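(* Suppose that $\alpha\in S_n$ has precisely three nontrivial cycles, of lengths $d_1\ge d_2\ge d_3$. Let $d_\infty$ be the number of fixed points of $\alpha$. Then $\alpha\in\mathrm{Aut}(n)$ if and only if one of the following cases holds: 1. $d_1=d_2=d_3$ and (a) $d_\infty\le 3d_1$, and (b) if $d_1$ is even then $d_\infty\ge 1$; 2. $d_1>d_2=d_3$ and (a) $d_1\ge 2d_2+d_\infty$, (b) $d_2$ divides $d_1$, (c) $d_\infty\le 2d_2$, and (d) if $d_2$ is even and $d_1/d_2$ is odd then $d_\infty>0$; 3. $d_1=d_2>d_3$ and (a) $d_3$ divides $d_1$, (b) $d_\infty\le d_3$, and (c) if $d_3$ is even then $d_\infty>0$; 4. $d_1>d_2>d_3$ and (a) $d_1=\mathrm{lcm}(d_2,d_3)$, (b) $d_3\ge d_\infty$, and (c) if $d_1$ is even then $d_\infty>0$; 5. $d_1>d_2>d_3$ and (a) $d_3$ divides $d_2$ which divides $d_1$, (b) $d_3\ge d_\infty$, and (c) if $d_3$ is even then $d_\infty>0$.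
   Context: A Latin square of order $n$ is an $n\times n$ array $L=L(i,j)$ with rows, columns and symbols indexed by $[n]=\{1,\dots,n\}$ such that the symbols in every row and in every column are distinct. $S_n$ is the symmetric group on $[n]$. A permutation $\alpha\in S_n$ is an automorphism of $L$ if $\alpha(L(i,j))=L(\alpha(i),\alpha(j))$ for all $i,j\in[n]$. $\mathrm{Aut}(n)$ denotes the set of all $\alpha\in S_n$ that are an automorphism of at least one Latin square of order $n$. A cycle of a permutation is nontrivial if its length is greater than one. *)

(* Defs.v *)
From mathcomp Require Import all_boot all_fingroup all_algebra.

Set Implicit Arguments.
Unset Strict Implicit.
Unset Printing Implicit Defensive.

(* The index set [n] is 'I_n, i.e. {0, ..., n-1}. *)

Definition latin_square (n : nat) (L : 'M['I_n]_n) : bool :=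
  [forall i, injectiveb (fun j => L i j)] &&
  [forall j, injectiveb (fun i => L i j)].

Definition is_automorphism (n : nat) (L : 'M['I_n]_n) (alpha : 'S_n) : bool :=
  [forall i, forall j, alpha (L i j) == L (alpha i) (alpha j)].

Definition AutLS (n : nat) : {set 'S_n} :=
  [set alpha : 'S_n |
    [exists L : 'M['I_n]_n, latin_square L && is_automorphism L alpha]].

(* With multiplicity, in unspecified order: compare with perm_eq. *)
Definition nontrivial_cycle_lengths (n : nat) (alpha : 'S_n) : seq nat :=
  [seq #|c| | c : {set 'I_n} <- enum (porbits alpha) & 1 < #|c|].

Definition fixed_points (n : nat) (alpha : 'S_n) : {set 'I_n} :=
  [set i | alpha i == i].

(* Main.v *)
(** Idea.
    Necessity: for an automorphism [a], the points fixed by [a ^ k] span a subsquare, and a proper subsquare has at most half the order of the square containing it. Multiplying the subsquare of [a ^ d] by a point outside it sends whole cycles to cycles, which forces the divisibility conditions and the lcm. If all cycles in a subsquare without fixed points have lengths divisible by an even [d], label the points by [Z/d] along the cycles; summing the labels of all products in two ways shows that the number of points with label 0 is even.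
    Sufficiency: a Latin square is an orthogonal array of triples (row, column, symbol), and an invariant one is given by representatives of the orbits of triples. Take the longest cycle (or both, if two are equal and long) to be a free orbit of a group [G], and start from a complete mapping [s i = c i + r i] of [G], or one that fails at a single index when [G] is cyclic of even order. Deleting the orbits of triples indexed by a set [K] and replacing each by three orbits of triples with one entry outside the long cycle prolongs the square, provided that the values of [c], [s] and [r] on [K] can be cut into residue systems modulo the lengths of the shorter cycles; a residue system modulo an even length has the wrong sum, which is repaired by exchanging one element with a fixed point or with the residue system of another cycle. When the longest length is the lcm of the other two, triples meeting all three cycles are needed as well: their entries in the two shorter cycles are paired so that the differences run over all residues modulo the gcd.
    Powers of automorphisms reduce several equal cycles to one cycle. *)

Require Import Defs.
From HB Require Import structures.
From mathcomp Require Import all_boot all_fingroup all_algebra zify.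
Set Implicit Arguments.
Unset Strict Implicit.
Unset Printing Implicit Defensive.
Import GRing.Theory.

(** * Latin squares with an automorphism *)

(** An orbit of triples with exactly one entry [y] outside the long cycle is given by [y] and the
    difference [g] of the other two entries. Normalised at the first of these it shows [y], at the
    second [y - g], and both must permute the outside points. On a cycle of even length the sum of
    all residues forbids this for a complete residue system, just as it denies a cyclic group of
    even order a complete mapping. A fixed point imposes no such condition, so it can absorb the
    element left over; without fixed points two cycles have to absorb each other's, and this works
    only under divisibility conditions involving [e / 2] or [H]. In the lcm case let the lengths be
    [D = lcm(P, Q)] and [G = gcd(P, Q)]. Pairs with one entry in each shorter cycle form exactly [G]
    orbits, all of length [D]. This fixes the number of triples through all three cycles, and leaves
    [P - G] and [Q - G] points of the shorter cycles to triples with two long entries. *)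

Definition latin_op (T : Type) (op : T -> T -> T) : Prop :=
  (forall x, injective (op x)) /\ (forall y, injective (op^~ y)).

Definition realizable (T : Type) (a : T -> T) : Prop :=
  exists op : T -> T -> T,
    latin_op op /\ forall x y, a (op x y) = op (a x) (a y).

Lemma realizable_transfer (T T' : Type) (a : T -> T) (a' : T' -> T')
    (f : T' -> T) :
  bijective f -> (forall x, f (a' x) = a (f x)) ->
  realizable a -> realizable a'.
Proof.
case=> g fK gK fa [op [[opr opc] opa]].
have gi := can_inj gK.
exists (fun x y => g (op (f x) (f y))); split; first split.
- by move=> x y z /gi /opr /(can_inj fK).
- by move=> y x z /gi /opc /(can_inj fK).
move=> x y; apply: (can_inj fK).
by rewrite gK fa gK opa !fa.
Qed.

Lemma realizable_iter (T : Type) (a : T -> T) k :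
  realizable a -> realizable (iter k a).
Proof.
case=> op [opL opa]; exists op; split=> // x y.
by elim: k => //= k ->; rewrite opa.
Qed.

(* A Latin square of order [n] is an orthogonal array: [n ^ 2] triples, any two of whose coordinates determine the third. *)
Lemma realizable_OA (T Th : finType) (a : T -> T) (b : Th -> Th)
    (R C S : Th -> T) :
  #|T| ^ 2 <= #|Th| ->
  (forall u v, R u = R v -> C u = C v -> u = v) ->
  (forall u v, R u = R v -> S u = S v -> u = v) ->
  (forall u v, C u = C v -> S u = S v -> u = v) ->
  (forall u, R (b u) = a (R u)) -> (forall u, C (b u) = a (C u)) ->
  (forall u, S (b u) = a (S u)) ->
  realizable a.
Proof.
move=> card_Th RC RS CS Rb Cb Sb.
have RCi : injective (fun u => (R u, C u)).
  by move=> u v [Ruv Cuv]; apply: RC.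
have [|g gK Kg] := inj_card_bij RCi.
  by rewrite card_prod mulnn.
have Rg x y : R (g (x, y)) = x by case: (Kg (x, y)).
have Cg x y : C (g (x, y)) = y by case: (Kg (x, y)).
have gE u x y : R u = x -> C u = y -> g (x, y) = u.
  by move=> <- <-; rewrite gK.
exists (fun x y => S (g (x, y))); split; first split.
- move=> x y z Sxyz; rewrite -[LHS](Cg x) -[RHS](Cg x).
  by congr (C _); apply: RS => //; rewrite !Rg.
- move=> y x z Sxyz; rewrite -[LHS](Rg x y) -[RHS](Rg z y).
  by congr (R _); apply: CS => //; rewrite !Cg.
move=> x y; rewrite -Sb; congr (S _); symmetry.
by apply: gE; rewrite ?Rb ?Cb ?Rg ?Cg.
Qed.

(** * Normal forms of permutations, given by their cycle lengths *)

Fixpoint model (s : seq nat) (f : nat) : finType :=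
  if s is d :: s' then ('I_d + model s' f)%type else 'I_f.

Fixpoint rotate s f : model s f -> model s f :=
  match s with
  | [::] => id
  | d :: s' => fun x : model (d :: s') f =>
      match x with inl i => inl (ordS i) | inr y => inr (rotate y) end
  end.

Lemma card_model s f : #|{: model s f}| = sumn s + f.
Proof.
elim: s => [|d s IHs] /=; first by rewrite card_ord.
by rewrite card_sum card_ord IHs addnA.
Qed.

Lemma val_iter_ordS d (i : 'I_d) k : iter k (@ordS d) i = (i + k) %% d :> nat.
Proof.
elim: k => [|k IHk] /=; first by rewrite addn0 modn_small.
by rewrite IHk -addn1 modnDml addn1 addnS.
Qed.

Lemma iter_inl (d : nat) s f k (i : 'I_d) :
  iter k (@rotate (d :: s) f) (inl i) = inl (iter k (@ordS d) i).
Proof. by elim: k => //= k ->. Qed.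

Lemma iter_inr (d : nat) s f k (y : model s f) :
  iter k (@rotate (d :: s) f) (inr y) = inr (iter k (@rotate s f) y).
Proof. by elim: k => //= k ->. Qed.

Lemma rotate_inj s f : injective (@rotate s f).
Proof.
elim: s => [|d s IHs] //= [i|x] [j|y] //=.
  by case=> e; rewrite (@ordS_inj _ i j) //; apply: val_inj.
by case=> /IHs ->.
Qed.

Lemma iter_rotate_dvd s f d (y : model s f) :
  all (fun e => e %| d) s -> iter d (@rotate s f) y = y.
Proof.
elim: s y => [|e s IHs] y /=; first by elim: d.
case/andP=> ed eds; case: y => [i|y]; last by rewrite iter_inr IHs.
rewrite iter_inl; congr inl; apply: val_inj => /=.
by rewrite val_iter_ordS -modnDmr (eqP ed) addn0 modn_small.
Qed.

Lemma iter_modn (T : Type) (h : T -> T) d k x :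
  iter d h x = x -> iter (k %% d) h x = iter k h x.
Proof.
move=> dx; rewrite [in RHS](divn_eq k d) addnC iterD; congr (iter _ _ _).
by elim: (k %/ d) => // m IHm; rewrite mulSn iterD -IHm dx.
Qed.

Lemma iter_rotate_mod s f d k (y : model s f) :
  all (fun e => e %| d) s -> iter (k %% d) (@rotate s f) y = iter k (@rotate s f) y.
Proof. by move=> eds; apply/iter_modn/iter_rotate_dvd. Qed.

(** Injectivity of [copair f g] says that both families are injective and never meet; the separation
    conditions on orbits of triples are mostly of this kind. *)
Definition copair (A B C : Type) (f : A -> C) (g : B -> C) (z : A + B) : C :=
  match z with inl a => f a | inr b => g b end.

Definition extend_act (G : zmodType) (Y : Type) (A : G -> Y -> Y) (g : G)
    (z : G + Y) : G + Y :=
  match z with inl x => inl (x + g)%R | inr y => inr (A g y) end.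

(* [X] is a free orbit of [G]. A family of [G]-orbits of triples is indexed by its representatives, one finite type for each of the seven patterns in which [X] occurs:
   [I0] = XXX, [Ic] = XXY, [Is] = XYX, [Ir] = YXX, [Jr] = XYY, [Jc] = YXY, [Js] = YYX.
   The triples of pattern YYY are given by [Th]. *)
Lemma realizable_extension (G : finZmodType) (Y : finType) (A : G -> Y -> Y)
    (I0 Ic Is Ir Jr Jc Js Th : finType)
    (c0 s0 r0 : I0 -> G) (cc : Ic -> G) (tc : Ic -> Y) (us : Is -> Y)
    (ss : Is -> G) (wr : Ir -> Y) (rr : Ir -> G) (uj tj : Jr -> Y)
    (wk tk : Jc -> Y) (wl ul : Js -> Y) (RT CT ST : Th -> Y) (b : Th -> Th)
    (g0 : G) :
  (forall y, A 0%R y = y) -> (forall x x' y, A (x + x')%R y = A x (A x' y)) ->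
  (#|G| + #|Y|) ^ 2 <=
    #|G| * (#|I0| + #|Ic| + #|Is| + #|Ir| + #|Jr| + #|Jc| + #|Js|) + #|Th| ->
  (forall i, s0 i = c0 i + r0 i)%R ->
  injective (copair c0 cc) -> injective (copair us uj) ->
  injective (copair wr wk) ->
  (forall x x' j j', A x (wl j) = A x' (wl j') -> A x (ul j) = A x' (ul j') ->
     x = x' /\ j = j') ->
  (forall x j u, A x (wl j) = RT u -> A x (ul j) = CT u -> False) ->
  (forall u v, RT u = RT v -> CT u = CT v -> u = v) ->
  injective (copair s0 ss) -> injective (copair tc tj) ->
  injective (copair (fun i => A (- rr i)%R (wr i)) wl) ->
  (forall x x' j j', A x (wk j) = A x' (wk j') -> A x (tk j) = A x' (tk j') ->
     x = x' /\ j = j') ->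
  (forall x j u, A x (wk j) = RT u -> A x (tk j) = ST u -> False) ->
  (forall u v, RT u = RT v -> ST u = ST v -> u = v) ->
  injective (copair r0 rr) ->
  injective (copair (fun i => A (- cc i)%R (tc i)) tk) ->
  injective (copair (fun i => A (- ss i)%R (us i)) ul) ->
  (forall x x' j j', A x (uj j) = A x' (uj j') -> A x (tj j) = A x' (tj j') ->
     x = x' /\ j = j') ->
  (forall x j u, A x (uj j) = CT u -> A x (tj j) = ST u -> False) ->
  (forall u v, CT u = CT v -> ST u = ST v -> u = v) ->
  (forall u, RT (b u) = A g0 (RT u)) -> (forall u, CT (b u) = A g0 (CT u)) ->
  (forall u, ST (b u) = A g0 (ST u)) ->
  realizable (extend_act A g0).
Proof.
move=> A0 AD cardT s0E RC1 RC2 RC3 RC4 RC5 RC6 RS1 RS2 RS3 RS4 RS5 RS6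
  CS1 CS2 CS3 CS4 CS5 CS6 Rb Cb Sb.
(* Moves along an orbit until another entry in [G] becomes the base point; the arguments [- rr i],
   [- cc i], [- ss i] of the hypotheses come from this change of representative. *)
have AN x y r : A x y = A (x + r)%R (A (- r)%R y) by rewrite -AD addrK.
have AI x : injective (A x).
  by move=> y z e; rewrite -[y]A0 -[z]A0 -(addNr x) !AD e.
have AC x y : A (x + g0)%R y = A g0 (A x y) by rewrite addrC AD.
pose F := (I0 + (Ic + (Is + (Ir + (Jr + (Jc + Js))))))%type.
pose fam_row (x : G) (z : F) : G + Y := match z with
  | inl _ | inr (inl _) | inr (inr (inl _))
  | inr (inr (inr (inr (inl _)))) => inl x
  | inr (inr (inr (inl i))) => inr (A x (wr i))
  | inr (inr (inr (inr (inr (inl j))))) => inr (A x (wk j))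
  | inr (inr (inr (inr (inr (inr l))))) => inr (A x (wl l)) end.
pose fam_col (x : G) (z : F) : G + Y := match z with
  | inl i => inl (x + c0 i)%R
  | inr (inl i) => inl (x + cc i)%R
  | inr (inr (inl i)) => inr (A x (us i))
  | inr (inr (inr (inl i))) => inl x
  | inr (inr (inr (inr (inl j)))) => inr (A x (uj j))
  | inr (inr (inr (inr (inr (inl j))))) => inl x
  | inr (inr (inr (inr (inr (inr l))))) => inr (A x (ul l)) end.
pose fam_sym (x : G) (z : F) : G + Y := match z with
  | inl i => inl (x + s0 i)%R
  | inr (inl i) => inr (A x (tc i))
  | inr (inr (inl i)) => inl (x + ss i)%R
  | inr (inr (inr (inl i))) => inl (x + rr i)%R
  | inr (inr (inr (inr (inl j)))) => inr (A x (tj j))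
  | inr (inr (inr (inr (inr (inl j))))) => inr (A x (tk j))
  | inr (inr (inr (inr (inr (inr l))))) => inl x end.
pose oa (fam : G -> F -> G + Y) (fT : Th -> Y) (u : (G * F + Th)%type) :=
  match u with inl z => fam z.1 z.2 | inr v => inr (fT v) end.
apply: (@realizable_OA _ (G * F + Th)%type _
  (fun u => match u with inl z => inl ((z.1 + g0)%R, z.2) | inr v => inr (b v) end)
  (oa fam_row RT) (oa fam_col CT) (oa fam_sym ST)).
- by rewrite !card_sum card_prod !card_sum !addnA.
- move=> [[x [i|[i|[i|[i|[i|[i|i]]]]]]]|u] [[y [j|[j|[j|[j|[j|[j|j]]]]]]]|v] //=.
  + by case=> <- [/addrI/(@RC1 (inl _) (inl _))[->]].
  + by case=> <- [/addrI/(@RC1 (inl _) (inr _))].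
  + by case=> <- [/addrI/(@RC1 (inr _) (inl _))].
  + by case=> <- [/addrI/(@RC1 (inr _) (inr _))[->]].
  + by case=> <- [/AI/(@RC2 (inl _) (inl _))[->]].
  + by case=> <- [/AI/(@RC2 (inl _) (inr _))].
  + by move=> e1 [e2]; move: e1; rewrite e2 => -[/AI/(@RC3 (inl _) (inl _))[->]].
  + by move=> e1 [e2]; move: e1; rewrite e2 => -[/AI/(@RC3 (inl _) (inr _))].
  + by case=> <- [/AI/(@RC2 (inr _) (inl _))].
  + by case=> <- [/AI/(@RC2 (inr _) (inr _))[->]].
  + by move=> e1 [e2]; move: e1; rewrite e2 => -[/AI/(@RC3 (inr _) (inl _))].
  + by move=> e1 [e2]; move: e1; rewrite e2 => -[/AI/(@RC3 (inr _) (inr _))[->]].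
  + by case=> e1 [/(RC4 _ _ _ _ e1)[-> ->]].
  + by case=> e1 [/(RC5 _ _ _ e1)].
  + by case=> e1 [e2]; case: (@RC5 y j u).
  + by case=> e1 [/(RC6 _ _ e1)->].
- move=> [[x [i|[i|[i|[i|[i|[i|i]]]]]]]|u] [[y [j|[j|[j|[j|[j|[j|j]]]]]]]|v] //=.
  + by case=> <- [/addrI/(@RS1 (inl _) (inl _))[->]].
  + by case=> <- [/addrI/(@RS1 (inl _) (inr _))].
  + by case=> <- [/AI/(@RS2 (inl _) (inl _))[->]].
  + by case=> <- [/AI/(@RS2 (inl _) (inr _))].
  + by case=> <- [/addrI/(@RS1 (inr _) (inl _))].
  + by case=> <- [/addrI/(@RS1 (inr _) (inr _))[->]].
  + rewrite (AN x _ (rr i)) (AN y _ (rr j)) => -[e1] [e2].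
    move: e1; rewrite e2 => /AI/(@RS3 (inl _) (inl _))[ij].
    by move: e2; rewrite ij => /addIr->.
  + rewrite (AN x _ (rr i)) => -[e1] [e2].
    by move: e1; rewrite e2 => /AI/(@RS3 (inl _) (inr _)).
  + by case=> <- [/AI/(@RS2 (inr _) (inl _))].
  + by case=> <- [/AI/(@RS2 (inr _) (inr _))[->]].
  + by case=> e1 [/(RS4 _ _ _ _ e1)[-> ->]].
  + by case=> e1 [/(RS5 _ _ _ e1)].
  + rewrite (AN y _ (rr j)) => -[e1] [e2].
    by move: e1; rewrite e2 => /AI/(@RS3 (inr _) (inl _)).
  + by move=> e1 [e2]; move: e1; rewrite e2 => -[/AI/(@RS3 (inr _) (inr _))[->]].
  + by case=> e1 [e2]; case: (@RS5 y j u).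
  + by case=> e1 [/(RS6 _ _ e1)->].
- have r0E i : (s0 i - c0 i)%R = r0 i by rewrite s0E addrC addKr.
  have XS x i : (x + s0 i)%R = (x + c0 i + r0 i)%R by rewrite s0E addrA.
  move=> [[x [i|[i|[i|[i|[i|[i|i]]]]]]]|u] [[y [j|[j|[j|[j|[j|[j|j]]]]]]]|v] //=.
  + rewrite !XS => -[e1] [e2].
    move: (e2); rewrite e1 => /addrI/(@CS1 (inl _) (inl _))[ij].
    by move: e1; rewrite ij => /addIr->.
  + by rewrite !XS => -[->] [/addrI/(@CS1 (inl _) (inr _))].
  + rewrite (AN x _ (cc i)) (AN y _ (cc j)) => -[e1] [e2].
    move: e2; rewrite e1 => /AI/(@CS2 (inl _) (inl _))[ij].
    by move: e1; rewrite ij => /addIr->.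
  + rewrite (AN x _ (cc i)) => -[->] [].
    by move=> /AI/(@CS2 (inl _) (inr _)).
  + rewrite (AN x _ (ss i)) (AN y _ (ss j)) => -[e1] [e2].
    move: e1; rewrite e2 => /AI/(@CS3 (inl _) (inl _))[ij].
    by move: e2; rewrite ij => /addIr->.
  + rewrite (AN x _ (ss i)) => -[e1] [e2].
    by move: e1; rewrite e2 => /AI/(@CS3 (inl _) (inr _)).
  + by rewrite !XS => -[->] [/addrI/(@CS1 (inr _) (inl _))].
  + by case=> <- [/addrI/(@CS1 (inr _) (inr _))[->]].
  + by case=> e1 [/(CS4 _ _ _ _ e1)[-> ->]].
  + by case=> e1 [/(CS5 _ _ _ e1)].
  + rewrite (AN y _ (cc j)) => -[<-] [].
    by move=> /AI/(@CS2 (inr _) (inl _)).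
  + by case=> <- [/AI/(@CS2 (inr _) (inr _))[->]].
  + rewrite (AN y _ (ss j)) => -[e1] [e2].
    by move: e1; rewrite e2 => /AI/(@CS3 (inr _) (inl _)).
  + by move=> e1 [e2]; move: e1; rewrite e2 => -[/AI/(@CS3 (inr _) (inr _))[->]].
  + by case=> e1 [e2]; case: (@CS5 y j u).
  + by case=> e1 [/(CS6 _ _ e1)->].
- by move=> [[x [i|[i|[i|[i|[i|[i|i]]]]]]]|u] //=; rewrite ?AC ?Rb.
- by move=> [[x [i|[i|[i|[i|[i|[i|i]]]]]]]|u] //=; rewrite ?AC ?Cb ?addrA // addrAC.
- by move=> [[x [i|[i|[i|[i|[i|[i|i]]]]]]]|u] //=; rewrite ?AC ?Sb ?addrA // addrAC.
Qed.

(* [psi y] is the deleted triple whose place is taken by the point [y] outside the long cycle, and [g] the difference of its two surviving entries: the triples obtained must give distinct orbits seen from either of these entries. *)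
Definition good (G : zmodType) d (pi : G -> 'I_d.+1) (I : finType) (g : I -> G)
    s f (K : {set I}) : Prop :=
  exists psi : model s f -> I,
    [/\ injective psi, forall y, psi y \in K &
        injective (fun y => iter (pi (- g (psi y))%R) (@rotate s f) y)].

(** Only patterns with at most one entry outside [G] occur besides those entirely outside, so three
    families are [void]. With [n] the order of [G] and [k] the size of [K], which is also the number
    of outside points, the count is [(n + k)^2 = n (n - k + 3 k) + k^2]. *)
Lemma realizable_good_extension (G : finZmodType) d (pi : G -> 'I_d.+1) s f
    (I : finType) (c sg r : I -> G) (K : {set I}) (g0 : G) :
  {morph pi : x y / (x + y)%R} -> pi g0 = 1 %% d.+1 :> nat ->
  all (fun e => e %| d.+1) s -> realizable (@rotate s f) ->
  injective c -> injective sg -> injective r ->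
  #|I| = #|G| -> #|K| = sumn s + f ->
  (forall i, i \notin K -> sg i = c i + r i)%R ->
  good pi c s f K -> good pi sg s f K -> good pi r s f K ->
  realizable (extend_act (fun x y => iter (pi x) (@rotate s f) y) g0).
Proof.
move=> piD pi1 sd [op [[opr opc] opa]] cI sgI rI cardI cardK sgE
  [pc [pcI pcK pcT]] [ps [psI psK psT]] [pr [prI prK prT]].
have pi0 : pi 0%R = 0%R by apply: (addrI (pi 0%R)); rewrite -piD !addr0.
have cp (g : I -> G) (p : model s f -> I) : injective g -> injective p ->
    (forall y, p y \in K) ->
    injective (copair (fun i : {i | i \notin K} => g (val i)) (fun y => g (p y))).
  move=> gI pI pK [[i iK]|y] [[j jK]|z] /= /gI.
  - by move=> ij; congr inl; apply: val_inj.
  - by move=> iz; case/negP: (iK); rewrite iz.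
  - by move=> yj; case/negP: (jK); rewrite -yj.
  - by move/pI->.
apply: (@realizable_extension G _ (fun x y => iter (pi x) (@rotate s f) y)
  {i | i \notin K} _ _ _ void void void (model s f * model s f)%type
  (fun i => c (val i)) (fun i => sg (val i)) (fun i => r (val i))
  (fun y => c (pc y)) id id (fun y => sg (ps y)) id (fun y => r (pr y))
  (of_void _) (of_void _) (of_void _) (of_void _) (of_void _) (of_void _)
  fst snd (fun u => op u.1 u.2)
  (fun u => (iter (pi g0) (@rotate s f) u.1, iter (pi g0) (@rotate s f) u.2)) g0).
- by move=> y; rewrite pi0.
- by move=> x x' y; rewrite piD /= iter_rotate_mod // iterD.
- have eK : #|{: {i | i \notin K}}| = #|G| - #|K|.
    by rewrite card_sig -cardI -(cardsC K) addKn; apply: eq_card => i; rewrite !inE.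
  have leK : #|K| <= #|G| by rewrite -cardI max_card.
  rewrite eK !card_void card_prod card_model -cardK; nia.
- by case=> i iK /=; rewrite sgE.
- exact: cp.
- by move=> [y|//] [z|//] /= ->.
- by move=> [y|//] [z|//] /= ->.
- by move=> x x' [].
- by move=> x [].
- by move=> [y z] [y' z'] /= -> ->.
- exact: cp.
- by move=> [y|//] [z|//] /= ->.
- by move=> [y|//] [z|//] /= /prT->.
- by move=> x x' [].
- by move=> x [].
- by move=> [y z] [y' z'] /= -> /opr ->.
- exact: cp.
- by move=> [y|//] [z|//] /= /pcT->.
- by move=> [y|//] [z|//] /= /psT->.
- by move=> x x' [].
- by move=> x [].
- by move=> [y z] [y' z'] /= -> /opc ->.
- by [].
- by [].
- move=> [y z] /=; elim: (nat_of_ord (pi g0)) => //= k IHk.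
  by rewrite -IHk opa.
Qed.

(** * Complete residue systems *)

Lemma eqmod_ex e a b : a = b %[mod e] -> exists k, a = b + k * e \/ b = a + k * e.
Proof.
(* One of the two truncated differences is 0, so their sum is the distance of the quotients. *)
move=> ab; exists (a %/ e - b %/ e + (b %/ e - a %/ e)).
have := divn_eq a e; have := divn_eq b e; rewrite ab.
case: (leqP (a %/ e) (b %/ e)) => h; [right|left]; nia.
Qed.

Lemma eqmod_small e a b : a = b %[mod e] -> a < b + e -> b < a + e -> a = b.
Proof. by case/eqmod_ex=> [[|k]] []; nia. Qed.

Lemma disjoint_setP (T : finType) (A B : {set T}) :
  (forall i, i \in A -> i \in B -> False) -> [disjoint A & B].
Proof.
move=> AB; rewrite disjoints_subset; apply/subsetP=> i iA; rewrite inE.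
by apply/negP => /(AB i iA).
Qed.

(** The condition of [good] on one cycle: [u - pi (g (phi u))] is injective modulo [e], with the
    subtraction cleared. *)
Definition cyclic_good (G : zmodType) d (pi : G -> 'I_d.+1) (I : finType)
    (g : I -> G) e (phi : 'I_e -> I) : Prop :=
  injective phi /\
  forall u v : 'I_e,
    u + pi (g (phi v)) = v + pi (g (phi u)) %[mod e] -> u = v.

Definition residue_system (G : zmodType) d (pi : G -> 'I_d.+1) (I : finType)
    (g : I -> G) e (idx : 'I_e -> I) : Prop :=
  forall u v : 'I_e, pi (g (idx u)) = pi (g (idx v)) %[mod e] -> u = v.

Section Good.
Variables (G : zmodType) (d : nat) (pi : G -> 'I_d.+1) (I : finType) (g : I -> G).
Hypothesis piD : {morph pi : x y / (x + y)%R}.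

Lemma good_nil f (K : {set I}) : f <= #|K| -> good pi g [::] f K.
Proof.
move=> fK; exists (fun i : 'I_f => enum_val (widen_ord fK i)); split.
- by move=> i j /enum_val_inj /(congr1 val) ij; apply: val_inj.
- by move=> i; apply: enum_valP.
have it k (y : 'I_f) : iter k id y = y by elim: k.
by move=> i j /=; rewrite !it.
Qed.

Lemma good_sub s f (K K' : {set I}) :
  K \subset K' -> good pi g s f K -> good pi g s f K'.
Proof.
move=> KK' [psi [psiI psiK psiT]]; exists psi; split=> // y.
exact: (subsetP KK').
Qed.

Lemma good_cons e s f (phi : 'I_e -> I) (K1 K2 : {set I}) :
  e %| d.+1 -> cyclic_good pi g phi -> (forall u, phi u \in K1) ->
  good pi g s f K2 -> [disjoint K1 & K2] -> good pi g (e :: s) f (K1 :|: K2).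
Proof.
move=> ed [phiI phiC] phiK [psi [psiI psiK psiT]] dis.
exists (fun y : model (e :: s) f => match y with inl u => phi u | inr y => psi y end).
have piN x : e %| pi (- x)%R + pi x.
  apply: (dvdn_trans ed); apply/eqP.
  have: pi (- x + x)%R = 0%R.
    by rewrite addNr; apply: (addrI (pi 0%R)); rewrite -piD !addr0.
  by rewrite piD => /(congr1 val).
split.
- move=> [u|y] [v|z] //= e1.
  + by congr inl; apply: phiI.
  + by move: (disjointFr dis (phiK u)); rewrite e1 psiK.
  + by move: (disjointFr dis (phiK v)); rewrite -e1 psiK.
  + by congr inr; apply: psiI.
- by move=> [u|y]; rewrite inE ?phiK ?psiK ?orbT.
move=> [u|y] [v|z]; rewrite ?iter_inl ?iter_inr //; last first.
  by case=> /psiT->.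
case=> /(congr1 val); rewrite /= !val_iter_ordS => uv.
congr inl; apply: phiC.
set x := g (phi u) in uv *; set y := g (phi v) in uv *.
have e1 : u + pi y = (u + pi (- x)%R) + (pi x + pi y) %[mod e].
  have -> : (u + pi (- x)%R) + (pi x + pi y) = u + pi y + (pi (- x)%R + pi x) by lia.
  by rewrite -[RHS]modnDmr (eqP (piN x)) addn0.
have e2 : v + pi x = (v + pi (- y)%R) + (pi x + pi y) %[mod e].
  have -> : (v + pi (- y)%R) + (pi x + pi y) = v + pi x + (pi (- y)%R + pi y) by lia.
  by rewrite -[RHS]modnDmr (eqP (piN y)) addn0.
by rewrite e1 e2 -modnDml uv modnDml.
Qed.

Lemma residue_system_inj e (idx : 'I_e -> I) : residue_system pi g idx -> injective idx.
Proof. by move=> sec u v uv; apply: sec; rewrite uv. Qed.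

Lemma residue_system_lift e (idx : 'I_e -> I) : 0 < e -> residue_system pi g idx ->
  exists2 inv : nat -> 'I_e, forall k, pi (g (idx (inv k))) = k %[mod e] &
    forall k u, pi (g (idx u)) = k %[mod e] -> inv k = u.
Proof.
move=> e0 sec.
pose rho u := Ordinal (ltn_pmod (pi (g (idx u))) e0).
have rhoI : injective rho by move=> u v /(congr1 val) /= /sec.
pose inv k := invF rhoI (Ordinal (ltn_pmod k e0)).
have invE k : rho (inv k) = Ordinal (ltn_pmod k e0) by apply: f_invF.
exists inv => [k|k u uk]; first by move/(congr1 val): (invE k).
by apply: (rhoI); rewrite invE; apply: val_inj; rewrite /= uk.
Qed.

(** Give the point [u] the element with residue [2 u]: for odd [e] both [2 u] and [u - 2 u = - u]
    run over all residues. *)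
Lemma cyclic_good_odd e (idx : 'I_e -> I) : odd e -> residue_system pi g idx ->
  exists2 phi, cyclic_good pi g phi & forall u : 'I_e, phi u \in [set idx v | v : 'I_e].
Proof.
move=> eo sec; have e0 := odd_gt0 eo.
have [inv invE _] := residue_system_lift e0 sec.
have ltn_u (u : 'I_e) := ltn_ord u.
exists (fun u : 'I_e => idx (inv u.*2)); last by move=> u; apply: imset_f.
split=> u v.
  move/(residue_system_inj sec)/(congr1 (fun w => pi (g (idx w)) %% e)).
  rewrite !invE => /eqmod_ex[k uv]; apply: val_inj => /=.
  have := ltn_u u; have := ltn_u v.
  by case: k uv => [|[|k]] uv; nia.
rewrite -modnDmr invE modnDmr -[RHS]modnDmr invE modnDmr => /eqmod_ex[k uv].
apply: val_inj => /=; have := ltn_u u; have := ltn_u v.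
by case: k uv => [|k] uv; nia.
Qed.

(* The even case cannot avoid the extra element [y]: the residues of a bijection [phi] with [phi u - u] bijective add up to 0 mod [e], those of a complete system to [e / 2]. *)
Lemma cyclic_good_even e (idx : 'I_e -> I) y : 0 < e -> ~~ odd e ->
  residue_system pi g idx -> (forall u, idx u != y) ->
  exists phi z, [/\ cyclic_good pi g phi,
    forall u : 'I_e, phi u \in y |: [set idx v | v : 'I_e] :\ idx z &
    pi (g (idx z)) = pi (g y) + e./2 %[mod e]].
Proof.
move=> e0 ee sec idxy; have [inv invE invK] := residue_system_lift e0 sec.
have ltn_u (u : 'I_e) := ltn_ord u.
(* [u - zeta u] is a bijection modulo [e], while [zeta] is 0 modulo [e] at [u = 0] and at
   [u = e - 1] and misses [e / 2]. So [y], of residue [w], serves [u = 0], and the element of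
   residue [w + e / 2] is left over. *)
pose zeta (u : nat) := if odd u then (u.+1)./2 + e./2 else u./2.
pose w := nat_of_ord (pi (g y)).
have zetaB (u v : 'I_e) : u + (w + zeta v) = v + (w + zeta u) %[mod e] -> u = v.
  move=> /eqmod_ex[k uv]; apply: val_inj => /=.
  move: uv; rewrite /zeta; have := ltn_u u; have := ltn_u v.
  by case: k => [|[|k]]; case: ifP; case: ifP; nia.
have zetaI (u v : 'I_e) : 0 < u -> 0 < v -> w + zeta u = w + zeta v %[mod e] -> u = v.
  move=> u0 v0 /eqmod_ex[k uv]; apply: val_inj => /=.
  move: uv; rewrite /zeta; have := ltn_u u; have := ltn_u v.
  by case: k => [|[|k]]; case: ifP; case: ifP; nia.
have zetaN (u : 'I_e) : 0 < u -> w + zeta u = w + e./2 %[mod e] -> False.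
  move=> u0 /eqmod_ex[k].
  rewrite /zeta; have := ltn_u u.
  by case: k => [|[|k]]; case: ifP; nia.
pose phi (u : 'I_e) := if u == 0 :> nat then y else idx (inv (w + zeta u)).
have phiE u : pi (g (phi u)) = w + zeta u %[mod e].
  rewrite /phi; case: eqP => [->|_]; first by rewrite /zeta addn0.
  exact: invE.
exists phi, (inv (w + e./2)); split; last exact: invE.
  split=> u v.
    rewrite /phi; case: eqP => u0; case: eqP => v0.
    + by move=> _; apply: val_inj; rewrite /= u0 v0.
    + by move=> e1; move: (idxy (inv (w + zeta v))); rewrite e1 eqxx.
    + by move=> e1; move: (idxy (inv (w + zeta u))); rewrite e1 eqxx.
    move/(residue_system_inj sec)/(congr1 (fun w => pi (g (idx w)) %% e)).
    by rewrite !invE; apply: zetaI; lia.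
  rewrite -modnDmr phiE modnDmr -[RHS]modnDmr phiE modnDmr; exact: zetaB.
move=> u; rewrite /phi; case: eqP => u0; rewrite !inE ?eqxx //.
rewrite imset_f // andbT (inj_eq (residue_system_inj sec)); apply/orP; right.
apply/eqP => /(congr1 (fun w => pi (g (idx w)) %% e)).
by rewrite !invE; apply: zetaN; lia.
Qed.

Fixpoint residue_systems (s : seq nat) (K : {set I}) : Prop :=
  if s is e :: s' then exists idx : 'I_e -> I,
    [/\ residue_system pi g idx, forall u, idx u \in K &
        residue_systems s' (K :\: [set idx u | u : 'I_e])]
  else True.

(** Each even cycle borrows an element of [F] and returns the one its residue system leaves over.
    The size of [F] is preserved, so a single fixed point serves all even cycles. *)
Lemma good_residue_systems s f (K F : {set I}) :
  all (fun e => 0 < e) s -> all (fun e => e %| d.+1) s ->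
  (0 < f) || all odd s ->
  residue_systems s K -> [disjoint K & F] -> f <= #|F| ->
  good pi g s f (K :|: F).
Proof.
elim: s K F => [|e s IHs] K F /=.
  move=> _ _ _ _ _ fF; apply: good_sub (subsetUr _ _) _; exact: good_nil.
case/andP=> e0 s0 /andP[ed sd] f0 [idx [sec idxK secs]] dis fF.
pose J := [set idx u | u : 'I_e].
have JK : J \subset K by apply/subsetP => _ /imsetP[u _ ->].
have [eo|ee] := boolP (odd e).
  have [phi phig phiJ] := cyclic_good_odd eo sec.
  have -> : K :|: F = J :|: ((K :\: J) :|: F).
    by rewrite setUA setDE setUIr setUCr setIT (setUidPr JK).
  apply: (good_cons ed phig phiJ).
    apply: IHs => //; first by case: (0 < f) f0 => //; rewrite eo.
    by apply: disjointWl dis; apply: subsetDl.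
  apply: disjoint_setP => i iJ; rewrite !inE iJ /=.
  by rewrite (disjointFr dis (subsetP JK i iJ)).
have f1 : 0 < f by move: f0; rewrite (negPf ee) orbF.
have [y yF] : exists y, y \in F by apply/card_gt0P; apply: leq_trans fF.
have yK : y \notin K by rewrite (disjointFl dis yF).
have idxy u : idx u != y by apply: contraNneq yK => <-.
have [phi [z [phig phiJ _]]] := cyclic_good_even e0 ee sec idxy.
have zK : idx z \in K := idxK z.
have zJ : idx z \in J by apply: imset_f.
have zF : idx z \notin F by rewrite (disjointFr dis zK).
have IH : good pi g s f ((K :\: J) :|: (idx z |: F :\ y)).
  apply: IHs => //; first by rewrite f1.
    apply: disjoint_setP => i; rewrite !inE => /andP[iJ iK].
    by rewrite (disjointFr dis iK) andbF orbF => /eqP iz; rewrite iz zJ in iJ.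
  by rewrite cardsU1 !inE (negPf zF) andbF; have := cardsD1 y F; rewrite yF; lia.
apply: good_sub (good_cons ed phig phiJ IH _).
  apply/subsetP=> i; rewrite !inE => /orP[/orP[/eqP->|/andP[_ /(subsetP JK)->]]|].
  - by rewrite yF orbT.
  - by [].
  by case/orP=> [/andP[_ ->]|/orP[/eqP->|/andP[_ ->]]] //; rewrite ?zK ?orbT.
apply: disjoint_setP => i; rewrite !inE; case/orP=> [/eqP->|/andP[iz iJ]].
  by rewrite (negPf yK) eqxx andbF /= orbF eq_sym (negPf (idxy z)).
by rewrite iJ (negPf iz) /= (disjointFr dis (subsetP JK i iJ)) andbF.
Qed.

End Good.

Lemma eqmod_dvd e d a b : e %| d -> a = b %[mod d] -> a = b %[mod e].
Proof. by move=> ed ab; rewrite -(modn_dvdm a ed) ab modn_dvdm. Qed.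

Lemma eqmod_mulI e lam c u v : coprime lam e -> u < e -> v < e ->
  c + lam * u = c + lam * v %[mod e] -> u = v.
Proof.
move=> co; wlog uv : u v / u <= v.
  move=> W ue ve E; case/orP: (leq_total u v) => uv; first exact: W.
  by apply/esym/W.
move=> ue ve /eqP; rewrite eqn_modDl eq_sym eqn_mod_dvd ?leq_mul2l ?uv ?orbT //.
rewrite -mulnBr Gauss_dvdr 1?coprime_sym // => /dvdn_leq; lia.
Qed.

Lemma exists_superset (T : finType) (A : {set T}) n :
  #|A| <= n -> n <= #|T| -> exists2 B : {set T}, A \subset B & #|B| = n.
Proof.
move=> An nT; elim: n An nT => [|n IHn] An nT.
  by exists A => //; apply/eqP; rewrite -leqn0.
case: (ltngtP #|A| n.+1) An => // [An _|An _]; last by exists A.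
have [B AB Bn] := IHn An (ltnW nT).
have [x xB] : exists x, x \notin B.
  have: 0 < #|~: B| by have := cardsC B; rewrite Bn; lia.
  by case/card_gt0P => x; rewrite inE; exists x.
exists (x |: B); first exact: subset_trans AB (subsetUr _ _).
by rewrite cardsU1 xB Bn.
Qed.

Lemma card_imset_ord n (T : finType) (h : 'I_n -> T) :
  #|[set h i | i : 'I_n]| <= n.
Proof. by rewrite (leq_trans (leq_imset_card _ _)) // cardT size_enum_ord. Qed.

Lemma even_sumn s : all (fun e => ~~ odd e) s -> ~~ odd (sumn s).
Proof.
by elim: s => //= e s IHs /andP[ee es]; rewrite oddD (negPf ee) IHs.
Qed.

(** * Residue systems from arithmetic progressions, and exchanges between cycles *)

Section Lines.
Variables (G : zmodType) (d : nat) (pi : G -> 'I_d.+1) (I : finType) (g : I -> G).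
Hypothesis piD : {morph pi : x y / (x + y)%R}.

(** A step coprime to every length makes any [e] consecutive terms a residue system modulo [e], so
    the progression is cut into blocks in the order of [s]. *)
Lemma residue_systems_line s (K : {set I}) (q : nat -> I) C lam :
  all (fun e => e %| d.+1) s -> all (coprime lam) s ->
  (forall i j, i < sumn s -> j < sumn s -> q i = q j -> i = j) ->
  (forall i, i < sumn s -> q i \in K) ->
  (forall i, i < sumn s -> pi (g (q i)) = C + lam * i %[mod d.+1]) ->
  residue_systems pi g s K.
Proof.
elim: s K q C => //= e s IHs K q C /andP[ed sd] /andP[eco sco] qI qK qE.
exists (fun u : 'I_e => q u); split.
- move=> u v.
  have ul := ltn_ord u; have vl := ltn_ord v.
  rewrite (eqmod_dvd ed (qE u _)) ?(eqmod_dvd ed (qE v _)); try lia.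
  by move=> uv; apply: val_inj; apply: eqmod_mulI uv.
- by move=> u; apply: qK; have := ltn_ord u; lia.
apply: (IHs _ (fun i => q (e + i)) (C + lam * e)) => //.
- by move=> i j il jl /qI; lia.
- move=> i il; rewrite inE qK ?andbT; last lia.
  apply/imsetP => -[u _ /qI]; have := ltn_ord u; lia.
by move=> i il; rewrite qE; [congr (_ %% _); lia|lia].
Qed.

(** A progression of step 2 stays in one parity class. For even [e], a residue system consists of
    [e / 2] consecutive terms from each of two such progressions of opposite parity. *)
Lemma residue_systems_pairs s (K : {set I}) (q0 q1 : nat -> I) C0 C1 :
  all (fun e => e %| d.+1) s -> all (fun e => ~~ odd e) s -> odd (C0 + C1) ->
  (forall i j, i < (sumn s)./2 -> j < (sumn s)./2 -> q0 i = q0 j -> i = j) ->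
  (forall i j, i < (sumn s)./2 -> j < (sumn s)./2 -> q1 i = q1 j -> i = j) ->
  (forall i j, i < (sumn s)./2 -> j < (sumn s)./2 -> q0 i <> q1 j) ->
  (forall i, i < (sumn s)./2 -> q0 i \in K) ->
  (forall i, i < (sumn s)./2 -> q1 i \in K) ->
  (forall i, i < (sumn s)./2 -> pi (g (q0 i)) = C0 + 2 * i %[mod d.+1]) ->
  (forall i, i < (sumn s)./2 -> pi (g (q1 i)) = C1 + 2 * i %[mod d.+1]) ->
  residue_systems pi g s K.
Proof.
elim: s K q0 q1 C0 C1 => //= e s IHs K q0 q1 C0 C1 /andP[ed sd] /andP[ee se] Co
  q0I q1I q01 q0K q1K q0E q1E.
have ev := even_sumn se.
exists (fun u : 'I_e => if u < e./2 then q0 u else q1 (u - e./2)); split.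
- move=> u v; have ul := ltn_ord u; have vl := ltn_ord v.
  case: ifP => ue; case: ifP => ve;
    rewrite ?(eqmod_dvd ed (q0E _ _)) ?(eqmod_dvd ed (q1E _ _)); try lia;
    by case/eqmod_ex=> [[|k]] uv; apply: val_inj => /=; nia.
- by move=> u; have := ltn_ord u; case: ifP => ue ul; [apply: q0K|apply: q1K]; lia.
apply: (IHs _ (fun i => q0 (e./2 + i)) (fun i => q1 (e./2 + i)) (C0 + e) (C1 + e)) => //.
- lia.
- by move=> i j il jl /q0I; lia.
- by move=> i j il jl /q1I; lia.
- by move=> i j il jl /q01; apply; lia.
- move=> i il; rewrite inE q0K ?andbT; last lia.
  apply/imsetP => -[u _]; have ul := ltn_ord u.
  by case: ifP => ue; [move/q0I; lia|move/q01; apply; lia].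
- move=> i il; rewrite inE q1K ?andbT; last lia.
  apply/imsetP => -[u _]; have ul := ltn_ord u.
  by case: ifP => ue; [move/esym/q01; apply; lia|move/q1I; lia].
- by move=> i il; rewrite q0E; [congr (_ %% _); lia|lia].
by move=> i il; rewrite q1E; [congr (_ %% _); lia|lia].
Qed.

Lemma good_of_residue_systems s f (K0 K : {set I}) :
  all (fun e => 0 < e) s -> all (fun e => e %| d.+1) s ->
  (0 < f) || all odd s -> residue_systems pi g s K0 -> K0 \subset K ->
  #|K0| <= sumn s -> sumn s + f <= #|K| -> good pi g s f K.
Proof.
move=> s0 sd fs secs K0K cK0 cK.
have <- : K0 :|: K :\: K0 = K by rewrite -{1}(setIidPr K0K) setID.
apply: good_residue_systems => //; first by apply: disjoint_setP => i iK; rewrite inE iK.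
by rewrite cardsD (setIidPr K0K); lia.
Qed.

Lemma good_line s f (K : {set I}) (q : nat -> I) C lam :
  all (fun e => 0 < e) s -> all (fun e => e %| d.+1) s ->
  (0 < f) || all odd s -> all (coprime lam) s ->
  (forall i j, i < sumn s -> j < sumn s -> q i = q j -> i = j) ->
  (forall i, i < sumn s -> q i \in K) ->
  (forall i, i < sumn s -> pi (g (q i)) = C + lam * i %[mod d.+1]) ->
  sumn s + f <= #|K| -> good pi g s f K.
Proof.
move=> s0 sd fs sco qI qK qE cK.
apply: (@good_of_residue_systems s f [set q (val i) | i : 'I_(sumn s)]) => //.
- apply: (@residue_systems_line s _ q C lam) => // i il; apply/imsetP.
  by exists (Ordinal il).
- by apply/subsetP => _ /imsetP[i _ ->]; apply: qK (ltn_ord i).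
exact: card_imset_ord.
Qed.

Lemma good_pairs s f (K : {set I}) (q0 q1 : nat -> I) C0 C1 :
  all (fun e => 0 < e) s -> all (fun e => e %| d.+1) s ->
  0 < f -> all (fun e => ~~ odd e) s -> odd (C0 + C1) ->
  (forall i j, i < (sumn s)./2 -> j < (sumn s)./2 -> q0 i = q0 j -> i = j) ->
  (forall i j, i < (sumn s)./2 -> j < (sumn s)./2 -> q1 i = q1 j -> i = j) ->
  (forall i j, i < (sumn s)./2 -> j < (sumn s)./2 -> q0 i <> q1 j) ->
  (forall i, i < (sumn s)./2 -> q0 i \in K) ->
  (forall i, i < (sumn s)./2 -> q1 i \in K) ->
  (forall i, i < (sumn s)./2 -> pi (g (q0 i)) = C0 + 2 * i %[mod d.+1]) ->
  (forall i, i < (sumn s)./2 -> pi (g (q1 i)) = C1 + 2 * i %[mod d.+1]) ->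
  sumn s + f <= #|K| -> good pi g s f K.
Proof.
move=> s0 sd f0 se Co q0I q1I q01 q0K q1K q0E q1E cK.
apply: (@good_of_residue_systems s f ([set q0 (val i) | i : 'I_(sumn s)./2] :|:
  [set q1 (val i) | i : 'I_(sumn s)./2])) => //; first by rewrite f0.
- apply: (@residue_systems_pairs s _ q0 q1 C0 C1) => // i il; apply/setUP.
    by left; apply/imsetP; exists (Ordinal il).
  by right; apply/imsetP; exists (Ordinal il).
- apply/subsetP => _ /setUP[] /imsetP[i _ ->].
    exact: q0K (ltn_ord i).
  exact: q1K (ltn_ord i).
rewrite (leq_trans (leq_card_setU _ _)) //.
have := card_imset_ord (fun i : 'I_(sumn s)./2 => q0 (val i)).
have := card_imset_ord (fun i : 'I_(sumn s)./2 => q1 (val i)).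
by have := odd_double_half (sumn s); lia.
Qed.

(** Two cycles take over each other's left-over element, so no fixed point is spent. *)
Lemma good_exchange e' e f (phi : 'I_e' -> I) (psi : 'I_e -> I) y z
    (J1 J2 K : {set I}) :
  e' %| d.+1 -> e %| d.+1 -> cyclic_good pi g phi -> cyclic_good pi g psi ->
  [disjoint J1 & J2] -> z \in J1 -> y \in J2 ->
  (forall u, phi u \in y |: J1 :\ z) -> (forall u, psi u \in z |: J2 :\ y) ->
  J1 :|: J2 \subset K -> f + #|J1 :|: J2| <= #|K| -> good pi g [:: e'; e] f K.
Proof.
move=> e'd ed phig psig J12 zJ yJ phiJ psiJ JK cK.
have zJ2 : z \notin J2 by rewrite (disjointFr J12 zJ).
have yJ1 : y \notin J1 by rewrite (disjointFl J12 yJ).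
have G2 : good pi g [:: e] f ((z |: J2 :\ y) :|: (K :\: (J1 :|: J2))).
  apply: (good_cons piD ed psig psiJ).
    by apply: good_nil; rewrite cardsD (setIidPr JK); lia.
  apply: disjoint_setP => i; rewrite !inE.
  by case/orP=> [/eqP->|/andP[_ ->]]; rewrite ?zJ ?orbT.
apply: good_sub (good_cons piD e'd phig phiJ G2 _).
  apply/subsetP=> i iU; have [//|iK] := boolP (i \in K).
  have: i \notin J1 :|: J2 by apply: contra iK; apply: (subsetP JK).
  move: iU; rewrite !inE (negPf iK) andbF orbF negb_or.
  by case/orP=> /orP[/eqP->|/andP[_ ->]] //; rewrite ?zJ ?yJ ?andbF.
apply: disjoint_setP => i; rewrite !inE.
case/orP=> [/eqP->|/andP[iz iJ]].
  by rewrite eqxx yJ orbT /= !orbF => /eqP yz; move: yJ; rewrite yz (negPf zJ2).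
by rewrite (negPf iz) iJ (disjointFr J12 iJ) /= ?andbF.
Qed.

Lemma disjoint_codom e' e (idx1 : 'I_e' -> I) (idx2 : 'I_e -> I) :
  (forall u v, idx1 u != idx2 v) ->
  [disjoint [set idx1 u | u : 'I_e'] & [set idx2 u | u : 'I_e]].
Proof.
move=> dis; apply: disjoint_setP => i /imsetP[u _ ->] /imsetP[v _ /eqP].
by rewrite (negPf (dis u v)).
Qed.

Lemma card_codomU e' e (idx1 : 'I_e' -> I) (idx2 : 'I_e -> I) :
  #|[set idx1 u | u : 'I_e'] :|: [set idx2 u | u : 'I_e]| <= e' + e.
Proof.
by rewrite (leq_trans (leq_card_setU _ _)) // leq_add // card_imset_ord.
Qed.

(** The even cycle borrows [y] from the odd one and leaves over an element with residue
    [y + e' / 2]. The odd [e] divides [e' / 2], so this element replaces [y] modulo [e]. *)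
Lemma good_swap_odd e' e f (idx1 : 'I_e' -> I) (idx2 : 'I_e -> I) (K : {set I}) :
  0 < e' -> ~~ odd e' -> odd e -> e %| e' -> e' %| d.+1 ->
  residue_system pi g idx1 -> residue_system pi g idx2 -> (forall u v, idx1 u != idx2 v) ->
  (forall u, idx1 u \in K) -> (forall u, idx2 u \in K) ->
  e' + e + f <= #|K| -> good pi g [:: e'; e] f K.
Proof.
move=> e'0 e'e eo ee' e'd sec1 sec2 dis K1 K2 cK.
have e0 := odd_gt0 eo; pose u0 := Ordinal e0.
have [phi [z [phig phiJ zE]]] :=
  cyclic_good_even e'0 e'e sec1 (fun u => dis u u0).
pose idx3 (u : 'I_e) := if u == u0 then idx1 z else idx2 u.
have sec3E u : pi (g (idx3 u)) = pi (g (idx2 u)) %[mod e].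
  rewrite /idx3; case: eqP => [->|//].
  rewrite (eqmod_dvd ee' zE) -modnDmr.
  suff /eqP-> : e %| e'./2 by rewrite addn0.
  by rewrite -(@Gauss_dvdr e 2) ?coprimen2 // mul2n halfK (negPf e'e) subn0.
have sec3 : residue_system pi g idx3 by move=> u v; rewrite !sec3E; apply: sec2.
have [psi psig psiJ] := cyclic_good_odd eo sec3.
apply: (good_exchange (z := idx1 z) e'd (dvdn_trans ee' e'd) phig psig
  (disjoint_codom dis) _ _ phiJ).
- exact: imset_f.
- exact: imset_f.
- move=> u; have /imsetP[v _ ->] := psiJ u.
  rewrite /idx3; case: (v =P u0) => [_|/eqP vu0]; rewrite !inE ?eqxx //.
  by rewrite imset_f // (inj_eq (residue_system_inj sec2)) vu0 orbT.
- by apply/subsetP => i /setUP[] /imsetP[u _ ->].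
by have := card_codomU idx1 idx2; lia.
Qed.

(** The first cycle borrows [y] and leaves over [z] with residue [y + e / 2]; the second borrows [z]
    and leaves over residue [y + e], which is [y] itself. *)
Lemma good_swap_even e f (idx1 idx2 : 'I_e -> I) (K : {set I}) :
  0 < e -> ~~ odd e -> e %| d.+1 ->
  residue_system pi g idx1 -> residue_system pi g idx2 -> (forall u v, idx1 u != idx2 v) ->
  (forall u, idx1 u \in K) -> (forall u, idx2 u \in K) ->
  e + e + f <= #|K| -> good pi g [:: e; e] f K.
Proof.
move=> e0 ee ed sec1 sec2 dis K1 K2 cK.
pose u0 := Ordinal e0.
have [phi [z [phig phiJ zE]]] :=
  cyclic_good_even e0 ee sec1 (fun u => dis u u0).
have dis2 u : idx2 u != idx1 z by rewrite eq_sym dis.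
have [psi [t [psig psiJ tE]]] := cyclic_good_even e0 ee sec2 dis2.
have tu0 : t = u0.
  apply: sec2; rewrite tE -modnDml zE modnDml -addnA addnn halfK (negPf ee) subn0.
  by rewrite modnDr.
rewrite tu0 in psiJ.
apply: (good_exchange (z := idx1 z) ed ed phig psig (disjoint_codom dis) _ _ phiJ psiJ).
- exact: imset_f.
- exact: imset_f.
- by apply/subsetP => i /setUP[] /imsetP[u _ ->].
by have := card_codomU idx1 idx2; lia.
Qed.

End Lines.

Ltac slia := repeat match goal with
  | H : is_true (all _ _) |- _ => clear H
  | H : is_true (dvdn _ _) |- _ => clear H
  | H : is_true (odd _) |- _ => clear H
  | H : is_true (_ \subset _) |- _ => clear H
  end; lia.

Lemma eqmodI e a b k : a = b + k * e -> a = b %[mod e].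
Proof. by move=> ->; rewrite addnC modnMDl. Qed.

Lemma residue_system_line (G : zmodType) d (pi : G -> 'I_d.+1) (I : finType) (g : I -> G)
    e (idx : 'I_e -> I) C lam : coprime lam e ->
  (forall u : 'I_e, pi (g (idx u)) = C + lam * u %[mod e]) -> residue_system pi g idx.
Proof.
move=> co idxE u v; rewrite !idxE => uv.
by apply: val_inj; apply: eqmod_mulI uv.
Qed.

(** * One long cycle *)

Lemma realizable_cycle d s f (c sg r : 'I_d.+1 -> 'I_d.+1) (K : {set 'I_d.+1}) :
  all (fun e => e %| d.+1) s -> realizable (@rotate s f) ->
  injective c -> injective sg -> injective r -> #|K| = sumn s + f ->
  (forall i, i \notin K -> sg i = c i + r i)%R ->
  good id c s f K -> good id sg s f K -> good id r s f K ->
  realizable (@rotate (d.+1 :: s) f).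
Proof.
move=> sd realY cI sgI rI cardK sgE gc gs gr.
pose g0 : 'I_d.+1 := inZp 1.
have := realizable_good_extension (pi := id) (g0 := g0) (fun x y => erefl) erefl sd
  realY cI sgI rI (erefl _) cardK sgE gc gs gr.
apply: (@realizable_transfer _ _ _ _ id); first by exists id.
case=> [i|y] /=.
  by congr inl; apply: val_inj; rewrite /= modnDmr addn1.
by congr inr; rewrite iter_rotate_mod.
Qed.

(** In odd order [c] and [r] can be the identity, as doubling is injective. On an initial segment
    they have steps 1 and 2, both coprime to the odd lengths in [s]. *)
Lemma realizable_cycle_odd d s f : odd d -> all (fun e => e %| d) s ->
  sumn s + f <= d -> realizable (@rotate s f) -> realizable (@rotate (d :: s) f).
Proof.
case: d => // d od sd sfd realY.
have so : all odd s by apply: sub_all sd => e /dvdn_odd; apply.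
have s0 : all (fun e => 0 < e) s by apply: sub_all so => e /odd_gt0.
pose J := [set (inord (val i) : 'I_d.+1) | i : 'I_(sumn s)].
have [||K sK cK] := @exists_superset _ J (sumn s + f).
- by rewrite (leq_trans (card_imset_ord _)) // leq_addr.
- by rewrite card_ord.
have lined (g : 'I_d.+1 -> 'I_d.+1) lam : all (coprime lam) s ->
    (forall i, g i = lam * i %[mod d.+1]) -> good id g s f K.
  move=> sco gE; apply: (@good_line _ _ id _ g _ s f K inord 0 lam) => //.
  - by rewrite so orbT.
  - by move=> i j il jl /(congr1 val) /=; rewrite !inordK //; lia.
  - by move=> i il; apply: (subsetP sK); apply/imsetP; exists (Ordinal il).
  - by move=> i il; rewrite gE inordK //; lia.
  by rewrite cK.
have s1 : all (coprime 1) s by apply/allP => e _; rewrite coprime1n.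
apply: (@realizable_cycle d s f id (fun i => i + i)%R id K) => //.
- move=> i j /(congr1 val) /= /eqmod_ex[k ij].
  apply: val_inj => /=; have := ltn_ord i; have := ltn_ord j.
  by case: k ij => [|[|k]]; nia.
- by apply: (lined _ 1) => // i; rewrite mul1n.
- apply: (lined _ 2) => [|i /=]; last by rewrite modn_mod mul2n addnn.
  by apply: sub_all so => e; rewrite coprime2n.
by apply: (lined _ 1) => // i; rewrite mul1n.
Qed.

(* A transversal of the cyclic group of even order [2 H] missing one cell: [near_s H i = i + near_r H i] modulo [2 H], except for [i = 2 H - 1]. *)
Definition near_s H i := if i < H then 2 * i else 2 * i + 1 - 2 * H.
Definition near_r H i := if i < H then i else if i.+1 < 2 * H then i.+1 else H.

Section NearTransversal.
Variables (d H : nat).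
Hypothesis dH : d.+1 = 2 * H.
Let c : 'I_d.+1 -> 'I_d.+1 := id.
Let sg (i : 'I_d.+1) : 'I_d.+1 := inord (near_s H i).
Let r (i : 'I_d.+1) : 'I_d.+1 := inord (near_r H i).

Lemma near_s_inord i : i < d.+1 -> sg (inord i) = near_s H i :> nat.
Proof. by move=> il; rewrite /sg !inordK // /near_s; case: ifP; slia. Qed.

Lemma near_r_inord i : i < d.+1 -> r (inord i) = near_r H i :> nat.
Proof. by move=> il; rewrite /r !inordK // /near_r; do 2?case: ifP; slia. Qed.

Lemma near_s_inj : injective sg.
Proof.
move=> i j /(congr1 val); rewrite /= -[i]inord_val -[j]inord_val.
rewrite !near_s_inord // /near_s => ij; congr inord; move: ij.
by do 2?case: ifP; have := ltn_ord i; have := ltn_ord j; slia.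
Qed.

Lemma near_r_inj : injective r.
Proof.
move=> i j /(congr1 val); rewrite /= -[i]inord_val -[j]inord_val.
rewrite !near_r_inord // /near_r => ij; congr inord; move: ij.
by do 4?case: ifP; have := ltn_ord i; have := ltn_ord j; slia.
Qed.

Lemma near_sE i : i != inord d -> (sg i = i + r i)%R.
Proof.
move=> id_; have ild := ltn_ord i.
have {}id_ : nat_of_ord i <> d.
  by move=> iE; case/eqP: id_; rewrite -[LHS]inord_val iE.
apply: val_inj; rewrite /= -[in LHS](inord_val i) -[X in r X](inord_val i).
rewrite near_s_inord // near_r_inord // /near_s /near_r.
case: ifP => iH; first by rewrite modn_small; slia.
have -> : i.+1 < 2 * H by slia.
have -> : i + i.+1 = (2 * i + 1 - 2 * H) + d.+1 by slia.
by rewrite modnDr modn_small; slia.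
Qed.

Lemma realizable_cycle_even s f (K : {set 'I_d.+1}) :
  all (fun e => e %| d.+1) s -> realizable (@rotate s f) ->
  #|K| = sumn s + f -> inord d \in K ->
  good id c s f K -> good id sg s f K -> good id r s f K ->
  realizable (@rotate (d.+1 :: s) f).
Proof.
move=> sd realY cK dK; apply: realizable_cycle => //.
- exact: near_s_inj.
- exact: near_r_inj.
by move=> i iK; apply: near_sE; apply: contraNneq iK => ->.
Qed.

(** [near_s] and [near_r] break at [H], so the window is placed there: its symbols are even on the
    left and odd on the right, and [near_r] takes the consecutive values from [H - u] to [H + v],
    with [d] supplying the value [H] (for [v < H]). *)
Definition near_base u v : {set 'I_d.+1} :=
  [set i : 'I_d.+1 | (H - u <= i < H + v) || (i == d :> nat)].

Lemma near_baseE u v i : i <= d ->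
  (inord i \in near_base u v) = (H - u <= i < H + v) || (i == d).
Proof. by move=> il; rewrite inE !inordK. Qed.

Lemma near_base_superset u v n : u <= H -> u + v < n -> n <= d.+1 ->
  exists2 K : {set 'I_d.+1}, near_base u v \subset K & #|K| = n.
Proof.
move=> uH un nd; apply: exists_superset; last by rewrite card_ord.
apply: (@leq_trans (u + v).+1) => //.
pose h (i : 'I_(u + v).+1) : 'I_d.+1 := inord (if i < u + v then H - u + i else d).
apply: (leq_trans _ (card_imset_ord h)); apply: subset_leq_card.
apply/subsetP => i; rewrite inE => /orP[iH|/eqP iE]; apply/imsetP.
  exists (inord (i - (H - u))); rewrite ?inE //; apply: val_inj.
  have ild := ltn_ord i.
  by rewrite /h /= (inordK (_ : i - (H - u) < _)) ?ifT ?inordK; slia.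
exists ord_max; rewrite ?inE //; apply: val_inj.
by rewrite /h /= ltnn inordK.
Qed.

(** The exceptional index [d] has to lie in [K]. Since [e] divides [H], the values of [c], [sg] and
    [r] at [d = 2 H - 1] continue, modulo [e], their progressions on the indices from [H] on. So [d]
    completes the residue system of the cycle [e], and [s] uses indices below [H]. *)
Lemma realizable_cycle_even_oddY e s f :
  all odd (e :: s) -> all (fun e => e %| d.+1) (e :: s) -> sumn s <= H ->
  e + sumn s + f <= d.+1 -> realizable (@rotate (e :: s) f) ->
  realizable (@rotate (d.+1 :: e :: s) f).
Proof.
move=> odds sd uH sfd realY; case/andP: (odds) => eo so; case/andP: (sd) => ed sd'.
have e0 := odd_gt0 eo.
have eH : e %| H by rewrite -(@Gauss_dvdr e 2) ?coprimen2 // -dH.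
have [k Hk] := dvdnP eH.
have k0 : 0 < k by case: k Hk; slia.
have eleH : e <= H by nia.
have [|||K BK cK] := @near_base_superset (sumn s) e.-1 (e + sumn s + f); try slia.
have inK i : i <= d -> (H - sumn s <= i < H + e.-1) || (i == d) -> inord i \in K.
  by move=> il iB; apply: (subsetP BK); rewrite near_baseE.
pose ix j := if j < e.-1 then H + j else d.
pose idx (u : 'I_e) : 'I_d.+1 := inord (ix u).
have lined (g : 'I_d.+1 -> 'I_d.+1) C1 C2 lam : all (coprime lam) (e :: s) ->
    (forall j, j < e -> g (inord (ix j)) = C1 + lam * j %[mod e]) ->
    (forall j, j < sumn s -> g (inord (H - sumn s + j)) = C2 + lam * j %[mod d.+1]) ->
    good id g (e :: s) f K.
  move=> /= /andP[eco sco] gE1 gE2.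
  apply: (@good_of_residue_systems _ _ id _ g (fun x y => erefl) (e :: s) f
            [set i : 'I_d.+1 | (H - sumn s <= i < H + e.-1) || (i == d :> nat)]) => //.
  - by apply: sub_all odds => x /odd_gt0.
  - by rewrite odds orbT.
  - exists idx; split.
    + apply: (residue_system_line (C := C1) eco) => u; apply: gE1; exact: ltn_ord.
    + move=> u; have := ltn_ord u; rewrite /idx /ix; case: ifP => h ul;
      rewrite (near_baseE (sumn s)); slia.
    apply: (@residue_systems_line _ _ id _ g s _ (fun j => inord (H - sumn s + j)) C2 lam) => //.
    + move=> i j il jl /(congr1 val) /=; rewrite !inordK; slia.
    move=> i il; rewrite inE (near_baseE (sumn s)); last slia.
    apply/andP; split; last slia.
    apply/imsetP => -[u _ /(congr1 val)]; rewrite /= /idx /ix.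
    by have := ltn_ord u; case: ifP => h ul; rewrite !inordK; slia.
  - have [|||K' BK' cK'] := @near_base_superset (sumn s) e.-1 (e + sumn s); try slia.
    by rewrite /= -cK'; apply: subset_leq_card.
  by rewrite cK.
have co1 : all (coprime 1) (e :: s) by apply/allP => x _; rewrite coprime1n.
apply: (@realizable_cycle_even _ f K) => //.
- by apply: inK => //; rewrite eqxx orbT.
- apply: (lined _ H (H - sumn s) 1) => // j jl; rewrite mul1n.
    rewrite /c inordK /ix; case: ifP => h //; try slia.
    by apply: (@eqmodI _ _ _ k.-1); nia.
  by rewrite /c inordK //; slia.
- apply: (lined _ 1 (d.+1 - 2 * sumn s) 2).
  + by apply: sub_all odds => x; rewrite coprime2n.
  + move=> j jl; rewrite /ix; case: (ltnP j e.-1) => h; rewrite near_s_inord /near_s; try slia.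
      by rewrite ifF; [congr (_ %% _)|]; slia.
    rewrite ifF; last slia.
    by apply: (@eqmodI _ _ _ (2 * k.-1)); nia.
  move=> j jl; rewrite near_s_inord /near_s; last slia.
  by rewrite ifT; [congr (_ %% _)|]; slia.
apply: (lined _ H.+1 (H - sumn s) 1) => // j jl; rewrite mul1n.
  rewrite /ix; case: (ltnP j e.-1) => h; rewrite near_r_inord /near_r; try slia.
    by rewrite ifF ?ifT; [congr (_ %% _)| |]; slia.
  rewrite ifF ?ifF; try slia.
  by apply/esym; apply: (@eqmodI _ _ _ 1); nia.
by rewrite near_r_inord /near_r ?ifT //; slia.
Qed.

(** The window has equal halves on both sides of [H], so the symbols supply the two progressions of
    opposite parity that [good_pairs] asks for. *)
Lemma realizable_cycle_even_evenY s f :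
  all (fun e => 0 < e) s -> all (fun e => ~~ odd e) s ->
  all (fun e => e %| d.+1) s -> 0 < f ->
  sumn s + f <= d.+1 -> realizable (@rotate s f) ->
  realizable (@rotate (d.+1 :: s) f).
Proof.
move=> s0 se sd f0 sfd realY.
have ev := even_sumn se.
set u := (sumn s)./2; have su : sumn s = 2 * u by slia.
have [|||K BK cK] := @near_base_superset u u (sumn s + f); try slia.
have inK i : i <= d -> (H - u <= i < H + u) || (i == d) -> inord i \in K.
  by move=> il iB; apply: (subsetP BK); rewrite near_baseE.
have co1 : all (coprime 1) s by apply/allP => x _; rewrite coprime1n.
apply: (@realizable_cycle_even _ f K) => //.
- by apply: inK => //; rewrite eqxx orbT.
- apply: (@good_line _ _ id _ c _ s f K (fun i => inord (H - u + i)) (H - u) 1) => //.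
  + by rewrite f0.
  + by move=> i j il jl /(congr1 val) /=; rewrite !inordK; slia.
  + by move=> i il; apply: inK; slia.
  + by move=> i il; rewrite /c inordK ?mul1n //; slia.
  by rewrite cK.
- apply: (@good_pairs _ _ id _ sg _ s f K (fun i => inord (H - u + i))
    (fun i => inord (H + i)) (d.+1 - 2 * u) 1) => //.
  + slia.
  + by move=> i j il jl /(congr1 val) /=; rewrite !inordK; slia.
  + by move=> i j il jl /(congr1 val) /=; rewrite !inordK; slia.
  + by move=> i j il jl /(congr1 val) /=; rewrite !inordK; slia.
  + by move=> i il; apply: inK; slia.
  + by move=> i il; apply: inK; slia.
  + move=> i il; rewrite near_s_inord /near_s; last slia.
    by rewrite ifT; [congr (_ %% _)|]; slia.
  + move=> i il; rewrite near_s_inord /near_s; last slia.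
    by rewrite ifF; [congr (_ %% _)|]; slia.
  by rewrite cK.
(* [d] is inserted at the break of [near_r], where its value [H] fills the gap. *)
pose q i := if i < u then H - u + i else if i == u then d else H + (i - u.+1).
have qd i : i < sumn s -> q i < d.+1.
  by rewrite /q; case: (ltngtP i u); slia.
apply: (@good_line _ _ id _ r _ s f K (fun i => inord (q i)) (H - u) 1) => //.
- by rewrite f0.
- move=> i j il jl /(congr1 val) /=; rewrite !inordK ?qd // /q.
  by case: (ltngtP i u); case: (ltngtP j u); slia.
- by move=> i il; apply: inK; have := qd i il; rewrite /q; case: (ltngtP i u); slia.
- move=> i il; rewrite near_r_inord ?qd // /q.
  case: (ltngtP i u) => h; rewrite /near_r.
  + by rewrite ifT; [congr (_ %% _)|]; slia.
  + by rewrite ifF ?ifT; [congr (_ %% _)| |]; slia.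
  by rewrite ifF ?ifF; [congr (_ %% _)| |]; slia.
by rewrite cK.
Qed.

End NearTransversal.

(** This is the shape of the symbols [near_s] on two segments of length [w], one on each side of
    [H]: the parities differ, and within one parity the problem is halved to modulus [w]. *)
Lemma eqmod_halves w A B i j : i < 2 * w -> j < 2 * w ->
  (if i < w then 2 * (A + i) else 2 * (B + (i - w)) + 1) =
  (if j < w then 2 * (A + j) else 2 * (B + (j - w)) + 1) %[mod 2 * w] -> i = j.
Proof.
have dbl x y : 2 * x = 2 * y %[mod 2 * w] -> x = y %[mod w].
  by rewrite -!muln_modr => /eqP; rewrite eqn_pmul2l // => /eqP.
have par x y : 2 * x = 2 * y + 1 %[mod 2 * w] -> False.
  by move/(@eqmod_dvd 2 _ _ _ (dvdn_mulr w (dvdnn 2))); rewrite !modn2; slia.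
move=> il jl; case: (ltnP i w) => iw; case: (ltnP j w) => jw.
- by move/dbl/eqmod_small; slia.
- by move/par.
- by move/esym/par.
move=> /eqP; rewrite eqn_modDr => /eqP/dbl/eqmod_small; slia.
Qed.

Section EvenPairs.
Variables (d H : nat).
Hypothesis dH : d.+1 = 2 * H.
Let c : 'I_d.+1 -> 'I_d.+1 := id.
Let sg (i : 'I_d.+1) : 'I_d.+1 := inord (near_s H i).
Let r (i : 'I_d.+1) : 'I_d.+1 := inord (near_r H i).

Lemma residue_system_inord (g : 'I_d.+1 -> 'I_d.+1) (gv : nat -> nat) e (ix : nat -> nat) :
  (forall i, i < d.+1 -> g (inord i) = gv i :> nat) ->
  (forall j, j < e -> ix j < d.+1) ->
  (forall j k, j < e -> k < e -> gv (ix j) = gv (ix k) %[mod e] -> j = k) ->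
  residue_system id g (fun j : 'I_e => inord (ix j)).
Proof.
move=> gE ixl ixI u v; rewrite !gE ?ixl // => /ixI uv.
by apply: val_inj; apply: uv.
Qed.

Lemma inord_neq e' e (ix1 ix2 : nat -> nat) :
  (forall j, j < e' -> ix1 j < d.+1) -> (forall j, j < e -> ix2 j < d.+1) ->
  (forall j k, j < e' -> k < e -> ix1 j <> ix2 k) ->
  forall (u : 'I_e') (v : 'I_e),
    (inord (ix1 u) : 'I_d.+1) != (inord (ix2 v) : 'I_d.+1).
Proof.
move=> l1 l2 n12 u v; rewrite -val_eqE /= !inordK ?l1 ?l2 //.
by apply/eqP; apply: n12.
Qed.

(** There may be no fixed point here. By [good_swap_odd] it is enough to split the window,
    separately for each of [c], [sg] and [r], into residue systems modulo [e'] and [e]. *)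
Lemma realizable_cycle_even_mixed e' e f :
  0 < e' -> ~~ odd e' -> odd e -> e %| e' -> e' %| d.+1 -> e' <= H ->
  e' + e + f <= d.+1 -> realizable (@rotate [:: e'; e] f) ->
  realizable (@rotate [:: d.+1; e'; e] f).
Proof.
move=> e'0 e'e eo ee' e'd e'H efd realY; have e0 := odd_gt0 eo.
have ed := dvdn_trans ee' e'd.
have [k Hk] : exists k, H = k * e.
  by apply/dvdnP; rewrite -(@Gauss_dvdr e 2) ?coprimen2 // -dH.
set w := e'./2; have e'w : e' = 2 * w by slia.
have [l wl] : exists l, w = l * e.
  by apply/dvdnP; rewrite -(@Gauss_dvdr e 2) ?coprimen2 // -e'w.
have l0 : 0 < l by case: (l) wl => // wl; slia.
have lk : 2 * l <= k by move: e'H; rewrite e'w Hk wl mulnA leq_pmul2r.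
have ew : e <= w by rewrite wl leq_pmull.
(* Hence [d = 2 H - 1] is congruent modulo [e] to [H + w + e - 1], the index just after the
   window. *)
have [m Hm] : exists m, H = w + e + m * e.
  by exists (k - l - 1); rewrite Hk wl [l * e + e]addnC -mulSn -mulnDl; congr (_ * e); slia.
have [|||K BK cK] := @near_base_superset d H dH w (w + e.-1) (e' + e + f); try slia.
have inK i : i < d.+1 -> (H - w <= i < H + (w + e.-1)) || (i == d) -> inord i \in K.
  by move=> il iB; apply: (subsetP BK); rewrite near_baseE.
have cK' : e' + e + f <= #|K| by rewrite cK.
have swap (g : 'I_d.+1 -> 'I_d.+1) gv ix1 ix2 :
    (forall i, i < d.+1 -> g (inord i) = gv i :> nat) ->
    (forall j, j < e' -> (H - w <= ix1 j < H + (w + e.-1)) || (ix1 j == d)) ->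
    (forall j, j < e -> (H - w <= ix2 j < H + (w + e.-1)) || (ix2 j == d)) ->
    (forall j k, j < e' -> k < e -> ix1 j <> ix2 k) ->
    (forall j k, j < e' -> k < e' -> gv (ix1 j) = gv (ix1 k) %[mod e'] -> j = k) ->
    (forall j k, j < e -> k < e -> gv (ix2 j) = gv (ix2 k) %[mod e] -> j = k) ->
    good id g [:: e'; e] f K.
  move=> gE ix1B ix2B ix12 g1 g2.
  have l1 j : j < e' -> ix1 j < d.+1 by move/ix1B; slia.
  have l2 j : j < e -> ix2 j < d.+1 by move/ix2B; slia.
  apply: (@good_swap_odd _ _ id _ g (fun x y => erefl) e' e f
    (fun u => inord (ix1 u)) (fun u => inord (ix2 u))) => //.
  - exact: residue_system_inord gE l1 g1.
  - exact: residue_system_inord gE l2 g2.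
  - exact: inord_neq.
  - by move=> u; apply: inK; [apply: l1|apply: ix1B].
  - by move=> u; apply: inK; [apply: l2|apply: ix2B].
apply: (@realizable_cycle_even _ _ dH _ f K) => //.
- by rewrite /= e'd ed.
- by rewrite cK /= addn0.
- by apply: inK => //; rewrite eqxx orbT.
- apply: (swap c id (fun j => H - w + j)
    (fun j => if j < e.-1 then H + w + j else d)) => //.
  + exact: inordK.
  + by move=> j jl; slia.
  + by move=> j jl; case: (ltnP j e.-1); slia.
  + by move=> i j il jl; case: (ltnP j e.-1); slia.
  + by move=> i j il jl /eqmod_small; slia.
  have E j : j < e -> (if j < e.-1 then H + w + j else d) = H + w + 1 * j %[mod e].
    move=> jl; rewrite mul1n; case: (ltnP j e.-1) => // h.
    by apply: (@eqmodI _ _ _ m); slia.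
  by move=> i j il jl /=; rewrite !E //; apply: eqmod_mulI => //; rewrite coprime1n.
- apply: (swap sg (near_s H) (fun j => if j < w then H - w + j else H + (j - w))
    (fun j => if j < e.-1 then H + w + j else d)) => //.
  + exact: near_s_inord.
  + by move=> j jl; case: (ltnP j w); slia.
  + by move=> j jl; case: (ltnP j e.-1); slia.
  + by move=> i j il jl; case: (ltnP j e.-1); case: (ltnP i w); slia.
  + have E j : j < e' -> near_s H (if j < w then H - w + j else H + (j - w)) =
        if j < w then 2 * (H - w + j) else 2 * (0 + (j - w)) + 1.
      by move=> jl; rewrite /near_s; case: (ltnP j w) => h; [rewrite ifT|rewrite ifF]; slia.
    by move=> i j il jl; rewrite !E // e'w; apply: eqmod_halves; rewrite -e'w.
  have E j : j < e -> near_s H (if j < e.-1 then H + w + j else d) =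
      2 * w + 1 + 2 * j %[mod e].
    move=> jl; rewrite /near_s; case: (ltnP j e.-1) => h; rewrite ifF; try slia.
      by congr (_ %% _); slia.
    by apply: (@eqmodI _ _ _ (2 * m)); rewrite -mulnA; slia.
  by move=> i j il jl; rewrite !E //; apply: eqmod_mulI => //; rewrite coprime2n.
pose ix1 j := if j < w then H - w + j else if j == w then d else H + (j - w.+1).
have E1 j : j < e' -> near_r H (ix1 j) = H - w + j.
  move=> jl; rewrite /ix1 /near_r; case: (ltngtP j w) => h; first by rewrite ifT; slia.
    by rewrite ifF ?ifT; slia.
  by rewrite ifF ?ifF; slia.
have E2 j : j < e -> near_r H (H + w - 1 + j) = H + w + j.
  by move=> jl; rewrite /near_r ifF ?ifT; slia.
apply: (swap r (near_r H) ix1 (fun j => H + w - 1 + j)) => //.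
- exact: near_r_inord.
- by move=> j jl; rewrite /ix1; case: (ltngtP j w); slia.
- by move=> j jl; slia.
- by move=> i j il jl; rewrite /ix1; case: (ltngtP i w); slia.
- by move=> i j il jl; rewrite !E1 // => /eqmod_small; slia.
by move=> i j il jl; rewrite !E2 // => /eqmod_small; slia.
Qed.

(** As [e] divides [H], the index [d] stands for [H + e - 1] modulo [e]. The symbols are split so
    that each of the two systems gets [e / 2] even and [e / 2] odd ones. *)
Lemma realizable_cycle_even_twice e f :
  0 < e -> ~~ odd e -> e %| H -> e + e + f <= d.+1 ->
  realizable (@rotate [:: e; e] f) -> realizable (@rotate [:: d.+1; e; e] f).
Proof.
move=> e0 ee eH efd realY; have ed : e %| d.+1 by rewrite dH dvdn_mull.
have [k Hk] := dvdnP eH.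
have k0 : 0 < k by case: (k) Hk; slia.
have eleH : e <= H by rewrite Hk leq_pmull.
have [m Hm] : exists m, H = e + m * e.
  by exists k.-1; rewrite Hk -mulSn; congr (_ * e); slia.
set w := e./2; have ew : e = 2 * w by slia.
have [|||K BK cK] := @near_base_superset d H dH e e.-1 (e + e + f); try slia.
have inK i : i < d.+1 -> (H - e <= i < H + e.-1) || (i == d) -> inord i \in K.
  by move=> il iB; apply: (subsetP BK); rewrite near_baseE.
have cK' : e + e + f <= #|K| by rewrite cK.
have swap (g : 'I_d.+1 -> 'I_d.+1) gv ix1 ix2 :
    (forall i, i < d.+1 -> g (inord i) = gv i :> nat) ->
    (forall j, j < e -> (H - e <= ix1 j < H + e.-1) || (ix1 j == d)) ->
    (forall j, j < e -> (H - e <= ix2 j < H + e.-1) || (ix2 j == d)) ->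
    (forall j k, j < e -> k < e -> ix1 j <> ix2 k) ->
    (forall j k, j < e -> k < e -> gv (ix1 j) = gv (ix1 k) %[mod e] -> j = k) ->
    (forall j k, j < e -> k < e -> gv (ix2 j) = gv (ix2 k) %[mod e] -> j = k) ->
    good id g [:: e; e] f K.
  move=> gE ix1B ix2B ix12 g1 g2.
  have l1 j : j < e -> ix1 j < d.+1 by move/ix1B; slia.
  have l2 j : j < e -> ix2 j < d.+1 by move/ix2B; slia.
  apply: (@good_swap_even _ _ id _ g (fun x y => erefl) e f
    (fun u => inord (ix1 u)) (fun u => inord (ix2 u))) => //.
  - exact: residue_system_inord gE l1 g1.
  - exact: residue_system_inord gE l2 g2.
  - exact: inord_neq.
  - by move=> u; apply: inK; [apply: l1|apply: ix1B].
  - by move=> u; apply: inK; [apply: l2|apply: ix2B].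
apply: (@realizable_cycle_even _ _ dH _ f K) => //.
- by rewrite /= ed.
- by rewrite cK /= addn0.
- by apply: inK => //; rewrite eqxx orbT.
- apply: (swap c id (fun j => H - e + j)
    (fun j => if j < e.-1 then H + j else d)) => //.
  + exact: inordK.
  + by move=> j jl; slia.
  + by move=> j jl; case: (ltnP j e.-1); slia.
  + by move=> i j il jl; case: (ltnP j e.-1); slia.
  + by move=> i j il jl /eqmod_small; slia.
  have E j : j < e -> (if j < e.-1 then H + j else d) = H + 1 * j %[mod e].
    move=> jl; rewrite mul1n; case: (ltnP j e.-1) => // h.
    by apply: (@eqmodI _ _ _ m); slia.
  by move=> i j il jl /=; rewrite !E //; apply: eqmod_mulI => //; rewrite coprime1n.
- apply: (swap sg (near_s H) (fun j => if j < w then H - e + j else H + (j - w))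
    (fun j => if j < w then H - w + j else if j < e.-1 then H + j else d)) => //.
  + exact: near_s_inord.
  + by move=> j jl; case: (ltnP j w); slia.
  + by move=> j jl; case: (ltnP j w); case: (ltnP j e.-1); slia.
  + by move=> i j il jl; case: (ltnP j w); case: (ltnP j e.-1); case: (ltnP i w); slia.
  + have E j : j < e -> near_s H (if j < w then H - e + j else H + (j - w)) =
        if j < w then 2 * (H - e + j) else 2 * (0 + (j - w)) + 1.
      by move=> jl; rewrite /near_s; case: (ltnP j w) => h; [rewrite ifT|rewrite ifF]; slia.
    by move=> i j il jl; rewrite !E // ew; apply: eqmod_halves; rewrite -ew.
  have E j : j < e ->
      near_s H (if j < w then H - w + j else if j < e.-1 then H + j else d) =
      (if j < w then 2 * (H - w + j) else 2 * (w + (j - w)) + 1) %[mod e].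
    move=> jl; rewrite /near_s; case: (ltnP j w) => h; first by rewrite ifT; slia.
    case: (ltnP j e.-1) => h'; rewrite ifF; try slia.
      by congr (_ %% _); slia.
    by apply: (@eqmodI _ _ _ (2 * m)); rewrite -mulnA; slia.
  by move=> i j il jl; rewrite !E // ew; apply: eqmod_halves; rewrite -ew.
pose ix2 j := if j == 0 then d else H + j.-1.
have E1 j : j < e -> near_r H (H - e + j) = H - e + j.
  by move=> jl; rewrite /near_r ifT; slia.
have E2 j : j < e -> near_r H (ix2 j) = H + j.
  by case: j => [|j] jl; rewrite /near_r /ix2 /=; [rewrite ifF ?ifF|rewrite ifF ?ifT]; slia.
apply: (swap r (near_r H) (fun j => H - e + j) ix2) => //.
- exact: near_r_inord.
- by move=> j jl; slia.
- by case=> [|j] jl; rewrite /ix2 /=; slia.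
- by move=> i [|j] il jl; rewrite /ix2 /=; slia.
- by move=> i j il jl; rewrite !E1 // => /eqmod_small; slia.
by move=> i j il jl; rewrite !E2 // => /eqmod_small; slia.
Qed.

End EvenPairs.

Lemma realizable_fixed f : realizable (@rotate [::] f).
Proof.
case: f => [|f].
  by exists (fun x _ => x); split=> //; split=> [[]|[]].
exists (fun x y : 'I_f.+1 => x + y)%R; split=> //; split=> x y z.
  exact: addrI.
exact: addIr.
Qed.

Lemma realizable1 d f : 0 < d -> f <= d -> (~~ odd d -> 0 < f) ->
  realizable (@rotate [:: d] f).
Proof.
case: d => // d _ fd df; have [od|ed] := boolP (odd d.+1).
  by apply: realizable_cycle_odd => //; apply: realizable_fixed.
apply: (@realizable_cycle_even_evenY _ d.+1./2) => //; last exact: realizable_fixed.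
- lia.
exact: df.
Qed.

(** The square of a cycle of length [2 d] consists of two cycles of length [d], the even and the odd
    positions; [h] conjugates the remaining rotation to its own square. *)
Lemma realizable_double d s f (h : model s f -> model s f) :
  0 < d -> bijective h -> (forall y, h (rotate y) = iter 2 (@rotate s f) (h y)) ->
  realizable (@rotate (2 * d :: s) f) -> realizable (@rotate (d :: d :: s) f).
Proof.
move=> d0 hb hr real2.
have bnd b (i : 'I_d) : 2 * i + nat_of_bool b < 2 * d by have := ltn_ord i; case: b; lia.
pose F (z : model (d :: d :: s) f) : model (2 * d :: s) f :=
  match z with inl i => inl (Ordinal (bnd false i))
  | inr (inl i) => inl (Ordinal (bnd true i)) | inr (inr y) => inr (h y) end.
have step b (i : 'I_d) :
    inl (Ordinal (bnd b (ordS i))) =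
      iter 2 (@rotate (2 * d :: s) f) (inl (Ordinal (bnd b i))).
  rewrite iter_inl; congr inl; apply: val_inj; rewrite [RHS](val_iter_ordS _ 2) /=; have := ltn_ord i.
  have [iE|/eqP iE] := eqVneq i.+1 d.
    rewrite iE modnn; have -> : 2 * i + b + 2 = b + 2 * d by lia.
    by rewrite modnDr modn_small //; case: b; lia.
  by move=> il; rewrite !modn_small; case: b; lia.
apply: (@realizable_transfer _ _ (iter 2 (@rotate (2 * d :: s) f)) _ F).
- apply: inj_card_bij; last by rewrite !card_sum !card_ord; lia.
  move=> [i|[i|y]] [j|[j|z]] //= [].
  + by move=> ij; congr inl; apply: val_inj => /=; lia.
  + by lia.
  + by lia.
  + by move=> ij; congr (inr (inl _)); apply: val_inj => /=; lia.
  + by move/(bij_inj hb)->.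
- by move=> [i|[i|y]]; [exact: step|exact: step|rewrite /= hr].
exact: realizable_iter.
Qed.

Lemma realizable_triple d f : 0 < d ->
  realizable (@rotate [:: 3 * d] f) -> realizable (@rotate [:: d; d; d] f).
Proof.
move=> d0 real3.
have bnd (b : 'I_3) (i : 'I_d) : 3 * i + b < 3 * d.
  by have := ltn_ord i; have := ltn_ord b; lia.
pose F (z : model [:: d; d; d] f) : model [:: 3 * d] f :=
  match z with inl i => inl (Ordinal (bnd (@Ordinal 3 0 isT) i))
  | inr (inl i) => inl (Ordinal (bnd (@Ordinal 3 1 isT) i))
  | inr (inr (inl i)) => inl (Ordinal (bnd (@Ordinal 3 2 isT) i)) | inr (inr (inr y)) => inr y end.
have step b (i : 'I_d) :
    inl (Ordinal (bnd b (ordS i))) =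
      iter 3 (@rotate [:: 3 * d] f) (inl (Ordinal (bnd b i))).
  rewrite iter_inl; congr inl; apply: val_inj; rewrite [RHS](val_iter_ordS _ 3) /=; have := ltn_ord i; have := ltn_ord b.
  have [iE|/eqP iE] := eqVneq i.+1 d.
    rewrite iE modnn => bl; have -> : 3 * i + b + 3 = b + 3 * d by lia.
    by rewrite modnDr modn_small //; lia.
  by move=> bl il; rewrite !modn_small; lia.
apply: (@realizable_transfer _ _ (iter 3 (@rotate [:: 3 * d] f)) _ F).
- apply: inj_card_bij; last by rewrite !card_sum !card_ord; lia.
  move=> [i|[i|[i|y]]] [j|[j|[j|z]]] //= [] //; try lia.
  + by move=> ij; congr inl; apply: val_inj => /=; lia.
  + by move=> ij; congr (inr (inl _)); apply: val_inj => /=; lia.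
  + by move=> ij; congr (inr (inr (inl _))); apply: val_inj => /=; lia.
  + by move->.
- by move=> [i|[i|[i|y]]]; [exact: step|exact: step|exact: step|].
exact: realizable_iter.
Qed.

(** * Two equal long cycles *)

Definition two_copies d s f (z : model (d.+1 :: d.+1 :: s) f) :
    ('I_2 * 'I_d.+1) + model s f :=
  match z with inl i => inl (0%R, i) | inr (inl i) => inl (1%R, i)
  | inr (inr y) => inr y end.

Lemma two_copies_bij d s f : bijective (@two_copies d s f).
Proof.
apply: inj_card_bij; last by rewrite card_sum card_prod !card_ord !card_model /=; lia.
by move=> [i|[i|y]] [j|[j|z]] //= []// ->.
Qed.

(** Squaring a cycle of length [2 d] fails here, as an even cycle alone needs a fixed point. Along
    the cycle the operation is [2 y - x], which commutes with translations and is injective in [y]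
    for odd [d]. *)
Lemma realizable_two_odd d : odd d -> realizable (@rotate [:: d; d] 0).
Proof.
case: d => // d od.
pose op (x y : 'I_2 * 'I_d.+1) := (x.1 + y.1, y.2 + y.2 - x.2)%R.
pose one : 'I_d.+1 := inZp 1.
apply: (@realizable_transfer ('I_2 * 'I_d.+1)%type _
  (fun x => (x.1, x.2 + one)%R) _
  (fun z => match z with inl i => (0%R, i) | inr (inl i) => (1%R, i)
            | inr (inr y) => (0%R, ord0) end)).
- apply: inj_card_bij; last by rewrite !card_sum card_prod !card_ord; lia.
  by move=> [i|[i|[]//]] [j|[j|[]//]] //= []// ->.
- by move=> [i|[i|[]//]] /=; congr (_, _); apply: val_inj; rewrite /= modnDmr addn1.
exists op; split; first split.
- move=> [a x] [b y] [b' y']; rewrite /op /= => e.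
  congr (_, _); first exact: addrI (congr1 fst e).
  have yy := addIr _ (congr1 snd e).
  move/(congr1 val): yy => /= /eqmod_ex[k yy]; apply: val_inj => /=.
  have := ltn_ord y; have := ltn_ord y'.
  by case: k yy => [|[|k]]; nia.
- move=> [b y] [a x] [a' x']; rewrite /op /= => e.
  congr (_, _); first exact: addIr (congr1 fst e).
  exact: oppr_inj (addrI _ (congr1 snd e)).
move=> [a x] [b y]; rewrite /op /=; congr (_, _).
by rewrite opprD !addrA [in RHS](addrAC _ (- x)%R) addrK (addrAC y one)
  [in LHS](addrAC _ (- x)%R).
Qed.

(** The alias carries the finite and the group structure together, as [realizable_good_extension]
    requires. *)
Definition dbl (d : nat) : Type := ('I_2 * 'I_d.+1)%type.
HB.instance Definition _ d := Finite.on (dbl d).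
HB.instance Definition _ d := GRing.Zmodule.on (dbl d).

Section DoubleEven.
Variables (d H : nat).
Hypothesis dH : d.+1 = 2 * H.

Definition dbl_elt (b : bool) (i : nat) : dbl d :=
  (if b then 1%R else 0%R, inord i).

Lemma dbl_elt_snd b i : i < d.+1 -> (dbl_elt b i).2 = i :> nat.
Proof. exact: inordK. Qed.

Lemma dbl_elt_inj b i b' i' : i < d.+1 -> i' < d.+1 ->
  dbl_elt b i = dbl_elt b' i' -> b = b' /\ i = i'.
Proof.
move=> il i'l E; split; last first.
  by move/(congr1 (fun x : dbl d => val x.2)): E; rewrite /= !inordK.
by move/(congr1 (fun x : dbl d => val x.1)): E; case: b; case: b'.
Qed.

Lemma dbl_eltP (x : dbl d) : exists b i, i < d.+1 /\ x = dbl_elt b i.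
Proof.
case: x => a i; exists (a != 0%R), i; split=> //.
congr (_, _); last by rewrite inord_val.
by case: a => [[|[|]]] //= ?; apply: val_inj.
Qed.

(* [x |-> x + dbl_r x] and [dbl_r] are both bijective: the group of type (2, 2 H), unlike the cyclic group of even order, has a complete mapping. *)
Definition dbl_ri b i :=
  if i < H then (if b then i + H else i)
  else if b then (if i < d then i.+1 else 0) else i.+1 - H.
Definition dbl_r (x : dbl d) : dbl d :=
  dbl_elt (H <= x.2) (dbl_ri (x.1 != 0%R) x.2).
Definition dbl_s (x : dbl d) : dbl d := (x + dbl_r x)%R.

Lemma dbl_ri_lt b i : i < d.+1 -> dbl_ri b i < d.+1.
Proof. by rewrite /dbl_ri; case: b; do 2?case: ifP; lia. Qed.

Lemma dbl_rE b i : i < d.+1 ->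
  dbl_r (dbl_elt b i) = dbl_elt (H <= i) (dbl_ri b i).
Proof. by move=> il; rewrite /dbl_r /= inordK //; case: b. Qed.

Lemma dbl_sE b i : i < d.+1 ->
  dbl_s (dbl_elt b i) = dbl_elt (b (+) (H <= i)) ((i + dbl_ri b i) %% d.+1).
Proof.
move=> il; rewrite /dbl_s dbl_rE //; congr (_, _); apply: val_inj.
  by case: b; case: (H <= i).
by rewrite /= !inordK ?ltn_pmod ?dbl_ri_lt.
Qed.

Lemma dbl_r_inj : injective dbl_r.
Proof.
move=> x y; have [b [i [il ->]]] := dbl_eltP x; have [b' [j [jl ->]]] := dbl_eltP y.
rewrite !dbl_rE // => /dbl_elt_inj; rewrite !dbl_ri_lt // => -[] // hb.
move=> hi; suff [-> ->] : b = b' /\ i = j by [].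
move: hb hi; rewrite /dbl_ri.
case: (ltnP i H) => iH; case: (ltnP j H) => jH //= _; case: b; case: b' => //=.
- by move/addIn.
- by lia.
- by lia.
- by case: (ltnP i d) => id_; case: (ltnP j d) => jd; lia.
- by case: (ltnP i d) => id_; lia.
- by case: (ltnP j d) => jd; lia.
by move=> ?; split=> //; lia.
Qed.

Lemma dbl_s_inj : injective dbl_s.
Proof.
have dd x y : 2 * x = 2 * y %[mod d.+1] -> x = y %[mod H].
  by rewrite dH -!muln_modr => /eqP; rewrite eqn_pmul2l // => /eqP.
have par x y : 2 * x = 2 * y + 1 %[mod d.+1] -> False.
  by rewrite dH => /(@eqmod_dvd 2 _ _ _ (dvdn_mulr H (dvdnn 2))); rewrite !modn2; lia.
move=> x y; have [b [i [il ->]]] := dbl_eltP x; have [b' [j [jl ->]]] := dbl_eltP y.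
rewrite !dbl_sE // => /dbl_elt_inj; rewrite !ltn_pmod // => -[] // hb.
move=> hi; suff [-> ->] : b = b' /\ i = j by [].
(* Elements on different sides of [H] whose sums agree in the first coordinate are told apart by the
   parity of the second. *)
have E c k : k < d.+1 -> k + dbl_ri c k =
   (if k < H then 2 * k + (if c then H else 0)
    else 2 * k + 1 + (if c then 0 else H)) %[mod d.+1].
  move=> kl; rewrite /dbl_ri; case: (ltnP k H) => kH; case: c.
  - by congr (_ %% _); lia.
  - by congr (_ %% _); lia.
  - case: ltnP => kd; first by congr (_ %% _); lia.
    by apply/esym; apply: (@eqmodI _ _ _ 1); lia.
  by apply/esym; apply: (@eqmodI _ _ _ 1); lia.
move: hb hi; rewrite !E //.
case: (ltnP i H) => iH; case: (ltnP j H) => jH; case: b; case: b' => //= _;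
  rewrite ?addn0 => /eqP; rewrite ?[_ + H]addnC ?eqn_modDl ?eqn_modDr => /eqP.
all: try by move/dd/eqmod_small; lia.
all: try by move/par.
all: try by move/esym/par.
Qed.

Lemma realizable_two_even s f (K : {set dbl d}) :
  all (fun e => e %| d.+1) s -> realizable (@rotate s f) -> #|K| = sumn s + f ->
  good (fun x : dbl d => x.2) id s f K -> good (fun x : dbl d => x.2) dbl_s s f K ->
  good (fun x : dbl d => x.2) dbl_r s f K ->
  realizable (@rotate (d.+1 :: d.+1 :: s) f).
Proof.
move=> sd realY cK good1 good2 good3.
pose g0 : dbl d := (0%R, inZp 1).
have := @realizable_good_extension (dbl d) d (fun x => x.2) s f (dbl d) id
  dbl_s dbl_r K g0 (fun x y => erefl) erefl sd realY (@inj_id _) dbl_s_inj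
  dbl_r_inj erefl cK (fun i _ => erefl) good1 good2 good3.
apply: (@realizable_transfer _ _ _ _ (@two_copies d s f)).
  exact: two_copies_bij.
move=> [i|[i|y]] /=; last by congr inr; rewrite iter_rotate_mod.
all: congr (inl (_, _)); first exact: val_inj.
all: by apply: val_inj; rewrite /= modnDmr addn1.
Qed.

Lemma realizable_two_even0 : realizable (@rotate [:: d.+1; d.+1] 0).
Proof.
apply: (@realizable_two_even [::] 0 set0) => //; try exact: good_nil.
  exact: realizable_fixed.
by rewrite cards0.
Qed.

Lemma realizable_two_even_cycle e f : 0 < e -> ~~ odd e -> e %| d.+1 ->
  e < d.+1 -> 0 < f -> e + f <= 2 * d.+1 ->
  realizable (@rotate [:: e] f) -> realizable (@rotate [:: d.+1; d.+1; e] f).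
Proof.
move=> e0 ee ed eltd f0 efd realY.
set w := e./2; have ew : e = 2 * w by lia.
have eH : e <= H.
  by case/dvdnP: ed => [[|[|k]]]; rewrite dH; nia.
(* The end of one copy is followed by the start of the other: second coordinates are consecutive
   modulo [d.+1], while the second coordinates of [dbl_s] are odd on the first part and even on the
   second. *)
pose q (j : nat) := if j < w then dbl_elt true (d.+1 - w + j) else dbl_elt false (j - w).
have [||K BK cK] := @exists_superset _ [set q (val j) | j : 'I_e.+1] (e + f).
- by rewrite (leq_trans (card_imset_ord _)) //; lia.
- by rewrite /dbl card_prod !card_ord.
have qK j : j < e.+1 -> q j \in K.
  by move=> jl; apply: (subsetP BK); apply/imsetP; exists (Ordinal jl).
have piD : {morph (fun x : dbl d => x.2) : x y / (x + y)%R} by [].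
have qI i j : i < e.+1 -> j < e.+1 -> q i = q j -> i = j.
  move=> il jl; rewrite /q; case: (ltnP i w) => iw; case: (ltnP j w) => jw E;
  by have [||hb hi] := dbl_elt_inj _ _ E; try discriminate hb; clear realY; lia.
have se : sumn [:: e] = e by rewrite /= addn0.
have s0 : all (fun x => 0 < x) [:: e] by rewrite /= e0.
have sd : all (fun x => x %| d.+1) [:: e] by rewrite /= ed.
have cK' : sumn [:: e] + f <= #|K| by rewrite se cK.
have f0' : (0 < f) || all odd [:: e] by rewrite f0.
have co1 : all (coprime 1) [:: e] by rewrite /= coprime1n.
apply: (@realizable_two_even [:: e] f K) => //; first by rewrite se.
- apply: (@good_line _ _ _ _ id piD [:: e] f K q (d.+1 - w) 1) => //; rewrite se.
  + by move=> i j il jl /qI; apply; lia.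
  + by move=> i il; apply: qK; lia.
  move=> i il; rewrite mul1n /q; case: (ltnP i w) => iw.
    by rewrite dbl_elt_snd //; lia.
  by rewrite dbl_elt_snd; [apply/esym; apply: (@eqmodI _ _ _ 1); lia|lia].
- apply: (@good_pairs _ _ _ _ dbl_s piD [:: e] f K (fun j => q (w + j)) q 0
    (2 * (d.+1 - w) + 1)) => //; rewrite ?se -/w.
  + by rewrite /= ee.
  + by lia.
  + by move=> i j il jl /qI; lia.
  + by move=> i j il jl /qI; lia.
  + by move=> i j il jl /qI; lia.
  + by move=> i il; apply: qK; lia.
  + by move=> i il; apply: qK; lia.
  + move=> i il; rewrite /q ifF; last lia.
    rewrite addKn dbl_sE; last lia.
    rewrite dbl_elt_snd ?ltn_pmod // modn_mod /dbl_ri ifT; last lia.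
    by congr (_ %% _); lia.
  move=> i il; rewrite /q ifT; last lia.
  rewrite dbl_sE; last lia.
  rewrite dbl_elt_snd ?ltn_pmod // modn_mod /dbl_ri ifF; last lia.
  case: ltnP => id_; first by congr (_ %% _); lia.
  by apply/esym; apply: (@eqmodI _ _ _ 1); lia.
(* [dbl_r] has second coordinate 0 at both [q (w - 1)] and [q w], so [q w] is skipped; for this
   reason [q] has one element more than the cycle. *)
apply: (@good_line _ _ _ _ dbl_r piD [:: e] f K
  (fun j => if j < w then q j else q j.+1) (d.+2 - w) 1) => //; rewrite se.
- move=> i j il jl; case: (ltnP i w) => iw; case: (ltnP j w) => jw /qI; lia.
- by move=> i il; case: (ltnP i w) => iw; apply: qK; lia.
move=> i il; rewrite mul1n; case: (ltnP i w) => iw; rewrite /q.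
  rewrite ifT // dbl_rE; last lia.
  rewrite dbl_elt_snd; last by apply: dbl_ri_lt; lia.
  rewrite /dbl_ri ifF; last lia.
  case: ltnP => id_; first by congr (_ %% _); lia.
  by apply/esym; apply: (@eqmodI _ _ _ 1); lia.
rewrite ifF; last lia.
rewrite dbl_rE; last lia.
rewrite dbl_elt_snd; last by apply: dbl_ri_lt; lia.
rewrite /dbl_ri ifT; last lia.
by apply/esym; apply: (@eqmodI _ _ _ 1); lia.
Qed.

End DoubleEven.

(** * A cycle whose length is the lcm of two others *)

Definition inj_mod p (X : nat -> nat) : Prop :=
  forall i j, i < p -> j < p -> X i = X j %[mod p] -> i = j.

Lemma inj_modD p X k : inj_mod p X -> inj_mod p (fun i => X i + k).
Proof. by move=> XI i j il jl /eqP; rewrite eqn_modDr => /eqP/XI->. Qed.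

(* Multiplication by [p] is negation modulo [p.+1]. *)
Lemma eqmod_oppI p a b : p * a = p * b %[mod p.+1] -> a = b %[mod p.+1].
Proof.
move=> ab; apply/eqP; rewrite -(eqn_modDl (p * a + p * b)); apply/eqP.
have -> : p * a + p * b + a = p * b + a * p.+1 by rewrite mulnS mulnC; lia.
have -> : p * a + p * b + b = p * a + b * p.+1 by rewrite mulnS (mulnC b); lia.
by rewrite ![_ + _ * p.+1]addnC !modnMDl.
Qed.

Lemma inj_modN p X : inj_mod p.+1 X -> inj_mod p.+1 (fun i => p * X i).
Proof. by move=> XI i j il jl /eqmod_oppI/XI; apply. Qed.

Lemma inZpD g a b : inZp (a + b) = (inZp a + inZp b)%R :> 'I_g.+1.
Proof. by apply: val_inj; rewrite /= modnDm. Qed.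

Lemma inZpP g a b : a = b %[mod g.+1] <-> inZp a = inZp b :> 'I_g.+1.
Proof. by split=> [ab|/(congr1 val)//]; apply: val_inj. Qed.

Lemma inZpN g p a : g.+1 %| p.+1 -> inZp (p * a) = (- inZp a)%R :> 'I_g.+1.
Proof.
move=> gp; apply/eqP; rewrite -addr_eq0 -inZpD -mulSnr; apply/eqP/val_inj.
by rewrite /= -modnMml (eqP gp) mod0n.
Qed.

(** [W j - U j] modulo [g.+1] is invariant under rotating both cycles together, so distinct [j] give
    pairs in distinct orbits. *)
Definition pairing g (W U : nat -> nat) : Prop := forall j k, j < g.+1 -> k < g.+1 ->
  (inZp (W j) - inZp (U j) = inZp (W k) - inZp (U k) :> 'I_g.+1)%R -> j = k.

Lemma pairingC g W U : pairing g W U -> pairing g U W.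
Proof.
by move=> WU j k jl kl E; apply: WU => //; rewrite -opprB E opprB.
Qed.

Lemma pairingD g W U k l : pairing g W U ->
  pairing g (fun j => W j + k) (fun j => U j + l).
Proof.
move=> WU i j il jl; rewrite !inZpD !opprD addrACA [in RHS]addrACA.
by move/addIr/(WU _ _ il jl).
Qed.

Lemma pairingNN g p q W U : g.+1 %| p.+1 -> g.+1 %| q.+1 -> pairing g W U ->
  pairing g (fun j => p * W j) (fun j => q * U j).
Proof.
move=> gp gq WU i j il jl; rewrite !inZpN // -!opprD => /oppr_inj.
exact: WU.
Qed.

Lemma pairing_eq g p q W U x x' j k : g.+1 %| p.+1 -> g.+1 %| q.+1 ->
  pairing g W U -> j < g.+1 -> k < g.+1 ->
  W j + x = W k + x' %[mod p.+1] -> U j + x = U k + x' %[mod q.+1] -> j = k.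
Proof.
move=> gp gq WU jl kl /(eqmod_dvd gp)/inZpP + /(eqmod_dvd gq)/inZpP.
rewrite !inZpD => e1 e2; apply: WU => //.
have <- : (inZp (W j) + inZp x - (inZp (U j) + inZp x) = inZp (W j) - inZp (U j) :> 'I_g.+1)%R
  by rewrite opprD addrACA subrr addr0.
by rewrite e1 e2 opprD addrACA subrr addr0.
Qed.

Section Lcm.
Variables (p q g f L2 L3 : nat).
Hypotheses (L2p : L2 + g.+1 = p.+1) (L3q : L3 + g.+1 = q.+1).
Hypotheses (gp : g.+1 %| p.+1) (gq : g.+1 %| q.+1).

Let Y := model [:: p.+1; q.+1] f.
Let e2 (n : nat) : Y := inl (inZp n).
Let e3 (n : nat) : Y := inr (inl (inZp n)).
Let e0 (k : 'I_f) : Y := inr (inr k).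

Let e2P a b : e2 a = e2 b <-> a = b %[mod p.+1].
Proof. by split=> [[]//|/inZpP E]; rewrite /e2 E. Qed.

Let e3P a b : e3 a = e3 b <-> a = b %[mod q.+1].
Proof. by split=> [[]//|/inZpP E]; rewrite /e3 E. Qed.

Lemma iter_e2 x n : iter x (@rotate [:: p.+1; q.+1] f) (e2 n) = e2 (n + x).
Proof.
rewrite iter_inl; congr inl; apply: val_inj.
by rewrite [LHS]val_iter_ordS /= modnDml.
Qed.

Lemma iter_e3 x n : iter x (@rotate [:: p.+1; q.+1] f) (e3 n) = e3 (n + x).
Proof.
rewrite iter_inr iter_inl; congr (inr (inl _)); apply: val_inj.
by rewrite [LHS]val_iter_ordS /= modnDml.
Qed.

Lemma iter_e0 x k : iter x (@rotate [:: p.+1; q.+1] f) (e0 k) = e0 k.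
Proof. by rewrite !iter_inr; elim: x. Qed.

(* [X2], [X3] enumerate the residues modulo [p.+1], [q.+1]: the first [L2], [L3] of them are used by triples with two entries in the long cycle, the last [g.+1] by triples with an entry in each of the three cycles. *)
Definition main_half (X2 X3 : nat -> nat) (z : 'I_L2 + ('I_L3 + 'I_f)) : Y :=
  match z with inl i => e2 (X2 i) | inr (inl i) => e3 (X3 i)
  | inr (inr k) => e0 k end.

Definition cross_half (X2 X3 : nat -> nat) (z : 'I_g.+1 + 'I_g.+1) : Y :=
  match z with inl j => e2 (X2 (L2 + j)) | inr j => e3 (X3 (L3 + j)) end.

Definition swap_sum (z : 'I_g.+1 + 'I_g.+1) : 'I_g.+1 + 'I_g.+1 :=
  match z with inl j => inr j | inr j => inl j end.

Lemma halves_inj X2 X3 : inj_mod p.+1 X2 -> inj_mod q.+1 X3 ->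
  injective (copair (main_half X2 X3) (cross_half X2 X3)).
Proof.
move=> I2 I3.
have l2 (i : 'I_L2) : i < p.+1 by have := ltn_ord i; lia.
have l3 (i : 'I_L3) : i < q.+1 by have := ltn_ord i; lia.
have m2 (i : 'I_g.+1) : L2 + i < p.+1 by have := ltn_ord i; lia.
have m3 (i : 'I_g.+1) : L3 + i < q.+1 by have := ltn_ord i; lia.
case=> [[i|[i|i]]|[i|i]] [[j|[j|j]]|[j|j]] //=.
- by move/e2P/(I2 _ _ (l2 i) (l2 j)) => ij; do 2!congr inl; apply: val_inj.
- by move/e2P/(I2 _ _ (l2 i) (m2 j)); have := ltn_ord i; lia.
- by move/e3P/(I3 _ _ (l3 i) (l3 j)) => ij; do 3!congr (_ _); apply: val_inj.
- by move/e3P/(I3 _ _ (l3 i) (m3 j)); have := ltn_ord i; lia.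
- by case=> ->.
- by move/e2P/(I2 _ _ (m2 i) (l2 j)); have := ltn_ord j; lia.
- by move/e2P/(I2 _ _ (m2 i) (m2 j)) => ij; congr (inr (inl _)); apply: val_inj => /=; lia.
- by move/e3P/(I3 _ _ (m3 i) (l3 j)); have := ltn_ord j; lia.
by move/e3P/(I3 _ _ (m3 i) (m3 j)) => ij; congr (inr (inr _)); apply: val_inj => /=; lia.
Qed.

Lemma halves_swap_inj X2 X3 : inj_mod p.+1 X2 -> inj_mod q.+1 X3 ->
  injective (copair (main_half X2 X3) (fun z => cross_half X2 X3 (swap_sum z))).
Proof.
move=> I2 I3 [z|z] [z'|z'] E.
- by congr inl; have [] := @halves_inj _ _ I2 I3 (inl z) (inl z') E.
- by have := @halves_inj _ _ I2 I3 (inl z) (inr (swap_sum z')) E.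
- by have := @halves_inj _ _ I2 I3 (inr (swap_sum z)) (inl z') E.
have := @halves_inj _ _ I2 I3 (inr (swap_sum z)) (inr (swap_sum z')) E.
by case: z E => j _; case: z' => k // [->].
Qed.

(** Equal pairs have equal differences modulo the gcd, hence equal [j]; then the two rotations agree
    modulo both lengths, and [crt] identifies them. *)
Lemma cross_pair D (x x' : 'I_D) (W2 W3 U2 U3 : nat -> nat) j j' :
  (forall a b, a < D -> b < D -> a = b %[mod p.+1] -> a = b %[mod q.+1] -> a = b) ->
  pairing g (fun j => W2 (L2 + j)) (fun j => U3 (L3 + j)) ->
  pairing g (fun j => W3 (L3 + j)) (fun j => U2 (L2 + j)) ->
  iter x (@rotate _ f) (cross_half W2 W3 j) = iter x' (@rotate _ f) (cross_half W2 W3 j') ->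
  iter x (@rotate _ f) (cross_half U2 U3 (swap_sum j)) =
    iter x' (@rotate _ f) (cross_half U2 U3 (swap_sum j')) ->
  x = x' /\ j = j'.
Proof.
move=> crt P23 P32.
have jj (i k : 'I_g.+1) : i = k :> nat -> i = k by apply: val_inj.
case: j j' => [j|j] [k|k] /=; rewrite ?iter_e2 ?iter_e3 //.
- move=> /e2P E1 /e3P E2.
  have jk : j = k by apply/jj/(pairing_eq gp gq P23 _ _ E1 E2).
  rewrite jk in E1 E2 *; split=> //; apply: val_inj; apply: (crt _ _ (ltn_ord x) (ltn_ord x')).
    by apply/eqP; rewrite -(eqn_modDl (W2 (L2 + k))); apply/eqP.
  by apply/eqP; rewrite -(eqn_modDl (U3 (L3 + k))); apply/eqP.
move=> /e3P E1 /e2P E2.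
have jk : j = k by apply/jj/(pairing_eq gq gp P32 _ _ E1 E2).
rewrite jk in E1 E2 *; split=> //; apply: val_inj; apply: (crt _ _ (ltn_ord x) (ltn_ord x')).
  by apply/eqP; rewrite -(eqn_modDl (U2 (L2 + k))); apply/eqP.
by apply/eqP; rewrite -(eqn_modDl (W3 (L3 + k))); apply/eqP.
Qed.

End Lcm.

(** Put [P = L2 + G], [Q = L3 + G], [D = N + L2 + L3 + f]. The hypothesis is [D G = P Q], so the
    cross triples account for the [2 P Q] ordered pairs with one entry in each shorter cycle, and
    equality holds. *)
Lemma count_lcm N L2 L3 f G :
  (N + (L2 + (L3 + f))) * G = (L2 + G) * (L3 + G) ->
  (N + (L2 + (L3 + f)) + (L2 + G + (L3 + G + f))) ^ 2 <=
    (N + (L2 + (L3 + f))) * (N + (L2 + (L3 + f)) + (L2 + (L3 + f)) +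
      (L2 + (L3 + f)) + (G + G) + (G + G) + (G + G)) +
    ((L2 + G + f) * (L2 + G + f) +
      ((L3 + G) * (L3 + G) + ((L3 + G) * f + f * (L3 + G)))).
Proof. by rewrite -mulnn; lia. Qed.

Section Lcm.
Variables (p q g f L2 L3 : nat).
Hypotheses (L2p : L2 + g.+1 = p.+1) (L3q : L3 + g.+1 = q.+1).
Hypotheses (gp : g.+1 %| p.+1) (gq : g.+1 %| q.+1).

Let Y := model [:: p.+1; q.+1] f.

Lemma copair_ext (A B C : Type) (u u' : A -> C) (v : B -> C) :
  u =1 u' -> injective (copair u v) -> injective (copair u' v).
Proof. by move=> uu' inj; apply: eq_inj inj _ => -[a|b] /=. Qed.

Lemma normalize D n m (x : 'I_D.+1) X k : k.+1 %| D.+1 -> x = X %[mod k.+1] ->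
  n = m + X %[mod k.+1] -> n + (- x)%R = m %[mod k.+1].
Proof.
move=> kD xX nm; apply/eqP; rewrite -(eqn_modDr x) -addnA; apply/eqP.
rewrite -modnDmr (_ : (_ + x) %% k.+1 = 0) ?addn0.
  by rewrite nm -modnDmr -xX modnDmr.
have : ((- x) + x)%R = 0%R :> 'I_D.+1 by rewrite addNr.
move/(congr1 val) => /= h; apply/eqP; apply: (dvdn_trans kD); exact/eqP.
Qed.

Definition emb2 (y : model [:: p.+1] f) : Y :=
  match y with inl u => inl u | inr k => inr (inr k) end.
Definition emb3 (y : model [:: q.+1] f) : Y := inr y.

Lemma emb2_iter x y : emb2 (iter x (@rotate _ f) y) = iter x (@rotate _ f) (emb2 y).
Proof. by elim: x => //= x <-; case: (iter _ _ _). Qed.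

Lemma emb2_inj : injective emb2.
Proof. by move=> [u|k] [u'|k'] //= [->]. Qed.

Lemma emb3_inj : injective emb3. Proof. by move=> y y' []. Qed.

Definition in2 (y : Y) := if y is inl _ then true else false.
Definition in3 (y : Y) := if y is inr (inl _) then true else false.

Lemma in2_iter x y : in2 (iter x (@rotate _ f) y) = in2 y.
Proof. by elim: x => //= x <-; case: (iter _ _ _). Qed.

Lemma in3_iter x y : in3 (iter x (@rotate _ f) y) = in3 y.
Proof. by elim: x => //= x <-; case: (iter _ _ _) => // -[]. Qed.

Lemma in3_emb2 y : in3 (emb2 y) = false. Proof. by case: y. Qed.

Lemma in2_emb3 y : in2 (emb3 y) = false. Proof. by []. Qed.

Lemma cross_half_in X2 X3 X2' X3' z :
  let y := @cross_half p q g f L2 L3 X2 X3 z in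
  let y' := @cross_half p q g f L2 L3 X2' X3' (swap_sum z) in
  (in2 y && in3 y') || (in3 y && in2 y').
Proof. by case: z. Qed.

(* The triples with no entry in the long cycle: those of two Latin squares sharing their fixed points. The pairs of fixed points are counted in the first square only. *)
Let Th := ((model [:: p.+1] f * model [:: p.+1] f) +
  ('I_q.+1 * 'I_q.+1 + ('I_q.+1 * 'I_f + 'I_f * 'I_q.+1)))%type.

Definition th3 (z : 'I_q.+1 * 'I_q.+1 + ('I_q.+1 * 'I_f + 'I_f * 'I_q.+1)) :
    model [:: q.+1] f * model [:: q.+1] f :=
  match z with inl z => (inl z.1, inl z.2) | inr (inl z) => (inl z.1, inr z.2)
  | inr (inr z) => (inr z.1, inl z.2) end.

Lemma th3_inj : injective th3.
Proof. by move=> [[x y]|[[x y]|[x y]]] [[x' y']|[[x' y']|[x' y']]] //= [-> ->]. Qed.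

Definition rot3 (z : 'I_q.+1 * 'I_q.+1 + ('I_q.+1 * 'I_f + 'I_f * 'I_q.+1)) :
    'I_q.+1 * 'I_q.+1 + ('I_q.+1 * 'I_f + 'I_f * 'I_q.+1) :=
  match z with inl z => inl (ordS z.1, ordS z.2) | inr (inl z) => inr (inl (ordS z.1, z.2))
  | inr (inr z) => inr (inr (z.1, ordS z.2)) end.

Lemma th3_rot z : th3 (rot3 z) = (rotate (th3 z).1, rotate (th3 z).2).
Proof. by case: z => [z|[z|z]]. Qed.

Definition th_map (F2 : model [:: p.+1] f -> model [:: p.+1] f -> model [:: p.+1] f)
    (F3 : model [:: q.+1] f -> model [:: q.+1] f -> model [:: q.+1] f) (u : Th) : Y :=
  match u with inl z => emb2 (F2 z.1 z.2)
  | inr z => emb3 (F3 (th3 z).1 (th3 z).2) end.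

Definition th_rot (u : Th) : Th :=
  match u with inl z => inl (rotate z.1, rotate z.2) | inr z => inr (rot3 z) end.

Lemma th_map_rot F2 F3 u :
  (forall x y, rotate (F2 x y) = F2 (rotate x) (rotate y)) ->
  (forall x y, rotate (F3 x y) = F3 (rotate x) (rotate y)) ->
  th_map F2 F3 (th_rot u) = rotate (th_map F2 F3 u).
Proof.
move=> h2 h3; case: u => [z|z] /=; last by rewrite th3_rot -h3.
by rewrite -h2 (emb2_iter 1).
Qed.

Lemma th_map_cross F2 F3 F2' F3' u x y y' :
  (in2 y && in3 y') || (in3 y && in2 y') ->
  iter x (@rotate _ f) y = th_map F2 F3 u -> iter x (@rotate _ f) y' = th_map F2' F3' u -> False.
Proof.
rewrite -(in2_iter x y) -(in3_iter x y') -(in3_iter x y) -(in2_iter x y').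
move=> h e e'; move: h; rewrite {}e {}e'.
by case: u => z /=; rewrite ?in3_emb2 ?in2_emb3 ?andbF ?orbF.
Qed.

(** The third condition keeps the two squares apart: triples of the second have no two fixed
    entries, such triples being left to the first. *)
Lemma th_map_inj F2 F3 F2' F3' :
  (forall x y x' y', F2 x y = F2 x' y' -> F2' x y = F2' x' y' -> x = x' /\ y = y') ->
  (forall x y x' y', F3 x y = F3 x' y' -> F3' x y = F3' x' y' -> x = x' /\ y = y') ->
  (forall z k k', F3 (th3 z).1 (th3 z).2 = inr k -> F3' (th3 z).1 (th3 z).2 = inr k' -> False) ->
  forall u v, th_map F2 F3 u = th_map F2 F3 v -> th_map F2' F3' u = th_map F2' F3' v -> u = v.
Proof.
move=> h2 h3 h3n.
have ne y z : emb2 y = emb3 z -> exists k, z = inr k.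
  by case: y => // k [<-]; exists k.
move=> [[x y]|z] [[x' y']|z'] /=.
- by move/emb2_inj => e1 /emb2_inj e2; have [-> ->] := h2 _ _ _ _ e1 e2.
- by move/ne => [k e1] /ne [k' e2]; case: (h3n _ _ _ e1 e2).
- by move/esym/ne => [k e1] /esym/ne [k' e2]; case: (h3n _ _ _ e1 e2).
move/emb3_inj => e1 /emb3_inj e2; have [e3 e4] := h3 _ _ _ _ e1 e2.
by congr inr; apply: th3_inj; rewrite [LHS]surjective_pairing e3 e4 -surjective_pairing.
Qed.

Lemma fixed_only (y : model [:: q.+1] f) : 0 < q -> rotate y = y -> exists k, y = inr k.
Proof.
case: y => [i|k] q0 /=; last by exists k.
case=> /(congr1 val) /=; have := ltn_ord i; rewrite ltnS leq_eqVlt => /orP[/eqP->|il].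
  by rewrite modnn; lia.
by rewrite modn_small //; lia.
Qed.

(** Each family with two long entries is seen from both of them. Up to constants, symbols [A] become
    [A - i = B] seen from the column, rows [- B] become [- B - i = - A] seen from the symbol, and
    columns [U] become [U - 2 i = - U]. So three permutations per cycle cover all six views, and the
    pairing hypotheses couple their last [g.+1] values. *)
Lemma realizable_lcm D (A2 B2 U2 A3 B3 U3 : nat -> nat)
    (c s r : 'I_D.+1 -> 'I_D.+1) (idx : 'I_L2 + ('I_L3 + 'I_f) -> 'I_D.+1)
    (C2 S2 R2 C3 S3 R3 : nat) :
  0 < q -> p.+1 %| D.+1 -> q.+1 %| D.+1 -> D.+1 * g.+1 = p.+1 * q.+1 ->
  (forall a b, a < D.+1 -> b < D.+1 -> a = b %[mod p.+1] -> a = b %[mod q.+1] -> a = b) ->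
  inj_mod p.+1 A2 -> inj_mod p.+1 B2 -> inj_mod p.+1 U2 ->
  inj_mod q.+1 A3 -> inj_mod q.+1 B3 -> inj_mod q.+1 U3 ->
  (forall i, i < L2 -> A2 i = B2 i + i %[mod p.+1]) ->
  (forall i, i < L2 -> U2 i + U2 i = i + i %[mod p.+1]) ->
  (forall i, i < L3 -> A3 i = B3 i + i %[mod q.+1]) ->
  (forall i, i < L3 -> U3 i + U3 i = i + i %[mod q.+1]) ->
  pairing g (fun j => A2 (L2 + j)) (fun j => U3 (L3 + j)) ->
  pairing g (fun j => A3 (L3 + j)) (fun j => U2 (L2 + j)) ->
  pairing g (fun j => B2 (L2 + j)) (fun j => q * B3 (L3 + j)) ->
  injective c -> injective s -> injective r -> injective idx ->
  (forall i, i \notin codom idx -> s i = c i + r i)%R ->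
  (forall i : 'I_L2, c (idx (inl i)) = C2 + i %[mod p.+1]) ->
  (forall i : 'I_L2, s (idx (inl i)) = S2 + (i + i) %[mod p.+1]) ->
  (forall i : 'I_L2, r (idx (inl i)) = R2 + i %[mod p.+1]) ->
  (forall i : 'I_L3, c (idx (inr (inl i))) = C3 + i %[mod q.+1]) ->
  (forall i : 'I_L3, s (idx (inr (inl i))) = S3 + (i + i) %[mod q.+1]) ->
  (forall i : 'I_L3, r (idx (inr (inl i))) = R3 + i %[mod q.+1]) ->
  realizable (@rotate [:: p.+1] f) -> realizable (@rotate [:: q.+1] f) ->
  realizable (@rotate [:: D.+1; p.+1; q.+1] f).
Proof.
move=> q0 pD qD Dg crt IA2 IB2 IU2 IA3 IB3 IU3 AB2 UU2 AB3 UU3 P1 P2 P3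
  cI sI rI iI sE cE2 sE2 rE2 cE3 sE3 rE3 [op2 [[op2r op2c] op2a]]
  [op3 [[op3r op3c] op3a]].
have P1' : pairing g (fun j => p * (A2 (L2 + j) + R2)) (fun j => q * (U3 (L3 + j) + S3)).
  exact/pairingNN/pairingD.
have P2' : pairing g (fun j => q * (A3 (L3 + j) + R3)) (fun j => p * (U2 (L2 + j) + S2)).
  exact/pairingNN/pairingD.
have P3' : pairing g (fun j => p * B2 (L2 + j)) (fun j => B3 (L3 + j) + q * C3).
  move=> j k jl kl; rewrite !inZpD !(inZpN _ gp) !opprD !addrA => /addIr e.
  by apply: (P3 j k jl kl); rewrite !(inZpN _ gq) !opprK; apply: oppr_inj; rewrite !opprD.
have P4' : pairing g (fun j => q * B3 (L3 + j)) (fun j => B2 (L2 + j) + p * C2).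
  move=> j k jl kl; rewrite !inZpD !opprD !addrA => /addIr e.
  by apply: (P3 j k jl kl); rewrite -opprB e opprB.
have nA k n X C (i : nat) : n = X + i %[mod k.+1] -> n = X + k * C + (C + i) %[mod k.+1].
  move=> ->; apply/inZpP; rewrite !inZpD (inZpN _ (dvdnn _)).
  by rewrite -addrA addKr.
have nB k A B R (i : nat) : A = B + i %[mod k.+1] ->
    k * B = k * (A + R) + (R + i) %[mod k.+1].
  move=> /inZpP AB; apply/inZpP; rewrite !inZpD !(inZpN _ (dvdnn _)) inZpD AB inZpD.
  by rewrite !opprD -!addrA addKr addNr addr0.
have nU k U S (i : nat) : U + U = i + i %[mod k.+1] ->
    U = k * (U + S) + (S + (i + i)) %[mod k.+1].
  move=> /inZpP UU; apply/inZpP.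
  by rewrite inZpD (inZpN _ (dvdnn _)) !inZpD -(inZpD _ i i) -UU inZpD opprD -!addrA !addKr.
have cp (h : 'I_D.+1 -> 'I_D.+1) : injective h ->
    injective (copair (fun i : {i | i \notin codom idx} => h (val i)) (fun i => h (idx i))).
  move=> hI [[i iK]|z] [[j jK]|z'] /= /hI.
  - by move=> ij; congr inl; apply: val_inj.
  - by move=> iz; case/negP: (iK); rewrite iz codom_f.
  - by move=> zj; case/negP: (jK); rewrite -zj codom_f.
  - by move/iI->.
pose A (x : 'I_D.+1) := iter x (@rotate [:: p.+1; q.+1] f).
pose mh := @main_half p q f L2 L3; pose ch := @cross_half p q g f L2 L3.
have A0 y : A 0%R y = y by [].
have alld : all (fun e => e %| D.+1) [:: p.+1; q.+1] by rewrite /= pD qD.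
have AD x x' y : A (x + x')%R y = A x (A x' y).
  exact: etrans (iter_rotate_mod _ _ alld) (iterD _ _ _ _).
have Aone y : rotate y = A (inZp 1) y.
  by apply/esym; apply: (iter_rotate_mod 1 y alld).
have mhE (x : 'I_L2 + ('I_L3 + 'I_f) -> 'I_D.+1) (X2 X3 Z2 Z3 : nat -> nat) :
    (forall i : 'I_L2, X2 i + (- x (inl i))%R = Z2 i %[mod p.+1]) ->
    (forall i : 'I_L3, X3 i + (- x (inr (inl i)))%R = Z3 i %[mod q.+1]) ->
    mh Z2 Z3 =1 (fun i => A (- x i)%R (mh X2 X3 i)).
  move=> h2 h3 [i|[i|k]].
  - by rewrite /A [RHS]iter_e2; congr inl; apply/esym/inZpP/h2.
  - by rewrite /A [RHS]iter_e3; congr (inr (inl _)); apply/esym/inZpP/h3.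
  by rewrite /A [RHS]iter_e0.
apply: (@realizable_transfer _ _ (extend_act A (inZp 1)) _ id).
- by exists id.
- move=> [i|y]; first by congr inl; apply: val_inj; rewrite /= modnDmr addn1.
  by congr inr; apply: Aone.
apply: (@realizable_extension _ Y A {i | i \notin codom idx} _ _ _ _ _ _ Th
  (fun i => c (val i)) (fun i => s (val i)) (fun i => r (val i))
  (fun i => c (idx i)) (mh A2 A3) (mh U2 U3) (fun i => s (idx i))
  (mh (fun i => p * B2 i) (fun i => q * B3 i)) (fun i => r (idx i))
  (ch U2 U3) (fun z => ch A2 A3 (swap_sum z))
  (ch (fun i => p * B2 i) (fun i => q * B3 i))
  (fun z => ch (fun i => B2 i + p * C2) (fun i => B3 i + q * C3) (swap_sum z))
  (ch (fun i => p * (A2 i + R2)) (fun i => q * (A3 i + R3)))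
  (fun z => ch (fun i => p * (U2 i + S2)) (fun i => q * (U3 i + S3)) (swap_sum z))
  (th_map (fun x y => x) (fun x y => x)) (th_map (fun x y => y) (fun x y => y))
  (th_map op2 op3) th_rot (inZp 1)) => //.
- have eK : #|{: {i | i \notin codom idx}}| = D.+1 - (L2 + (L3 + f)).
    have cI' : #|codom idx| = L2 + (L3 + f) by rewrite card_codom // !card_sum !card_ord.
    have cD := cardC [in codom idx]; rewrite card_ord in cD.
    rewrite card_sig -cI' -[X in X - _]cD addKn.
    by apply: eq_card => i; rewrite !inE.
  have leK : L2 + (L3 + f) <= D.+1.
    by have := leq_card idx iI; rewrite !card_sum !card_ord.
  rewrite eK /Y /Th !card_sum !card_prod !card_sum !card_ord.
  have [N DN] : exists N, D.+1 = N + (L2 + (L3 + f)).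
    by exists (D.+1 - (L2 + (L3 + f))); rewrite subnK.
  move: Dg; rewrite DN addnK -L2p -L3q => /count_lcm; apply.
- by case=> i iK /=; apply: sE.
- exact: cp.
- exact: halves_inj.
- by apply: halves_inj => //; apply: inj_modN.
- move=> x x' j j'; apply: cross_pair => //.
- move=> x j u; apply: th_map_cross; exact: cross_half_in.
- apply: th_map_inj => //.
  by case=> [z|[z|z]] k k'.
- exact: cp.
- exact: halves_swap_inj.
- apply: (@copair_ext _ _ _ (mh (fun i => p * (A2 i + R2)) (fun i => q * (A3 i + R3)))).
    apply: mhE => i; [apply: normalize pD (rE2 i) _|apply: normalize qD (rE3 i) _].
      exact/nB/AB2.
    exact/nB/AB3.
  by apply: halves_inj => //; apply: inj_modN; apply: inj_modD.
- by move=> x x' j j'; apply: cross_pair.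
- move=> x j u; apply: th_map_cross; exact: cross_half_in.
- apply: th_map_inj.
  + by move=> x y x' y' -> /op2r ->.
  + by move=> x y x' y' -> /op3r ->.
  (* A fixed row and a fixed symbol force a fixed column, a pair that [th3] excludes. *)
  move=> z k k' e1 e2; have [k'' e3] : exists k'', (th3 z).2 = inr k''.
    rewrite e1 in e2; apply: fixed_only => //; apply: (op3r (inr k : model [:: q.+1] f)).
    by have := op3a (inr k) (th3 z).2; rewrite e2 /= => <-.
  by case: z e1 e2 e3 => [z|[z|z]].
- exact: cp.
- apply: (@copair_ext _ _ _ (mh (fun i => B2 i + p * C2) (fun i => B3 i + q * C3))).
    apply: mhE => i; [apply: normalize pD (cE2 i) _|apply: normalize qD (cE3 i) _].
      exact/nA/AB2.
    exact/nA/AB3.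
  by apply: halves_swap_inj => //; apply: inj_modD.
- apply: (@copair_ext _ _ _ (mh (fun i => p * (U2 i + S2)) (fun i => q * (U3 i + S3)))).
    apply: mhE => i; [apply: normalize pD (sE2 i) _|apply: normalize qD (sE3 i) _].
      exact/nU/UU2.
    exact/nU/UU3.
  by apply: halves_swap_inj => //; apply: inj_modN; apply: inj_modD.
- move=> x x' j j'; apply: cross_pair => //; exact: pairingC.
- move=> x j u; apply: th_map_cross; exact: cross_half_in.
- apply: th_map_inj.
  + by move=> x y x' y' -> /op2c ->.
  + by move=> x y x' y' -> /op3c ->.
  move=> z k k' e1 e2; have [k'' e3] : exists k'', (th3 z).1 = inr k''.
    rewrite e1 in e2; apply: fixed_only => //; apply: (op3c (inr k : model [:: q.+1] f)).
    by have := op3a (th3 z).1 (inr k); rewrite e2 /= => <-.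
  by case: z e1 e2 e3 => [z|[z|z]].
- move=> u; rewrite th_map_rot // /A; exact: Aone.
- move=> u; rewrite th_map_rot // /A; exact: Aone.
- move=> u; rewrite th_map_rot // /A; exact: Aone.
Qed.

End Lcm.

(** * Values on the shorter cycles in the lcm case *)

(* Of the last [G] values, which serve the triples meeting all three cycles, only the residues modulo [G] matter. *)
Definition arrays m G (A B U resA resB resU : nat -> nat) : Prop :=
  [/\ inj_mod m A /\ inj_mod m B, inj_mod m U,
      forall i, i < m - G -> A i = B i + i %[mod m],
      forall i, i < m - G -> U i + U i = i + i %[mod m] &
      forall j, j < G -> [/\ A (m - G + j) = resA j %[mod G],
        B (m - G + j) = resB j %[mod G] & U (m - G + j) = resU j %[mod G]]].

Lemma inj_mod_small m X : (forall i, i < m -> X i < m) ->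
  (forall i j, i < m -> j < m -> X i = X j -> i = j) -> inj_mod m X.
Proof. by move=> Xl XI i j il jl; rewrite !modn_small ?Xl //; apply: XI. Qed.

(** For even [G], [j + swapped G j] is a bijection modulo [G]. The sum of the residues forbids this
    for a permutation; [swapped] takes [G / 2] twice and misses 0. *)
Definition swapped G j := if j < G./2 then j + G./2 else j + 1 - G./2.

Lemma swapped_add_inj G j k : ~~ odd G -> j < G -> k < G ->
  j + swapped G j = k + swapped G k %[mod G] -> j = k.
Proof.
move=> ev; have GE : G = 2 * G./2 by lia.
set h := G./2 in GE; rewrite GE => jl kl.
have E i : i < 2 * h -> i + swapped (2 * h) i =
    (if i < h then 2 * (0 + i) else 2 * (h + (i - h)) + 1) + h %[mod 2 * h].
  move=> il; rewrite /swapped mul2n doubleK; case: (ltnP i h) => ih.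
    by congr (_ %% _); lia.
  by apply/esym; apply: (@eqmodI _ _ _ 1); lia.
rewrite !E // => /eqP; rewrite eqn_modDr => /eqP; exact: eqmod_halves.
Qed.

Section Arrays.
Variables (a G : nat).
Hypotheses (a2 : 1 < a) (G0 : 0 < G).
Let m := a * G.

Lemma arrays_odd : odd m -> exists A B : nat -> nat,
  arrays m G A B id (fun j => 2 * j) id id.
Proof.
move=> om; have am : G <= m by rewrite leq_pmull //; lia.
have mG : m - G = (a - 1) * G by rewrite mulnBl mul1n.
exists (fun i => 2 * i), id; split=> //; last first.
- move=> j jl; split; rewrite mG; [|by rewrite modnMDl|by rewrite modnMDl].
  by rewrite mulnDr mulnA modnMDl.
- by move=> i il; congr (_ %% _); lia.
- by apply: inj_mod_small.
split; last exact: inj_mod_small.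
move=> i j il jl E; apply: (@eqmod_mulI m 2 0) => //.
by rewrite coprime2n.
Qed.

Lemma near_A_inj : ~~ odd m -> inj_mod m (fun i => if i < m./2 then 2 * i else 2 * i + 1).
Proof.
move=> em; have mE : m = 2 * m./2 by lia.
move: (m) mE => n nE; set h := n./2 in nE *; move=> i j il jl E.
apply: (@eqmod_halves h 0 h) => //; rewrite -?nE //.
by move: E; case: (ltnP i h) => ih; case: (ltnP j h) => jh E;
  rewrite ?add0n ?subnKC.
Qed.

(** A near transversal of order [m]. Its left-over value [m / 2] is a multiple of [G], as [a] is
    even, and so replaces [m - G] modulo [G]. *)
Lemma arrays_even : ~~ odd a -> exists A B : nat -> nat,
  arrays m G A B id (fun j => 1 + 2 * j) id id.
Proof.
move=> ea; have em : ~~ odd m by rewrite /m oddM negb_and ea.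
have [l al] : exists l, a = 2 * l by exists a./2; lia.
have l0 : 0 < l by lia.
have mh : m./2 = l * G by rewrite /m al -mulnA mul2n doubleK.
have am : G <= m by rewrite leq_pmull //; lia.
have mG : m - G = (a - 1) * G by rewrite mulnBl mul1n.
have hL : m./2 <= m - G by rewrite mh mG leq_pmul2r //; lia.
pose B i := if i < m./2 then i else if i < m - G then i.+1 else if i == m - G then m./2 else i.
exists (fun i => if i < m./2 then 2 * i else 2 * i + 1), B; split.
- split; first exact: near_A_inj.
  apply: inj_mod_small => [i|i j]; rewrite /B; clear -am hL G0; do 6?case: ifP; lia.
- by apply: inj_mod_small.
- by move=> i il; rewrite /B il; case: ifP => h; congr (_ %% _); lia.
- by [].
move=> j jl; split.
- rewrite /= ifF; last by lia.
  by rewrite mG mulnDr mulnA -addnA modnMDl addnC.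
- rewrite /B ifF; last lia.
  rewrite ifF; last lia.
  case: eqP => [j0|_].
    have -> : j = 0 by lia.
    by rewrite mh modnMl mod0n.
  by rewrite mG modnMDl.
by rewrite mG modnMDl.
Qed.

(** For odd [a] the left-over value [m / 2] has residue [G / 2]. The last [G] values of [B] then
    have this residue twice and 0 never, like those of [swapped]. *)
Lemma arrays_swapped : odd a -> ~~ odd G -> exists A B : nat -> nat,
  arrays m G A B id (fun j => 1 + 2 * j) (swapped G) id.
Proof.
move=> oa eG; have em : ~~ odd m by rewrite /m oddM negb_and eG orbT.
have [l al] : exists l, a = 2 * l + 1 by exists a./2; lia.
have l0 : 0 < l by lia.
set h := G./2; have GE : G = 2 * h by rewrite /h; lia.
have mh : m./2 = l * G + h by rewrite /m al mulnDl; lia.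
have am : G <= m by rewrite leq_pmull //; lia.
have mG : m - G = (a - 1) * G by rewrite mulnBl mul1n.
have mG2 : m - G = 2 * (l * G) by rewrite mG al addnK mulnA.
have lG : G <= l * G by rewrite leq_pmull.
pose B i := if i < m./2 then i else if i < m - G then i.+1
  else if i < m - G + h then i + h else if i.+1 < m then i.+1 - h else m./2.
exists (fun i => if i < m./2 then 2 * i else 2 * i + 1), B; split.
- split; first exact: near_A_inj.
  move: (l * G) mh mG2 lG => t mh mG2 lG; clear -mh mG2 lG am GE G0 em.
  apply: inj_mod_small => [i|i j]; rewrite /B; do 8?case: ifP; lia.
- by apply: inj_mod_small.
- move=> i il; rewrite /B il; case: ifP => _; congr (_ %% _); lia.
- by [].
move=> j jl; split.
- rewrite /= ifF; last by lia.
  by rewrite mG mulnDr mulnA -addnA modnMDl addnC.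
- rewrite /B /swapped -/h ltn_add2l.
  rewrite ifF; last by lia.
  rewrite ifF; last by lia.
  case: (ltnP j h) => jh; first by rewrite mG -addnA modnMDl.
  case: ltnP => jm.
    have -> : (m - G + j).+1 - h = (a - 1) * G + (j + 1 - h) by rewrite -mG; lia.
    by rewrite modnMDl.
  rewrite mh modnMDl; congr (_ %% _); lia.
by rewrite mG modnMDl.
Qed.

(** Breaking at the multiple [t] of [G] instead of at [m / 2] keeps the last values of [B] a
    permutation modulo [G]; the odd symbols left for [A] are reached by adding [2 t], which does not
    change residues modulo [G]. *)
Lemma arrays_middle : odd a -> ~~ odd G -> exists A B : nat -> nat,
  arrays m G A B id id id id.
Proof.
move=> oa eG; have em : ~~ odd m by rewrite /m oddM negb_and eG orbT.
have [l al] : exists l, a = 2 * l + 1 by exists a./2; lia.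
have l0 : 0 < l by lia.
have am : G <= m by rewrite leq_pmull //; lia.
have mG : m - G = 2 * (l * G) by rewrite mulnA /m al mulnDl mul1n addnK.
have lG : G <= l * G by rewrite leq_pmull.
set t := l * G in mG lG *.
pose A i := if i < t then 2 * i else if i < 2 * t then 2 * i + 1
  else if odd i then i + 2 * t else i.
pose B i := if i < t then i else if i < 2 * t then i.+1 else if i == 2 * t then t else i.
exists A, B; split.
- split.
    have AE i : i < m -> A i = (if i < t then 2 * i else if i < 2 * t then
       (if 2 * i + 1 < m then 2 * i + 1 else 2 * i + 1 - m)
       else if odd i then (if i + 2 * t < m then i + 2 * t else i + 2 * t - m) else i) %[mod m].
      have sub x : (if x < m then x else x - m) = x %[mod m].
        by case: ltnP => // h; rewrite -[in RHS](subnK h) modnDr.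
      by move=> il; rewrite /A; do 2?case: ifP => // _; rewrite ?sub //; case: ifP; rewrite ?sub.
    move=> i j il jl; rewrite !AE //.
    clear AE; rewrite !modn_small; [|clear -il jl mG lG am eG em G0..].
    + clear -il jl mG lG am eG em G0; do 10?case: ifP; lia.
    + do 5?case: ifP; lia.
    do 5?case: ifP; lia.
  by apply: inj_mod_small => [i|i j]; rewrite /B; clear -am mG lG G0; do 6?case: ifP; lia.
- by apply: inj_mod_small.
- move=> i il; rewrite /A /B -mG il; case: ifP => _; congr (_ %% _); lia.
- by [].
move=> j jl; rewrite mG; have tG : 2 * t = (2 * l) * G by rewrite mulnA.
split; last by rewrite tG modnMDl.
- rewrite /A ifF; last lia.
  rewrite ifF; last lia.
  case: ifP => _; last by rewrite tG modnMDl.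
  by rewrite addnAC addnn -mul2n tG mulnA modnMDl.
rewrite /B ifF; last lia.
rewrite ifF; last lia.
case: eqP => [j0|_]; last by rewrite tG modnMDl.
have -> : j = 0 by lia.
by rewrite /t modnMl mod0n.
Qed.

(** The sequence from the proof of [cyclic_good_even], with [j - zeta G j] a bijection modulo even
    [G]. *)
Definition zeta G j := if odd j then (j.+1)./2 + G./2 else j./2.

Lemma zeta_inj j k : ~~ odd G -> j < G -> k < G ->
  j + zeta G k = k + zeta G j %[mod G] -> j = k.
Proof.
move=> eG jl kl /eqmod_ex[n]; rewrite /zeta.
by case: n => [|[|n]]; case: ifP; case: ifP; nia.
Qed.

(* Exchanging the middle value [t] and [t + m / 2] preserves doubles modulo [m]. *)
Lemma arrays_exchange A B resA resB : odd a -> ~~ odd G ->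
  arrays m G A B id resA resB id -> exists U, arrays m G A B U resA resB (zeta G).
Proof.
move=> oa eG [AB _ ABi _ res].
have [l al] : exists l, a = 2 * l + 1 by exists a./2; lia.
have l0 : 0 < l by lia.
set h := G./2; have GE : G = 2 * h by rewrite /h; lia.
have am : G <= m by rewrite leq_pmull //; lia.
have mG : m - G = 2 * (l * G) by rewrite mulnA /m al mulnDl mul1n addnK.
have lG : G <= l * G by rewrite leq_pmull.
have tG : 2 * (l * G) = (2 * l) * G by rewrite mulnA.
pose U i := if i < m - G then (if i == l * G then m - G + h else i)
  else if i.+1 == m then l * G else m - G + zeta G (i - (m - G)).
exists U; split=> //.
- apply: inj_mod_small.
    move=> i il; rewrite /U /zeta -/h; move: (l * G) mG lG => t mG lG.
    by clear -mG lG am GE il G0; do 4?case: ifP; lia.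
  move=> i j il jl; rewrite /U /zeta -/h; move: (l * G) mG lG => t mG lG.
  clear -mG lG am GE il G0 jl.
  by do 8?case: ifP; lia.
- move=> i il; rewrite /U il; case: eqP => // iE.
  by apply: (@eqmodI _ _ _ 1); lia.
move=> j jl; have [r1 r2 _] := res j jl; split=> //.
rewrite /U ifF; last lia.
rewrite mG addKn; case: eqP => jm; last by rewrite tG modnMDl.
rewrite /zeta -/h ifT; last lia.
have -> : (j.+1)./2 + h = G by lia.
by rewrite modnMl modnn.
Qed.

End Arrays.

Definition pair_mod G (X Y : nat -> nat) : Prop := forall j k, j < G -> k < G ->
  X j + Y k = X k + Y j %[mod G] -> j = k.

Lemma pair_mod_double G c : pair_mod G (fun j => c + 2 * j) id.
Proof.
move=> j k jl kl /eqP E; have: j = k %[mod G].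
  apply/eqP; rewrite -(eqn_modDl (c + j + k)); move: E; congr (_ %% _ == _ %% _); lia.
by rewrite !modn_small.
Qed.

(** For odd [G] the sums [RB2 + RB3] can be [3 j] with parameters [2 j] and [j], but the simpler
    choice of two identities with sum [2 j] already works. For even [G] a [swapped] array is needed
    on one side, hence an odd factor, which coprimality provides. If both factors are odd,
    [arrays_middle] gives [RA3 = id], and [U2] must then be altered to make [RA3 - RU2]
    injective. *)
Lemma arrays_exist a b G : 1 < a -> 1 < b -> coprime a b -> 0 < G ->
  exists A2 B2 U2 A3 B3 U3 RA2 RB2 RU2 RA3 RB3 RU3,
  [/\ arrays (a * G) G A2 B2 U2 RA2 RB2 RU2, arrays (b * G) G A3 B3 U3 RA3 RB3 RU3,
      pair_mod G RA2 RU3, pair_mod G RA3 RU2 &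
      forall j k, j < G -> k < G ->
        RB2 j + RB3 j = RB2 k + RB3 k %[mod G] -> j = k].
Proof.
move=> a2 b2 co G0; have [oG|eG] := boolP (odd G).
  have arr n : 1 < n -> exists A B c, arrays (n * G) G A B id (fun j => c + 2 * j) id id.
    move=> n2; have [on|en] := boolP (odd n).
      have [|A [B AB]] := arrays_odd n2 G0; first by rewrite oddM on.
      by exists A, B, 0; exact: AB.
    by have [A [B AB]] := arrays_even n2 G0 en; exists A, B, 1; exact: AB.
  have [A2 [B2 [c2 H2]]] := arr a a2; have [A3 [B3 [c3 H3]]] := arr b b2.
  exists A2, B2, id, A3, B3, id, (fun j => c2 + 2 * j), id, id, (fun j => c3 + 2 * j), id, id.
  split=> //; try exact: pair_mod_double.
  move=> j k jl kl E; apply: (@eqmod_mulI G 2 0) => //; first by rewrite coprime2n.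
  by rewrite !add0n !mul2n -!addnn.
have [oa|ea] := boolP (odd a); have [ob|eb] := boolP (odd b).
- have [A2 [B2 H2]] := arrays_swapped a2 G0 oa eG.
  have [U2 H2'] := arrays_exchange a2 G0 oa eG H2.
  have [A3 [B3 H3]] := arrays_middle b2 G0 ob eG.
  exists A2, B2, U2, A3, B3, id, (fun j => 1 + 2 * j), (swapped G), (zeta G), id, id, id.
  split=> //; first exact: pair_mod_double.
    by move=> j k jl kl /zeta_inj; apply.
  by move=> j k jl kl; rewrite ![swapped G _ + _]addnC; apply: swapped_add_inj.
- have [A2 [B2 H2]] := arrays_swapped a2 G0 oa eG.
  have [A3 [B3 H3]] := arrays_even b2 G0 eb.
  exists A2, B2, id, A3, B3, id, (fun j => 1 + 2 * j), (swapped G), id,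
    (fun j => 1 + 2 * j), id, id.
  split=> //; try exact: pair_mod_double.
  by move=> j k jl kl; rewrite ![swapped G _ + _]addnC; apply: swapped_add_inj.
- have [A2 [B2 H2]] := arrays_even a2 G0 ea.
  have [A3 [B3 H3]] := arrays_swapped b2 G0 ob eG.
  exists A2, B2, id, A3, B3, id, (fun j => 1 + 2 * j), id, id,
    (fun j => 1 + 2 * j), (swapped G), id.
  split=> //; try exact: pair_mod_double.
  by move=> j k jl kl; apply: swapped_add_inj.
have : 2 %| gcdn a b by rewrite dvdn_gcd !dvdn2 ea eb.
by rewrite (eqP co).
Qed.

(** * Assembly of the lcm case *)

Lemma realizable_lcm_indexed p q g D L2 L3 f (c s r : 'I_D.+1 -> 'I_D.+1)
    (idx : 'I_L2 + ('I_L3 + 'I_f) -> 'I_D.+1) (C2 S2 R2 C3 S3 R3 : nat) a b :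
  L2 + g.+1 = p.+1 -> L3 + g.+1 = q.+1 ->
  p.+1 = a * g.+1 -> q.+1 = b * g.+1 -> D.+1 = a * b * g.+1 ->
  1 < a -> 1 < b -> coprime a b ->
  injective c -> injective s -> injective r -> injective idx ->
  (forall i, i \notin codom idx -> s i = c i + r i)%R ->
  (forall i : 'I_L2, c (idx (inl i)) = C2 + i %[mod D.+1]) ->
  (forall i : 'I_L2, s (idx (inl i)) = S2 + (i + i) %[mod D.+1]) ->
  (forall i : 'I_L2, r (idx (inl i)) = R2 + i %[mod D.+1]) ->
  (forall i : 'I_L3, c (idx (inr (inl i))) = C3 + i %[mod D.+1]) ->
  (forall i : 'I_L3, s (idx (inr (inl i))) = S3 + (i + i) %[mod D.+1]) ->
  (forall i : 'I_L3, r (idx (inr (inl i))) = R3 + i %[mod D.+1]) ->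
  realizable (@rotate [:: p.+1] f) -> realizable (@rotate [:: q.+1] f) ->
  realizable (@rotate [:: D.+1; p.+1; q.+1] f).
Proof.
move=> L2p L3q pE qE DE a2 b2 co cI sI rI iI sE cE2 sE2 rE2 cE3 sE3 rE3 real2 real3.
have [A2 [B2 [U2 [A3 [B3 [U3 [RA2 [RB2 [RU2 [RA3 [RB3 [RU3]]]]]]]]]]]] :=
  arrays_exist a2 b2 co (ltn0Sn g).
rewrite -pE -qE => -[].
rewrite /arrays -L2p -L3q !addnK L2p L3q.
case=> -[IA2 IB2] IU2 AB2 UU2 res2 [[IA3 IB3] IU3 AB3 UU3 res3] P1 P2 P3.
have pD : p.+1 %| D.+1 by apply/dvdnP; exists b; rewrite DE pE; lia.
have qD : q.+1 %| D.+1 by apply/dvdnP; exists a; rewrite DE qE; lia.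
have gp : g.+1 %| p.+1 by rewrite pE dvdn_mull.
have gq : g.+1 %| q.+1 by rewrite qE dvdn_mull.
have pair X Y RX RY :
    (forall j, j < g.+1 -> X (L2 + j) = RX j %[mod g.+1]) ->
    (forall j, j < g.+1 -> Y (L3 + j) = RY j %[mod g.+1]) ->
    pair_mod g.+1 RX RY -> pairing g (fun j => X (L2 + j)) (fun j => Y (L3 + j)).
  move=> hX hY XY j k jl kl.
  rewrite (proj1 (inZpP _ _ _) (hX j jl)) (proj1 (inZpP _ _ _) (hX k kl)).
  rewrite (proj1 (inZpP _ _ _) (hY j jl)) (proj1 (inZpP _ _ _) (hY k kl)).
  move=> E; apply: XY => //; apply/inZpP; rewrite !inZpD.
  by apply/eqP; rewrite -subr_eq addrAC E subrK.
apply: (@realizable_lcm p q g f L2 L3 L2p L3q gp gq D A2 B2 U2 A3 B3 U3 c s r idx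
  C2 S2 R2 C3 S3 R3) => //.
- by move: qE; case: (q) => // qE; nia.
- by rewrite DE pE qE; lia.
- move=> x y; wlog xy : x y / x <= y.
    move=> W xl yl e1 e2; case/orP: (leq_total x y) => h; first exact: W.
    by apply/esym/W.
  move=> xl yl /esym/eqP + /esym/eqP; rewrite !eqn_mod_dvd // => d1 d2.
  have : D.+1 %| y - x.
    rewrite DE; suff <- : lcmn p.+1 q.+1 = a * b * g.+1 by rewrite dvdn_lcm d1.
    by rewrite pE qE -muln_lcml /lcmn (eqP co) divn1.
  by move=> /dvdn_leq; lia.
- by apply: (pair _ _ RA2 RU3) P1 => j; [case/res2|case/res3].
- apply/pairingC/(pair _ _ RU2 RA3).
  + by move=> j /res2[].
  + by move=> j /res3[].
  by move=> j k jl kl E; apply/esym/P2 => //; rewrite addnC E addnC.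
- move=> j k jl kl; rewrite !(inZpN _ gq) !opprK -!inZpD => /inZpP.
  have [_ b2j _] := res2 j jl; have [_ b2k _] := res2 k kl.
  have [_ b3j _] := res3 j jl; have [_ b3k _] := res3 k kl.
  by rewrite -modnDm b2j b3j modnDm -[RHS]modnDm b2k b3k modnDm; apply: P3.
all: try by move=> i; apply: eqmod_dvd pD _.
all: by move=> i; apply: eqmod_dvd qD _.
Qed.

Lemma realizable_lcm_odd p q g D f a b :
  p.+1 = a * g.+1 -> q.+1 = b * g.+1 -> D.+1 = a * b * g.+1 ->
  1 < a -> 1 < b -> coprime a b -> odd D.+1 ->
  (p.+1 - g.+1) + (q.+1 - g.+1) + f <= D.+1 ->
  realizable (@rotate [:: p.+1] f) -> realizable (@rotate [:: q.+1] f) ->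
  realizable (@rotate [:: D.+1; p.+1; q.+1] f).
Proof.
move=> pE qE DE a2 b2 co oD; set L2 := _ - _; set L3 := _ - g.+1 => lD.
have gp : g.+1 <= p.+1 by rewrite pE leq_pmull; lia.
have gq : g.+1 <= q.+1 by rewrite qE leq_pmull; lia.
pose ix (z : 'I_L2 + ('I_L3 + 'I_f)) : nat := match z with inl i => i
  | inr (inl i) => L2 + i | inr (inr i) => L2 + L3 + i end.
have ixl z : ix z < D.+1.
  by case: z => [i|[i|i]] /=; have := ltn_ord i; lia.
apply: (@realizable_lcm_indexed p q g D L2 L3 f id (fun i => i + i)%R id
  (fun z => Ordinal (ixl z)) 0 0 0 L2 (L2 + L2) L2 a b) => //.
- by rewrite subnK.
- by rewrite subnK.
- move=> i j /(congr1 val) /= /eqmod_ex[k ij].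
  apply: val_inj => /=; have := ltn_ord i; have := ltn_ord j.
  by case: k ij => [|[|k]]; nia.
- move=> [i|[i|i]] [j|[j|j]] /(congr1 val) /= ij; have := ltn_ord i; have := ltn_ord j.
  + by move=> _ _; congr inl; apply: val_inj.
  + by lia.
  + by lia.
  + by lia.
  + by move=> _ _; congr (inr (inl _)); apply: val_inj => /=; lia.
  + by lia.
  + by lia.
  + by lia.
  by move=> _ _; congr (inr (inr _)); apply: val_inj => /=; lia.
- by move=> i; rewrite /= modn_mod.
by move=> i; rewrite /= modn_mod; congr (_ %% _); lia.
Qed.

Lemma realizable_lcm_even p q g D H f a b : D.+1 = 2 * H ->
  p.+1 = a * g.+1 -> q.+1 = b * g.+1 -> D.+1 = a * b * g.+1 ->
  1 < a -> 1 < b -> coprime a b ->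
  (p.+1 - g.+1) + (q.+1 - g.+1) + f <= D.+1 -> 0 < f ->
  realizable (@rotate [:: p.+1] f) -> realizable (@rotate [:: q.+1] f) ->
  realizable (@rotate [:: D.+1; p.+1; q.+1] f).
Proof.
move=> dH pE qE DE a2 b2 co; set L2 := _ - _; set L3 := _ - g.+1 => lD f0.
have gp : g.+1 <= p.+1 by rewrite pE leq_pmull; lia.
have gq : g.+1 <= q.+1 by rewrite qE leq_pmull; lia.
have L2H : L2 <= H.
  have : 2 * p.+1 <= D.+1; last lia.
  by rewrite (_ : D.+1 = b * p.+1) ?leq_mul2r ?b2 ?orbT // DE pE; lia.
have L3H : L3 < H.
  have : 2 * q.+1 <= D.+1; last lia.
  by rewrite (_ : D.+1 = a * q.+1) ?leq_mul2r ?a2 ?orbT // DE qE; lia.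
(* The indices just below [H] serve one cycle and those from [H] on the other; the exceptional index
   [D] goes to the first fixed point, and the other fixed points take indices outside this
   window. *)
pose ix (z : 'I_L2 + ('I_L3 + 'I_f)) : nat := match z with inl i => H - L2 + i
  | inr (inl i) => H + i
  | inr (inr i) => if i == 0 :> nat then D
                   else if i.-1 < H - L2 then i.-1 else i.-1 + (L2 + L3) end.
have ixl z : ix z < D.+1.
  case: z => [i|[i|i]] /=; have := ltn_ord i; try lia.
  by case: eqP => // i0; case: (ltnP i.-1 (H - L2)); lia.
have ixE z : (inord (ix z) : 'I_D.+1) = ix z :> nat by rewrite inordK.
apply: (@realizable_lcm_indexed p q g D L2 L3 f id (fun i => inord (near_s H i))
  (fun i => inord (near_r H i)) (fun z => inord (ix z)) (H - L2) (2 * (H - L2)) (H - L2) H 1 H.+1 a b) => //.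
- by rewrite subnK.
- by rewrite subnK.
- exact: near_s_inj.
- exact: near_r_inj.
- move=> y z /(congr1 val); rewrite /= !ixE.
  case: y z => [i|[i|i]] [j|[j|j]] /=; have := ltn_ord i; have := ltn_ord j.
  + by move=> _ _ ij; congr inl; apply: val_inj => /=; lia.
  + by lia.
  + by case: eqP => j0; [|case: (ltnP j.-1 (H - L2))]; lia.
  + by lia.
  + by move=> _ _ ij; congr (inr (inl _)); apply: val_inj => /=; lia.
  + by case: eqP => j0; [|case: (ltnP j.-1 (H - L2))]; lia.
  + by case: eqP => i0; [|case: (ltnP i.-1 (H - L2))]; lia.
  + by case: eqP => i0; [|case: (ltnP i.-1 (H - L2))]; lia.
  move=> jl il ij; congr (inr (inr _)); apply: val_inj => /=; move: ij.
  by case: eqP => i0; case: eqP => j0; case: (ltnP i.-1 (H - L2));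
    case: (ltnP j.-1 (H - L2)); lia.
- move=> i iK; apply: near_sE => //; apply: contraNneq iK => ->.
  by apply/codomP; exists (inr (inr (Ordinal f0))).
- by move=> i; rewrite ixE.
- move=> i; have il := ltn_ord i; rewrite (near_s_inord dH (ixl _)) /near_s ifT.
    by congr (_ %% _) => /=; lia.
  by rewrite /=; lia.
- move=> i; have il := ltn_ord i; rewrite (near_r_inord dH (ixl _)) /near_r ifT //.
  by rewrite /=; lia.
- by move=> i; rewrite ixE.
- move=> i; have il := ltn_ord i; rewrite (near_s_inord dH (ixl _)) /near_s ifF.
    by congr (_ %% _) => /=; lia.
  by rewrite /=; lia.
move=> i; have il := ltn_ord i; rewrite (near_r_inord dH (ixl _)) /near_r ifF.
  by rewrite ifT //= ; lia.
by rewrite /=; lia.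
Qed.

Lemma realizable_coprime_blocks p q f : q < p -> ~~ (q %| p) -> 0 < q -> f <= q ->
  (~~ odd (lcmn p q) -> 0 < f) ->
  realizable (@rotate [:: lcmn p q; p; q] f).
Proof.
move=> qp nqp q0 fq par; have p0 : 0 < p by lia.
have [g gE] : exists g, gcdn p q = g.+1.
  by exists (gcdn p q).-1; rewrite prednK // gcdn_gt0 p0.
have [a pE] : exists a, p = a * g.+1 by apply/dvdnP; rewrite -gE dvdn_gcdl.
have [b qE] : exists b, q = b * g.+1 by apply/dvdnP; rewrite -gE dvdn_gcdr.
have co : coprime a b.
  by rewrite /coprime -(eqn_pmul2r (ltn0Sn g)) muln_gcdl -pE -qE gE mul1n.
have b2 : 1 < b.
  rewrite ltn_neqAle; apply/andP; split.
    by apply: contraNneq nqp => b1; rewrite qE -b1 mul1n -gE dvdn_gcdl.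
  by case: (b) qE q0 => // ->.
have ab : b < a by move: qp; rewrite pE qE ltn_pmul2r.
have DE : lcmn p q = a * b * g.+1.
  by rewrite pE qE -muln_lcml /lcmn (eqP co) divn1.
have bound : (p - g.+1) + (q - g.+1) + f <= lcmn p q.
  (* With [f] replaced by its bound [q], the inequality reduces to [(a - 2) (b - 1) >= 0]. *)
  rewrite DE; apply: (@leq_trans ((p - g.+1) + (q - g.+1) + q)).
    by rewrite leq_add2l.
  rewrite pE qE -{2 4}[g.+1]mul1n -!mulnBl -!mulnDl leq_mul2r; apply/orP; right.
  by nia.
have evenD n : n %| lcmn p q -> ~~ odd n -> 0 < f.
  move=> nD en; apply: par; apply: contra en => oD; exact: dvdn_odd nD oD.
have real2 : realizable (@rotate [:: p] f).
  by apply: realizable1 => //; [lia|apply: evenD (dvdn_lcml _ _)].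
have real3 : realizable (@rotate [:: q] f).
  by apply: realizable1 => //; apply: evenD (dvdn_lcmr _ _).
have D0 : 0 < lcmn p q by rewrite lcmn_gt0 p0.
move: bound real2 real3 par DE pE qE D0.
case: (p) p0 => // p' _; case: (q) q0 => // q' _.
case: (lcmn _ _) => // D bound real2 real3 par DE pE qE _.
have [oD|eD] := boolP (odd D.+1).
  by apply: (realizable_lcm_odd pE qE DE) => //; lia.
have dH : D.+1 = 2 * D.+1./2 by lia.
by apply: (realizable_lcm_even dH pE qE DE) => //; [lia|apply: par].
Qed.

(** * Three cycles *)

Lemma dvdn_ltn_double e d : 0 < d -> e %| d -> e < d -> 2 * e <= d.
Proof. by move=> d0 /dvdnP[[|[|k]]] ->; nia. Qed.

Lemma realizable_three_equal d f : 0 < d -> f <= 3 * d -> (~~ odd d -> 0 < f) ->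
  realizable (@rotate [:: d; d; d] f).
Proof.
move=> d0 fd par; apply: realizable_triple => //; apply: realizable1 => //.
  lia.
by rewrite oddM /=.
Qed.

Lemma realizable_two_equal d f : 0 < d -> f <= 2 * d ->
  realizable (@rotate [:: d; d] f).
Proof.
(* A single cycle of length [2 d] needs a fixed point, so [f = 0] is treated apart. *)
move=> d0 fd; case: (posnP f) => [->|f0].
  have [od|ed] := boolP (odd d); first exact: realizable_two_odd.
  case: d d0 {fd} ed => // d _ ed.
  by apply: (@realizable_two_even0 _ d.+1./2); lia.
apply: (@realizable_double d [::] f id) => //; first by exists id.
by apply: realizable1 => //; lia.
Qed.

Lemma realizable_two_small e d f : 0 < e -> e < d -> e %| d -> f <= e ->
  (~~ odd e -> 0 < f) -> realizable (@rotate [:: d; e] f).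
Proof.
move=> e0 ed edd fe par; have d0 : 0 < d by lia.
have e2d := dvdn_ltn_double d0 edd ed.
have reale := realizable1 e0 fe par.
have [od|nod] := boolP (odd d).
  by apply: realizable_cycle_odd => //=; rewrite ?edd ?addn0 //; lia.
case: d ed edd d0 e2d nod => // d ed edd _ e2d nod.
have dH : d.+1 = 2 * d.+1./2 by lia.
have [oe|ne] := boolP (odd e).
  by apply: (realizable_cycle_even_oddY dH) => //=; rewrite ?oe ?edd //; lia.
apply: (realizable_cycle_even_evenY dH) => //=; rewrite ?e0 ?ne ?edd //; last lia.
exact: par.
Qed.

Lemma realizable_one_large_two_small d e f : 0 < e -> e < d -> e %| d -> 2 * e + f <= d ->
  f <= 2 * e -> (~~ odd e /\ odd (d %/ e) -> 0 < f) ->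
  realizable (@rotate [:: d; e; e] f).
Proof.
move=> e0 ed edd efd fe par; have d0 : 0 < d by lia.
have e2d := dvdn_ltn_double d0 edd ed.
have real2 := realizable_two_equal e0 fe.
have [od|nod] := boolP (odd d).
  by apply: realizable_cycle_odd => //=; rewrite ?edd ?addn0 //; lia.
case: d ed edd d0 e2d nod efd par => // d ed edd _ e2d nod efd par.
have dH : d.+1 = 2 * d.+1./2 by lia.
have [oe|ne] := boolP (odd e).
  by apply: (realizable_cycle_even_oddY dH) => //=; rewrite ?oe ?edd //; lia.
case: (posnP f) => [f0|f0].
  apply: (realizable_cycle_even_twice dH) => //; last lia.
  (* Without fixed points the quotient is even, so [e] divides half of [d.+1]. *)
  have : ~~ odd (d.+1 %/ e) by apply/negP => oq; have := par (conj ne oq); lia.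
  move: edd => /dvdnP[k kE]; rewrite kE mulnK // => ek.
  by rewrite -[k]odd_double_half (negPf ek) add0n -mul2n -mulnA mul2n doubleK dvdn_mull.
by apply: (realizable_cycle_even_evenY dH) => //=; rewrite ?e0 ?ne ?edd //; lia.
Qed.

Definition doubling e (i : 'I_e) : 'I_e :=
  Ordinal (ltn_pmod (2 * i) (leq_ltn_trans (leq0n i) (ltn_ord i))).

Lemma doubling_bij e : odd e -> bijective (@doubling e).
Proof.
move=> oe; apply: injF_bij => i j /(congr1 val) /= ij; apply: val_inj.
by apply: (eqmod_mulI _ (ltn_ord i) (ltn_ord j) (ij : 0 + 2 * i = 0 + 2 * j %[mod e])); rewrite coprime2n.
Qed.

Lemma realizable_two_large_one_small d e f : 0 < e -> e < d -> e %| d -> f <= e ->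
  (~~ odd e -> 0 < f) -> realizable (@rotate [:: d; d; e] f).
Proof.
move=> e0 ed edd fe par; have d0 : 0 < d by lia.
have e2d := dvdn_ltn_double d0 edd ed.
have [oe|ne] := boolP (odd e).
  (* For odd [e] doubling conjugates the short cycle to its square, so both long cycles come from
     one of length [2 d]. *)
  have [h hK Kh] := doubling_bij oe.
  pose g (F : 'I_e -> 'I_e) (y : model [:: e] f) : model [:: e] f :=
    match y with inl i => inl (F i) | inr k => inr k end.
  apply: (@realizable_double d [:: e] f (g (@doubling e))) => //.
  - by exists (g h) => -[i|k] //=; rewrite ?hK ?Kh.
  - case=> [i|k] //=; congr inl; apply: val_inj; rewrite /= modnMmr.
    have modS x : (x %% e).+1 %% e = x.+1 %% e by rewrite -addn1 modnDml addn1.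
    by rewrite modS -(addn2 ((2 * i) %% e)) modnDml; congr (_ %% _); lia.
  apply: realizable_two_small => //; [lia|exact: dvdn_mull].
case: d ed edd d0 e2d => // d ed edd _ e2d.
apply: (@realizable_two_even_cycle d d.+1./2) => //.
- have : ~~ odd d.+1 by apply: contra ne => od; apply: dvdn_odd edd od.
  lia.
- exact: par.
- lia.
exact: realizable1.
Qed.

Lemma realizable_divisor_chain d1 d2 d3 f : 0 < d3 -> d3 < d2 -> d2 < d1 ->
  d3 %| d2 -> d2 %| d1 -> f <= d3 -> (~~ odd d3 -> 0 < f) ->
  realizable (@rotate [:: d1; d2; d3] f).
Proof.
move=> d30 d32 d21 dv32 dv21 fd par; have d20 : 0 < d2 by lia.
have d10 : 0 < d1 by lia.
have b32 := dvdn_ltn_double d20 dv32 d32; have b21 := dvdn_ltn_double d10 dv21 d21.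
have dv31 := dvdn_trans dv32 dv21.
have real2 := realizable_two_small d30 d32 dv32 fd par.
have [od|nod] := boolP (odd d1).
  by apply: realizable_cycle_odd => //=; rewrite ?dv21 ?dv31 ?addn0 //; lia.
case: d1 d21 dv21 d10 b21 dv31 nod => // d d21 dv21 _ b21 dv31 nod.
have dH : d.+1 = 2 * d.+1./2 by lia.
have [o3|n3] := boolP (odd d3); last first.
  have n2 : ~~ odd d2 by apply: contra n3 => o2; apply: dvdn_odd dv32 o2.
  apply: (realizable_cycle_even_evenY dH) => //=; last lia;
    rewrite ?d20 ?d30 ?n2 ?n3 ?dv21 ?dv31 //; exact: par.
have [o2|n2] := boolP (odd d2).
  by apply: (realizable_cycle_even_oddY dH) => //=; rewrite ?o2 ?o3 ?dv21 ?dv31 //; lia.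
by apply: (realizable_cycle_even_mixed dH) => //; lia.
Qed.

(** * Necessary conditions *)

(* Summing [phi (op x y) - phi y] over the pairs with [phi x = 0] gives [0] row by row; translating each pair along its orbit to one with [phi y = 0] gives [#|fibre| ^ 2] times the sum of the residues, which is [d / 2] for even [d]. *)
Lemma even_fibre (T : finType) (a : T -> T) (op : T -> T -> T) (S : {set T}) d
    (phi : T -> 'I_d.+1) :
  latin_op op -> (forall x y, a (op x y) = op (a x) (a y)) ->
  injective a -> (forall x, (a x \in S) = (x \in S)) ->
  (forall x y, x \in S -> (op x y \in S) = (y \in S)) ->
  (forall x y, y \in S -> (op x y \in S) = (x \in S)) ->
  (forall x, x \in S -> phi (a x) = phi x + inZp 1)%R ->
  ~~ odd d.+1 -> ~~ odd #|[set x in S | phi x == 0%R]|.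
Proof.
move=> [opr opc] opa aI aS opS1 opS2 phia ev.
set rho := #|_|.
have ka k : injective (iter k a) by elim: k => // k IHk x y /= /aI/IHk.
have kS k x : (iter k a x \in S) = (x \in S) by elim: k => //= k <-.
have kphi k x : x \in S -> phi (iter k a x) = (phi x + inZp k)%R.
  move=> xS; elim: k => [|k IHk] /=.
    by rewrite (_ : inZp 0 = 0%R) ?addr0 //; apply: val_inj.
  rewrite phia ?kS // IHk -addrA; congr (_ + _)%R; apply: val_inj.
  by rewrite /= modnDm addn1.
have kop k x y : iter k a (op x y) = op (iter k a x) (iter k a y).
  by elim: k => //= k ->.
have inZpK (i : 'I_d.+1) : inZp i = i by apply: valZpK.
have total : (\sum_(z in S) phi z = (\sum_(i : 'I_d.+1) i) *+ rho)%R.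
  rewrite (partition_big phi predT) //= -sumrMnl; apply: eq_bigr => i _.
  rewrite (reindex_inj (ka (val i))) /=.
  rewrite (eq_bigl [in [set x in S | phi x == 0%R]]); last first.
    move=> x; rewrite !inE kS; case xS: (x \in S) => //=.
    by rewrite kphi // inZpK -subr_eq0 addrK.
  rewrite (eq_bigr (fun=> i)); first by rewrite sumr_const.
  by move=> x; rewrite inE => /andP[xS /eqP x0]; rewrite kphi // inZpK x0 add0r.
have rows : (\sum_(x in S | phi x == 0%R) \sum_(y in S) (phi (op x y) - phi y) = 0)%R.
  apply: big1 => x /andP[xS _]; rewrite sumrB.
  rewrite [X in (_ - X)%R](reindex_inj (opr x)) /=.
  by rewrite (eq_bigl _ _ (fun y => opS1 x y xS)) subrr.
have cols : (\sum_(y in S | phi y == 0%R) \sum_(x in S) phi (op x y) =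
    (\sum_(z in S) phi z) *+ rho)%R.
  rewrite (eq_bigr (fun=> \sum_(z in S) phi z)%R); last first.
    move=> y /andP[yS _]; rewrite [RHS](reindex_inj (opc y)) /=.
    by apply/esym/eq_bigl => x; apply: opS2.
  by rewrite sumr_const; congr (_ *+ _)%R; apply: eq_card => x; rewrite inE.
have shift (i : 'I_d.+1) :
    (\sum_(x in S | phi x == 0%R) \sum_(y in S | phi y == i) (phi (op x y) - phi y) =
     \sum_(x in S | - phi x == i) \sum_(y in S | phi y == 0) phi (op x y))%R.
  rewrite (reindex_inj (ka (val i))) /=; apply: eq_big => [x|x].
    rewrite kS; case xS: (x \in S) => //=.
    by rewrite kphi // inZpK addr_eq0 eq_sym eqr_oppLR eq_sym.
  rewrite kS => /andP[xS _]; rewrite (reindex_inj (ka (val i))) /=.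
  apply: eq_big => [y|y].
    rewrite kS; case yS: (y \in S) => //=.
    by rewrite kphi // inZpK -subr_eq0 addrK.
  rewrite kS => /andP[yS]; rewrite -kop !kphi ?opS1 // inZpK => yi.
  by rewrite (eqP yi) addrK.
have : ((\sum_(i : 'I_d.+1) i) *+ rho *+ rho = 0)%R.
  rewrite -total -cols; apply: etrans _ rows.
  transitivity (\sum_i \sum_(x in S | - phi x == i)
      \sum_(y in S | phi y == 0) phi (op x y))%R.
    rewrite exchange_big /=.
    by rewrite (partition_big (fun x => - phi x)%R predT).
  rewrite -(eq_bigr _ (fun i _ => shift i)) exchange_big /=.
  by apply: eq_bigr => x _; rewrite [RHS](partition_big phi predT) //=.
rewrite -mulrnA.
have -> : (\sum_(i : 'I_d.+1) i)%R = inZp 'C(d.+1, 2) :> 'I_d.+1.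
  rewrite -bin2_sum big_mkord.
  rewrite (eq_bigr (fun i : 'I_d.+1 => inZp i)) => [|i _]; last by rewrite inZpK.
  by elim/big_ind2: _ => [|m1 x1 m2 x2 -> ->|//]; apply: val_inj; rewrite /= ?modnDm.
have zn m n : (inZp m *+ n = inZp (m * n) :> 'I_d.+1)%R.
  elim: n => [|n IHn]; first by rewrite muln0; apply: val_inj.
  by rewrite mulrSr IHn mulnSr; apply: val_inj; rewrite /= modnDm.
(* [d.+1] divides [(d.+1 / 2) d rho^2] and [d] is odd, so [rho] is even. *)
rewrite zn => /(congr1 val) /= /eqP; rewrite -[_ == 0]/(d.+1 %| _).
have dE : d.+1 = 2 * (d.+1)./2 by lia.
have h0 : 0 < (d.+1)./2 by lia.
have -> : 'C(d.+1, 2) = (d.+1)./2 * d.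
  by rewrite bin2 /= {1}dE -mulnA mul2n doubleK.
rewrite {1}dE (mulnC 2) -mulnA dvdn_pmul2l // dvdn2 !oddM.
have -> : odd d by lia.
by rewrite andbb.
Qed.

(** * Subsquares fixed by powers of the automorphism *)

Section Necessity.
Variables (s : seq nat) (f : nat).
Let T := model s f.
Let a := @rotate s f.
Variable op : T -> T -> T.
Hypothesis opL : latin_op op.
Hypothesis opa : forall x y, a (op x y) = op (a x) (a y).

Definition fixed k : {set T} := [set x | iter k a x == x].

Lemma iter_op k x y : iter k a (op x y) = op (iter k a x) (iter k a y).
Proof. by elim: k => //= k ->. Qed.

Lemma fixed_opr k x y : x \in fixed k -> (op x y \in fixed k) = (y \in fixed k).
Proof.
by rewrite !inE iter_op => /eqP->; rewrite (inj_eq (proj1 opL x)).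
Qed.

Lemma fixed_opl k x y : y \in fixed k -> (op x y \in fixed k) = (x \in fixed k).
Proof.
by rewrite !inE iter_op => /eqP->; rewrite (inj_eq (proj2 opL y)).
Qed.

Lemma fixed_act k x : (a x \in fixed k) = (x \in fixed k).
Proof. by rewrite !inE -iterSr iterS (inj_eq (@rotate_inj s f)). Qed.

(** Multiplying the smaller subsquare by [z] gives equally many points of the larger one outside
    it. *)
Lemma fixed_bound k l z : k %| l -> z \in fixed l -> z \notin fixed k ->
  2 * #|fixed k| <= #|fixed l|.
Proof.
move=> kl zl zk.
have fkl : fixed k \subset fixed l.
  apply/subsetP => x; rewrite !inE => /eqP xk.
  by case/dvdnP: kl => m ->; elim: m => // m IHm; rewrite mulSn iterD (eqP IHm) xk.
have: #|[set op x z | x in fixed k]| <= #|fixed l :\: fixed k|.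
  apply: subset_leq_card; apply/subsetP => _ /imsetP[x xk ->].
  by rewrite inE fixed_opr // zk fixed_opr // (subsetP fkl).
rewrite card_imset; last exact: (proj2 opL).
by rewrite cardsD (setIidPr fkl); have := subset_leq_card fkl; lia.
Qed.

End Necessity.

Lemma fixed_inl d s f k (i : 'I_d) : (inl i \in fixed (d :: s) f k) = (d %| k).
Proof.
rewrite inE iter_inl; apply/eqP/idP => [[/(congr1 val)]|dk].
  rewrite /= val_iter_ordS => ik.
  have : i + k == i + 0 %[mod d] by rewrite ik addn0 modn_small.
  by rewrite eqn_modDl mod0n.
congr inl; apply: val_inj.
by rewrite /= val_iter_ordS -modnDmr (eqP dk) addn0 modn_small.
Qed.

Lemma fixed_inr d s f k (y : model s f) :
  (inr y \in fixed (d :: s) f k) = (y \in fixed s f k).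
Proof. by rewrite !inE iter_inr; apply/eqP/eqP => [[]|->]. Qed.

Lemma card_fixed s f k :
  #|fixed s f k| = sumn [seq d <- s | d %| k] + f.
Proof.
elim: s => [|d s IHs].
  rewrite /= add0n -[RHS]card_ord -cardsT; apply: eq_card => x.
  by rewrite !inE; apply/eqP; elim: k.
have -> : fixed (d :: s) f k =
    [set inl i | i : 'I_d & d %| k] :|: [set inr y | y in fixed s f k].
  apply/setP => -[i|y]; rewrite ?fixed_inl ?fixed_inr in_setU.
    apply/idP/orP => [dk|[|]]; first by left; apply/imsetP; exists i; rewrite ?inE.
      by case/imsetP => j; rewrite inE.
    by case/imsetP.
  apply/idP/orP => [yk|[|]]; first by right; apply: imset_f.
    by case/imsetP.
  by case/imsetP => z zk [->].
rewrite cardsU disjoint_setI0 ?cards0 ?subn0; last first.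
  by rewrite disjoints_subset; apply/subsetP => _ /imsetP[i _ ->]; rewrite inE; apply/imsetP => -[].
rewrite !card_imset; try by move=> ? ? [].
rewrite IHs /=; case: ifP => dk /=.
  by rewrite addnA; congr (_ + _ + _); rewrite -[RHS]card_ord -cardsT; apply: eq_card => i; rewrite !inE ?dk.
by rewrite eq_card0 // => i; rewrite !inE ?dk.
Qed.

(** Fixed points get the default label 0; the lemmas about labels take [f = 0]. *)
Fixpoint residue d s f : model s f -> 'I_d.+1 :=
  match s with
  | [::] => fun _ => 0%R
  | e :: s' => fun x : model (e :: s') f =>
      match x with inl i => inZp i | inr y => residue d y end
  end.

Lemma residue_rotate d s k (x : model s 0) : x \in fixed s 0 k ->
  {in s, forall e, e %| k -> d.+1 %| e} ->
  residue d (rotate x) = (residue d x + inZp 1)%R.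
Proof.
elim: s x => [|e s IHs] x; first by case: x.
case: x => [i|y]; rewrite ?fixed_inl ?fixed_inr => xk sd /=.
  have de := sd e (mem_head _ _) xk.
  by apply: val_inj; rewrite /= (modn_dvdm _ de) modnDm addn1.
by apply: IHs => // e' e's; apply: sd; rewrite inE e's orbT.
Qed.

Lemma card_multiples d k : #|[set i : 'I_(k * d.+1) | inZp i == 0%R :> 'I_d.+1]| = k.
Proof.
have lt (j : 'I_k) : j * d.+1 < k * d.+1 by rewrite ltn_pmul2r.
rewrite -[RHS]card_ord -[in RHS](card_imset predT (f := fun j => Ordinal (lt j))); last first.
  by move=> i j /(congr1 val) /= /eqP; rewrite eqn_pmul2r // => /eqP ij; apply: val_inj.
apply: eq_card => i; rewrite inE; apply/eqP/imsetP => [/(congr1 val)/= di|[j _ ->]].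
  have /dvdnP[j ij] : d.+1 %| i by apply/eqP.
  have jk : j < k by rewrite -(ltn_pmul2r (ltn0Sn d)) -ij.
  by exists (Ordinal jk) => //; apply: val_inj.
by apply: val_inj; rewrite /= modnMl.
Qed.

Lemma card_residue d s k : {in s, forall e, e %| k -> d.+1 %| e} ->
  #|[set x in fixed s 0 k | residue d x == 0%R]| =
    sumn [seq e %/ d.+1 | e <- s & e %| k].
Proof.
elim: s => [|e s IHs] sd.
  by rewrite /= eq_card0 // => -[].
have {}IHs := IHs (fun e' h => sd e' (mem_behead (s := e :: s) h)).
have -> : [set x in fixed (e :: s) 0 k | residue d x == 0%R] =
    [set inl i | i : 'I_e & (e %| k) && (inZp i == 0%R :> 'I_d.+1)] :|:
    [set inr y | y in [set x in fixed s 0 k | residue d x == 0%R]].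
  apply/setP => -[i|y]; rewrite in_set ?fixed_inl ?fixed_inr in_setU /=.
    apply/idP/orP => [h|[|]]; first by left; apply/imsetP; exists i; rewrite ?inE.
      by case/imsetP => j; rewrite inE => h [->].
    by case/imsetP.
  apply/idP/orP => [h|[|]]; first by right; apply/imsetP; exists y; rewrite // in_set.
    by case/imsetP.
  by case/imsetP => z; rewrite in_set => h [->].
rewrite cardsU disjoint_setI0 ?cards0 ?subn0; last first.
  by rewrite disjoints_subset; apply/subsetP => _ /imsetP[i _ ->]; rewrite inE; apply/imsetP => -[].
rewrite !card_imset; try by move=> ? ? [].
rewrite IHs /=; case: (boolP (e %| k)) => ek /=; last by rewrite eq_card0 // => i; rewrite !inE.
congr (_ + _); have /dvdnP[m ->] := sd e (mem_head _ _) ek.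
by rewrite mulnK // -[RHS](card_multiples d m); apply: eq_card => i; rewrite !inE.
Qed.

(** A cycle of length [e] has [e / d] points labelled 0, so this is [even_fibre] for the subsquare
    [fixed k]. *)
Lemma even_orbits s k d : realizable (@rotate s 0) -> ~~ odd d -> 0 < d ->
  {in s, forall e, e %| k -> d %| e} ->
  ~~ odd (sumn [seq e %/ d | e <- s & e %| k]).
Proof.
case: d => // d [op [opL opa]] ev _ sd.
rewrite -card_residue //.
apply: (even_fibre opL opa (@rotate_inj s 0)) => //.
- by move=> x; apply: fixed_act.
- by move=> x y; apply: fixed_opr.
- by move=> x y; apply: fixed_opl.
by move=> x xk; apply: residue_rotate xk sd.
Qed.

Section ThreeCycles.
Variables (d1 d2 d3 f : nat).
Hypotheses (d3_gt1 : 1 < d3) (d32 : d3 <= d2) (d21 : d2 <= d1).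
Let T := model [:: d1; d2; d3] f.
Hypothesis real : realizable (@rotate [:: d1; d2; d3] f).

Let m1 : 0 < d1. Proof. lia. Qed.
Let m2 : 0 < d2. Proof. lia. Qed.
Let m3 : 0 < d3. Proof. lia. Qed.
Let z1 : T := inl (Ordinal m1).
Let z2 : T := inr (inl (Ordinal m2)).
Let z3 : T := inr (inr (inl (Ordinal m3))).

Let ndvd e d : d < e -> 0 < d -> (e %| d) = false.
Proof. by move=> de d0; apply/negP => /(dvdn_leq d0); lia. Qed.

Let fixE k : [/\ forall i : 'I_d1, ((inl i : T) \in fixed _ f k) = (d1 %| k),
  forall i : 'I_d2, ((inr (inl i) : T) \in fixed _ f k) = (d2 %| k),
  forall i : 'I_d3, ((inr (inr (inl i)) : T) \in fixed _ f k) = (d3 %| k) &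
  forall i : 'I_f, ((inr (inr (inr i)) : T) \in fixed _ f k)].
Proof.
split=> i.
- exact: fixed_inl.
- exact: etrans (fixed_inr _ _ _) (fixed_inl _ _ _ _).
- exact: etrans (fixed_inr _ _ _) (etrans (fixed_inr _ _ _) (fixed_inl _ _ _ _)).
by rewrite inE !iter_inr; apply/eqP; congr (inr (inr (inr _))); elim: k.
Qed.

Let cardE k : #|fixed [:: d1; d2; d3] f k| =
  (if d1 %| k then d1 else 0) + (if d2 %| k then d2 else 0) +
  (if d3 %| k then d3 else 0) + f.
Proof. by rewrite card_fixed /=; do 3!case: ifP => _ /=; lia. Qed.

Let bound k l z : k %| l -> z \in fixed [:: d1; d2; d3] f l ->
  z \notin fixed [:: d1; d2; d3] f k ->
  2 * #|fixed [:: d1; d2; d3] f k| <= #|fixed [:: d1; d2; d3] f l|.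
Proof. by case: real => op [opL opa]; exact: (fixed_bound opL opa). Qed.

Let parity k d : ~~ odd d -> 0 < d ->
  {in [:: d1; d2; d3], forall e, e %| k -> d %| e} ->
  odd (sumn [seq e %/ d | e <- [:: d1; d2; d3] & e %| k]) -> 0 < f.
Proof.
move=> ed d0 h; case: (posnP f) => // f0 o; move: real; rewrite f0 => r.
by have := even_orbits r ed d0 h; rewrite o.
Qed.

(** Both claims come from the subsquare of [a ^ d3], which consists of the shortest cycle and the
    fixed points. *)
Lemma necessary_fixed_lt : d3 < d2 -> f <= d3 /\ (~~ odd d3 -> 0 < f).
Proof.
move=> lt32; have n23 := ndvd lt32 m3; have n13 : (d1 %| d3) = false by apply: ndvd; lia.
have [_ _ h3 _] := fixE d3; have [_ _ h1 _] := fixE 1.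
have n31 : (d3 %| 1) = false by apply: ndvd.
split.
  have := @bound 1 d3 z3 (dvd1n _); rewrite h3 dvdnn h1 n31 !cardE n13 n23 n31 dvdnn.
  have -> : (d1 %| 1) = false by apply: ndvd; lia.
  have -> : (d2 %| 1) = false by apply: ndvd; lia.
  by move=> /(_ isT isT); lia.
move=> ev; apply: (@parity d3 d3) => //.
  by move=> e; rewrite !inE => /or3P[] /eqP->; rewrite ?n13 ?n23.
by rewrite /= n13 n23 dvdnn /= divnn m3.
Qed.

Lemma necessary_equal : d1 = d2 -> d2 = d3 -> f <= 3 * d1 /\ (~~ odd d1 -> 0 < f).
Proof.
move=> e12 e23; have [h1 _ _ _] := fixE d1; have [g1 _ _ _] := fixE 1.
have n1 : (d1 %| 1) = false by apply: ndvd; lia.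
split.
  have := @bound 1 d1 z1 (dvd1n _); rewrite h1 dvdnn g1 n1 !cardE -e23 -e12 dvdnn n1.
  by move=> /(_ isT isT); lia.
move=> ev; apply: (@parity d1 d1) => //.
  by move=> e; rewrite -e23 -e12 !inE => /or3P[] /eqP->.
by rewrite -e23 -e12 /= dvdnn /= divnn m1.
Qed.

Lemma necessary_small_twice : d2 < d1 -> d2 = d3 ->
  [/\ 2 * d2 + f <= d1, d2 %| d1, f <= 2 * d2 &
      ~~ odd d2 /\ odd (d1 %/ d2) -> 0 < f].
Proof.
move=> lt21 e23; have n12 : (d1 %| d2) = false by apply: ndvd.
have n11 : (d1 %| 1) = false by apply: ndvd; lia.
have n21 : (d2 %| 1) = false by apply: ndvd; lia.
have [h1 h2 h3 _] := fixE d2; have [k1 k2 _ _] := fixE d1.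
have dv : d2 %| d1.
  (* [z2] lies in the subsquare of [a ^ d2] and [z1] does not, so their product is in the long
     cycle. Then [a ^ d1] fixes the product and [z1], hence also [z2]. *)
  have [op [opL opa]] := real.
  have : op z2 z1 \notin fixed _ f d2.
    by rewrite (fixed_opr opL opa) ?h2 // h1 n12.
  case E : (op z2 z1) => [i|[i|[i|i]]].
  - move=> _; have := fixed_opl opL opa z2 (k := d1) (y := z1).
    by rewrite E !k1 k2 dvdnn => <-.
  - by rewrite h2 dvdnn.
  - by rewrite h3 -e23 dvdnn.
  by have [_ _ _ ->] := fixE d2.
have [t1 _ _ _] := fixE (d1 * d2 * d3); have [_ u2 _ _] := fixE 1.
split=> //.
(* This power fixes every point, so the larger subsquare is the whole square. *)
- have e1 : d1 %| d1 * d2 * d3 by rewrite -mulnA dvdn_mulr.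
  have e2 : d2 %| d1 * d2 * d3 by rewrite mulnAC dvdn_mull.
  have := @bound d2 (d1 * d2 * d3) z1 e2.
  rewrite t1 h1 n12 e1 => /(_ isT isT).
  by rewrite !cardE n12 dvdnn e1 e2 -e23 dvdnn dvdn_mull //; lia.
- have := @bound 1 d2 z2 (dvd1n _).
  by rewrite h2 u2 n21 dvdnn => /(_ isT isT); rewrite !cardE -e23 n12 n11 n21 dvdnn; lia.
case=> ev od; apply: (@parity d1 d2) => //.
  by move=> e; rewrite -e23 !inE => /or3P[] /eqP->.
by rewrite -e23 /= dvdnn dv /= divnn m2 !oddD od.
Qed.

Lemma necessary_large_twice : d1 = d2 -> d3 < d2 -> d3 %| d1.
Proof.
move=> e12 lt32; have n23 := ndvd lt32 m3.
have [h1 h2 h3 h4] := fixE d3; have [k1 k2 k3 _] := fixE d1.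
have [op [opL opa]] := real.
have : op z3 z1 \notin fixed _ f d3.
  by rewrite (fixed_opr opL opa) ?h3 // h1 e12 n23.
have := fixed_opl opL opa z3 (k := d1) (y := z1).
rewrite k1 k3 dvdnn; case: (op z3 z1) => [i|[i|[i|i]]] <- //.
- by rewrite k1 dvdnn.
- by rewrite k2 e12 dvdnn.
- by rewrite h3 dvdnn.
by rewrite h4.
Qed.

Lemma necessary_distinct : d3 < d2 -> d2 < d1 ->
  (d3 %| d2 /\ d2 %| d1) \/ (d1 = lcmn d2 d3 /\ (~~ odd d1 -> 0 < f)).
Proof.
move=> lt32 lt21.
have n23 := ndvd lt32 m3; have n12 : (d1 %| d2) = false by apply: ndvd.
have n13 : (d1 %| d3) = false by apply: ndvd; lia.
have [h1 h2 h3 h4] := fixE d2; have [k1 k2 k3 _] := fixE d1.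
have [g1 g2 g3 g4] := fixE d3; have [op [opL opa]] := real.
have [dv|ndv] := boolP (d3 %| d2).
  left; split=> //.
  have : op z2 z1 \notin fixed _ f d2.
    by rewrite (fixed_opr opL opa) ?h2 // h1 n12.
  have := fixed_opl opL opa z2 (k := d1) (y := z1).
  rewrite k1 k2 dvdnn; case: (op z2 z1) => [i|[i|[i|i]]] <- //.
  - by rewrite k1 dvdnn.
  - by rewrite h2 dvdnn.
  - by rewrite h3 dv.
  by rewrite h4.
right.
have inj1 d (F : 'I_d1 -> 'I_d) : d < d1 -> injective F -> False.
  by move=> dd1 /leq_card; rewrite !card_ord; lia.
have injop z : injective (fun i : 'I_d1 => op z (inl i)).
  by move=> i j /(proj1 opL) [].
have d2d1 : d2 %| d1.
  (* Otherwise multiplication by [z2] would map the long cycle injectively into the cycle of length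
     [d3]. *)
  apply/negP => /negP nd; have N (i : 'I_d1) : exists j : 'I_d3, op z2 (inl i) = inr (inr (inl j)).
    have : op z2 (inl i) \notin fixed _ f d2.
      by rewrite (fixed_opr opL opa) ?h2 // h1 n12.
    have := fixed_opl opL opa z2 (k := d1) (y := inl i).
    rewrite k1 k2 dvdnn (negPf nd); case: (op z2 (inl i)) => [j|[j|[j|j]]].
    - by rewrite k1 dvdnn => /(_ isT).
    - by rewrite h2 dvdnn.
    - by exists j.
    by rewrite h4.
  have [F FE] := fin_all_exists N.
  apply: (inj1 d3 F) => [|i j ij]; first lia.
  by apply: (injop z2); rewrite /= !FE ij.
have d3d1 : d3 %| d1.
  apply/negP => /negP nd; have N (i : 'I_d1) : exists j : 'I_d2, op z3 (inl i) = inr (inl j).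
    have : op z3 (inl i) \notin fixed _ f d3.
      by rewrite (fixed_opr opL opa) ?g3 // g1 n13.
    have := fixed_opl opL opa z3 (k := d1) (y := inl i).
    rewrite k1 k3 dvdnn (negPf nd); case: (op z3 (inl i)) => [j|[j|[j|j]]].
    - by rewrite k1 dvdnn => /(_ isT).
    - by exists j.
    - by rewrite g3 dvdnn.
    by rewrite g4.
  have [F FE] := fin_all_exists N.
  apply: (inj1 d2 F) => // i j ij.
  by apply: (injop z3); rewrite /= !FE ij.
(* The product of [z2] and [z3] avoids the subsquares of [a ^ d2] and [a ^ d3], so it is in the long
   cycle, yet the power [lcmn d2 d3] fixes it. *)
have d1l : d1 %| lcmn d2 d3.
  have a2 : op z2 z3 \notin fixed _ f d2.
    by rewrite (fixed_opr opL opa) ?h2 // h3.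
  have a3 : op z2 z3 \notin fixed _ f d3.
    by rewrite (fixed_opl opL opa) ?g3 // g2 n23.
  have [l1 l2 l3 _] := fixE (lcmn d2 d3).
  have := fixed_opl opL opa z2 (k := lcmn d2 d3) (y := z3).
  rewrite l3 l2 dvdn_lcml dvdn_lcmr => /(_ isT).
  case: (op z2 z3) a2 a3 => [j|[j|[j|j]]] => [_ _|+ _|_|+ _]; rewrite ?l1 //.
  - by rewrite h2 dvdnn.
  - by rewrite g3 dvdnn.
  by rewrite h4.
split.
  by apply/eqP; rewrite eqn_dvd d1l dvdn_lcm d2d1.
(* If [d1] is even and [d3] odd, then [d2] is even, and its cycle is the only one in the subsquare
   of [a ^ d2]. *)
move=> ev; have [o3|e3] := boolP (odd d3); last by have [_] := necessary_fixed_lt lt32; apply.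
have e2 : ~~ odd d2.
  apply: contra ev => o2; apply: dvdn_odd d1l _.
  by apply: (@dvdn_odd _ (d2 * d3)); rewrite ?oddM ?o2 // dvdn_lcm dvdn_mulr // dvdn_mull.
apply: (@parity d2 d2) => //.
  by move=> e; rewrite !inE => /or3P[] /eqP->; rewrite ?n12 ?(negPf ndv).
by rewrite /= n12 dvdnn (negPf ndv) /= divnn m2.
Qed.

End ThreeCycles.

(** * Orbits of a permutation *)

Lemma seq_map_perm (T S : eqType) (f : T -> S) (s : seq T) (t : seq S) :
  perm_eq (map f s) t -> exists2 s', perm_eq s' s & map f s' = t.
Proof.
elim: t s => [|b t IHt] s.
  by move/perm_size; rewrite size_map => /size0nil ->; exists [::].
move=> e; have : b \in map f s by rewrite (perm_mem e) inE eqxx.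
case/mapP => a a_s ba; have pa := perm_to_rem a_s.
have : perm_eq (map f (rem a s)) t.
  rewrite -(perm_cons b); apply: perm_trans e; rewrite perm_sym.
  by rewrite {1}ba -map_cons; apply: perm_map.
case/IHt => s' s'P s't; exists (a :: s'); last by rewrite /= s't ba.
by rewrite perm_sym; apply: perm_trans pa _; rewrite perm_cons perm_sym.
Qed.

(** The description of the image is carried through the induction: it separates the next cycle from
    the earlier ones and finally gives surjectivity. *)
Lemma orbits_model n (alpha : 'S_n) (cs : seq {set 'I_n}) :
  uniq cs -> {subset cs <= porbits alpha} -> all (fun c : {set 'I_n} => 1 < #|c|) cs ->
  exists F : model [seq #|c| | c : {set 'I_n} <- cs] #|fixed_points alpha| -> 'I_n,
    [/\ forall x, F (rotate x) = alpha (F x), injective F &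
        forall y, (y \in fixed_points alpha) || has (fun c : {set 'I_n} => y \in c) cs
                    <-> exists x, F x = y].
Proof.
elim: cs => [|c cs IHcs] /=.
  move=> _ _ _; exists (@enum_val _ (mem (fixed_points alpha))); split.
  - by move=> x; have := enum_valP x; rewrite inE => /eqP.
  - exact: enum_val_inj.
  move=> y; rewrite orbF; split=> [yf|[x <-]]; last exact: enum_valP.
  by exists (enum_rank_in yf y); rewrite enum_rankK_in.
case/andP => c_cs ucs sub /andP[c_gt1 cs_gt1].
have subcs : {subset cs <= porbits alpha} by move=> b bcs; apply: sub; rewrite inE bcs orbT.
have [F [Fa Fi FP]] := IHcs ucs subcs cs_gt1.
have /imsetP[x _ cx] : c \in porbits alpha by apply: sub; rewrite mem_head.
have iterc k : iter k alpha x \in c by rewrite cx -permX mem_porbit.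
have notF z : F z \notin c.
  have /FP /orP[] : exists w, F w = F z by exists z.
    apply: contraTN => zc; rewrite inE.
    apply: contraTneq c_gt1 => az; rewrite cx -leqNgt; rewrite cx in zc.
    have -> : porbit alpha x = porbit alpha (F z) by apply/eqP; rewrite eq_porbit_mem porbit_sym.
    rewrite (@eq_card _ _ (mem [set F z])) ?cards1 // => w; rewrite [RHS]inE.
    apply/porbitP/eqP => [[i ->]|->]; last by exists 0; rewrite expg0 perm1.
    by rewrite permX; elim: i => //= i ->.
  case/hasP => b b_cs zb; apply: contra c_cs => zc.
  have /imsetP[w _ bw] := subcs _ b_cs.
  suff -> : c = b by [].
  rewrite cx bw in zc zb *; transitivity (porbit alpha (F z)); apply/eqP.
    by rewrite eq_porbit_mem porbit_sym.
  by rewrite eq_porbit_mem.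
exists (fun u : model (#|c| :: _) _ => match u with inl i => iter i alpha x | inr z => F z end).
split.
- by case=> [i|z] /=; rewrite ?Fa // iter_modn // cx iter_porbit.
- case=> [i|z] [j|w] /= e.
  + congr inl; apply: val_inj; have := uniq_traject_porbit alpha x.
    rewrite -cx => /(nth_uniq x); rewrite size_traject => /(_ i j (ltn_ord i) (ltn_ord j)).
    by rewrite !nth_traject // e eqxx => /esym/eqP.
  + by have := notF w; rewrite -e iterc.
  + by have := notF z; rewrite e iterc.
  by congr inr; apply: Fi.
move=> y; rewrite orbCA; split=> [/orP[yc|/FP[z <-]]|[[i|z] <-]].
- have : y \in traject alpha x #|c| by rewrite cx -porbit_traject -cx.
  by case/trajectP => i ic ->; exists (inl (Ordinal ic)).
- by exists (inr z).
- by rewrite iterc.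
by apply/orP; right; apply/FP; exists z.
Qed.

Lemma AutLS_realizable n (alpha : 'S_n) :
  alpha \in AutLS n <-> realizable alpha.
Proof.
rewrite inE; split.
  case/existsP => L /andP[/andP[/forallP Lr /forallP Lc] /forallP La].
  exists (fun i j => L i j); split; first split.
  - by move=> i; apply/injectiveP/Lr.
  - by move=> j; apply/injectiveP/Lc.
  by move=> i j; apply/eqP; have /forallP := La i; apply.
case=> op [[opr opc] opa]; apply/existsP; exists (\matrix_(i, j) op i j)%R.
apply/andP; split; last by apply/'forall_'forall_eqP => i j; rewrite !mxE opa.
apply/andP; split; apply/forallP => i; apply/injectiveP => j k; rewrite !mxE.
  by move/opr.
by move/opc.
Qed.

Lemma AutLS_rotate n (alpha : 'S_n) (s : seq nat) :
  perm_eq (nontrivial_cycle_lengths alpha) s ->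
  alpha \in AutLS n <-> realizable (@rotate s #|fixed_points alpha|).
Proof.
case/seq_map_perm => cs csP <-.
have csE c : (c \in cs) = (1 < #|c|) && (c \in porbits alpha).
  by rewrite (perm_mem csP) mem_filter mem_enum.
have ucs : uniq cs by rewrite (perm_uniq csP) filter_uniq ?enum_uniq.
have [||F [Fa Fi FP]] := orbits_model (alpha := alpha) ucs.
- by move=> c; rewrite csE => /andP[].
- by apply/allP => c; rewrite csE => /andP[].
have Fs y : exists x, F x = y.
  apply/FP; rewrite inE; have [//|ay] := eqVneq (alpha y) y.
  apply/hasP; exists (porbit alpha y); last exact: porbit_id.
  rewrite csE imset_f // andbT ltnNge; apply: contra ay => c1.
  by apply/eqP/(card_le1_eqP c1); rewrite ?porbit_id // (mem_porbit alpha 1).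
have Fb : bijective F.
  have [g gK] := fin_all_exists Fs; exists g => // x; exact: Fi.
have [g FK gK] := Fb.
have ga x : g (alpha x) = rotate (g x) by apply: Fi; rewrite gK Fa gK.
apply: (iff_trans (AutLS_realizable _)); split.
  exact: realizable_transfer Fb Fa.
by apply: realizable_transfer ga; exists F.
Qed.

Lemma nontrivial_cycle_lengths_gt1 n (alpha : 'S_n) d :
  d \in nontrivial_cycle_lengths alpha -> 1 < d.
Proof. by case/mapP => c; rewrite mem_filter => /andP[c1 _] ->. Qed.

Theorem theorem8p1 (n : nat) (alpha : 'S_n) (d1 d2 d3 dinf : nat)
  (hcycles : perm_eq (nontrivial_cycle_lengths alpha) [:: d1; d2; d3])
  (h12 : d2 <= d1) (h23 : d3 <= d2)
  (hinf : dinf = #|fixed_points alpha|) :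
  alpha \in AutLS n <->
  ([/\ d1 = d2 /\ d2 = d3,
       dinf <= 3 * d1 &
       ~~ odd d1 -> 1 <= dinf]
   \/
   [/\ d2 < d1 /\ d2 = d3,
       2 * d2 + dinf <= d1,
       d2 %| d1,
       dinf <= 2 * d2 &
       ~~ odd d2 /\ odd (d1 %/ d2) -> 0 < dinf]
   \/
   [/\ d1 = d2 /\ d3 < d2,
       d3 %| d1,
       dinf <= d3 &
       ~~ odd d3 -> 0 < dinf]
   \/
   [/\ d2 < d1 /\ d3 < d2,
       d1 = lcmn d2 d3,
       dinf <= d3 &
       ~~ odd d1 -> 0 < dinf]
   \/
   [/\ d2 < d1 /\ d3 < d2,
       d3 %| d2 /\ d2 %| d1,
       dinf <= d3 &
       ~~ odd d3 -> 0 < dinf]).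
Proof.
have gt1 e : e \in [:: d1; d2; d3] -> 1 < e.
  by rewrite -(perm_mem hcycles); apply: nontrivial_cycle_lengths_gt1.
have d3_gt1 : 1 < d3 by apply: gt1; rewrite !inE eqxx !orbT.
have d3_gt0 := ltnW d3_gt1.
apply: (iff_trans (AutLS_rotate hcycles)); rewrite -hinf; split=> [real|].
  have [h23'|h23'] := ltnP d3 d2.
    have [f_le ev] := necessary_fixed_lt d3_gt1 h23 h12 real h23'.
    have [h12'|h12'] := ltnP d2 d1; last first.
      have e12 : d1 = d2 by apply/eqP; rewrite eqn_leq h12 h12'.
      right; right; left; split=> //.
      exact: (necessary_large_twice d3_gt1 h23 h12 real e12 h23').
    have [dv|[lcm12 ev1]] := necessary_distinct d3_gt1 h23 h12 real h23' h12'.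
      by right; right; right; right; split.
    by right; right; right; left; split.
  have e23 : d2 = d3 by apply/eqP; rewrite eqn_leq h23 h23'.
  have [h12'|h12'] := ltnP d2 d1.
    right; left.
    by have [] := necessary_small_twice d3_gt1 h23 h12 real h12' e23; split.
  have e12 : d1 = d2 by apply/eqP; rewrite eqn_leq h12 h12'.
  by left; have [] := necessary_equal d3_gt1 h23 h12 real e12 e23; split.
case=> [[[e12 e23] f_le ev]|]; first by subst; apply: realizable_three_equal.
case=> [[[lt12 e23] d1_ge dv f_le ev]|]; first by subst; apply: realizable_one_large_two_small.
case=> [[[e12 lt23] dv f_le ev]|]; first by subst; apply: realizable_two_large_one_small.
case=> [[[lt12 lt23] lcm12 f_le ev]|[[lt12 lt23] [dv32 dv21] f_le ev]]; last first.
  exact: realizable_divisor_chain.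
rewrite lcm12 in ev *; apply: realizable_coprime_blocks => //.
(* If [d3] divided [d2], the lcm would be [d2], which is less than [d1]. *)
by apply: contraTN lt12 => dv; rewrite lcm12 (lcmn_idPl dv) ltnn.
Qed.
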